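(* Let $\mathfrak g$ be a finite-dimensional simple Lie algebra over $\mathbb C$ with associated affine Kac-Moody algebra $\hat{\mathfrak g}$, let $\sigma:\hat I\to\hat I$ be an automorphism of the affine Dynkin diagram of $\hat{\mathfrak g}$, and let $j=\sigma(0)$. Denote also by $\sigma$ the automorphism of $\hat P$ determined by $\sigma(\Lambda_i)=\Lambda_{\sigma^{-1}(i)}$ for $i\in\hat I$ and $\sigma(\delta)=\delta$. Let $\Lambda,\Phi\in\hat P^+$ be such that $\Phi\le\Lambda_j+\Lambda$, and let $c_i\in\mathbb Z_{\ge0}$, $i\in\hat I$, be the integers such that $\Lambda_j+\Lambda-\Phi=\sum_{i\in\hat I}c_i\alpha_i$. Then $$[V(\Lambda_j)\otimes V(\Lambda):V(\Phi)]=[V(\Lambda_0)\otimes V(\sigma(\Lambda)):V(\sigma(\Phi)+(c_0-c_j)\delta)].$$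
   Context: **Finite-dimensional data.** $\mathfrak h$ is a Cartan subalgebra of $\mathfrak g$, $\alpha_i,\omega_i$ ($i\in I$) the simple roots and fundamental weights, $h_i$ the simple coroots, $\theta$ the highest root, $h_\theta$ its coroot. **Affine algebra.** $\hat{\mathfrak g}=\mathfrak g\otimes\mathbb C[t,t^{-1}]\oplus\mathbb Cc\oplus\mathbb Cd$ with $c$ central, $[x\otimes t^r,y\otimes t^s]=[x,y]\otimes t^{r+s}+r\delta_{r,-s}(x,y)c$, $[d,x\otimes t^r]=r\,x\otimes t^r$, where $(\,,)$ is the invariant form normalized so that long roots have squared length 2. $\hat{\mathfrak h}=\mathfrak h\oplus\mathbb Cc\oplus\mathbb Cd$; $\mathfrak h^*$ is identified with $\{\lambda\in\hat{\mathfrak h}^*:\lambda(c)=\lambda(d)=0\}$. $\Lambda_0,\delta\in\hat{\mathfrak h}^*$ are given by $\Lambda_0(d)=0=\Lambda_0(\mathfrak h)$, $\Lambda_0(c)=1$, $\delta(c)=0=\delta(\mathfrak h)$, $\delta(d)=1$. $\hat I=I\sqcup\{0\}$, $\alpha_0=\delta-\theta$, $h_0=c-h_\theta$, $\Lambda_i=\omega_i+\omega_i(h_\theta)\Lambda_0$ for $i\in I$; thus $\Lambda_i(h_j)=\delta_{i,j}$. $\hat P=\{\lambda\in\hat{\mathfrak h}^*:\lambda(h_i)\in\mathbb Z\ \forall i\in\hat I\}=\mathbb C\delta\oplus\bigoplus_{i\in\hat I}\mathbb Z\Lambda_i$ and $\hat P^+=\{\lambda\in\hat P:\lambda(h_i)\ge0\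 \forall i\in\hat I\}$. The map $\sigma$ on $\hat P$ is $\mathbb C$-linear on $\mathbb C\delta$. For $\lambda,\mu\in\hat P$, $\mu\le\lambda$ means $\lambda-\mu\in\bigoplus_{i\in\hat I}\mathbb Z_{\ge0}\alpha_i$. A diagram automorphism is a permutation $\sigma$ of $\hat I$ with $\alpha_{\sigma(k)}(h_{\sigma(i)})=\alpha_k(h_i)$ for all $i,k\in\hat I$. **Integrable modules.** For $\Lambda\in\hat P^+$, $V(\Lambda)$ is the irreducible integrable $\hat{\mathfrak g}$-module of highest weight $\Lambda$. If $V\cong\bigoplus_{\Phi\in\hat P^+}V(\Phi)^{\oplus m_\Phi}$ with $m_\Phi\in\mathbb Z_{\ge0}$ (as tensor products of two such irreducibles do), then $[V:V(\Phi)]:=m_\Phi$. *)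

(* Defs.v *)
From HB Require Import structures.
From mathcomp Require Import all_boot all_order all_fingroup all_algebra.
From mathcomp Require Import finmap monalg.
From mathcomp Require Import boolp reals.
From mathcomp Require Import complex.

Set Implicit Arguments.
Unset Strict Implicit.
Unset Printing Implicit Defensive.

Import Order.TTheory GRing.Theory Num.Theory.
Local Open Scope ring_scope.

Reserved Notation "[ 'lie' x , y ]" (format "[ 'lie'  x ,  y ]").
Reserved Notation "x ⋅ v" (at level 40, left associativity).

HB.mixin Record isLieAlgebra (K : fieldType) L of GRing.Lmodule K L := {
  lie : L -> L -> L;
  lie_is_linearl : forall y, linear (lie^~ y);
  lie_is_linearr : forall x, linear (lie x);
  liexx : forall x, lie x x = 0;
  lie_jacobi : forall x y z,
    lie x (lie y z) + lie y (lie z x) + lie z (lie x y) = 0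
}.

#[short(type="lieAlgType")]
HB.structure Definition LieAlgebra (K : fieldType) :=
  {L of GRing.Lmodule K L & isLieAlgebra K L}.

#[short(type="finLieAlgType")]
HB.structure Definition FinLieAlgebra (K : fieldType) :=
  {L of LieAlgebra K L & Vector K L}.

Notation "[ 'lie' x , y ]" := (lie x y) : ring_scope.

HB.mixin Record isLieModule (K : fieldType) (L : lieAlgType K) V
    of GRing.Lmodule K V := {
  lie_act : L -> V -> V;
  lie_act_is_linearl : forall v, linear (lie_act^~ v);
  lie_act_is_linearr : forall x, linear (lie_act x);
  lie_act_bracket : forall x y v,
    lie_act [lie x, y] v = lie_act x (lie_act y v) - lie_act y (lie_act x v)
}.

#[short(type="lieModType")]
HB.structure Definition LieModule (K : fieldType) (L : lieAlgType K) :=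
  {V of GRing.Lmodule K V & isLieModule K L V}.

Notation "x ⋅ v" := (lie_act x v) : ring_scope.

Section Bilinear.
Context (K : fieldType) (L : lieAlgType K).
Implicit Types x y z : L.

HB.instance Definition _ x :=
  GRing.isLinear.Build K L L _ (lie x) (lie_is_linearr x).

Lemma lieDl x y z : [lie x + y, z] = [lie x, z] + [lie y, z].
Proof. by have := lie_is_linearl z 1 x y; rewrite !scale1r. Qed.
Lemma lie0l x : [lie 0, x] = 0.
Proof. by apply: (@addrI _ [lie 0, x]); rewrite -lieDl !addr0. Qed.
Lemma lieZl a x y : [lie a *: x, y] = a *: [lie x, y].
Proof. by have := lie_is_linearl y a x 0; rewrite lie0l !addr0. Qed.
Lemma lieDr x y z : [lie z, x + y] = [lie z, x] + [lie z, y].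
Proof. exact: raddfD. Qed.
Lemma lie0r x : [lie x, 0] = 0.
Proof. exact: raddf0. Qed.
Lemma lieZr a x y : [lie x, a *: y] = a *: [lie x, y].
Proof. exact: linearZ. Qed.

Lemma lieC x y : [lie x, y] = - [lie y, x].
Proof.
apply/eqP; rewrite -addr_eq0; apply/eqP.
by have := liexx (x + y); rewrite lieDl !lieDr !liexx addr0 add0r.
Qed.
End Bilinear.

Definition bilinear_map (K : fieldType) (U V W : lmodType K)
    (f : U -> V -> W) :=
  (forall v, linear (f^~ v)) /\ (forall u, linear (f u)).

Section Modules.
Context (K : fieldType) (L : lieAlgType K).
Implicit Types V W T : lieModType L.

Definition module_hom V W (f : V -> W) :=
  linear f /\ forall x v, f (x ⋅ v) = x ⋅ f v.

Definition submodule V (U : V -> Prop) :=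
  [/\ U 0, forall (a : K) u v, U u -> U v -> U (a *: u + v)
    & forall x u, U u -> U (x ⋅ u)].

Definition irreducible V :=
  (exists v : V, v <> 0) /\
  forall U : V -> Prop, submodule U ->
    (forall v, U v -> v = 0) \/ (forall v, U v).

(* [tau] is a universal bilinear map, and [x] acts on [v (x) w] by
   [x v (x) w + v (x) x w]. *)
Definition tensor_product V W T (tau : V -> W -> T) :=
  [/\ bilinear_map tau,
      forall (Z : lmodType K) (f : V -> W -> Z), bilinear_map f ->
        exists phi : T -> Z,
          [/\ linear phi, forall v w, phi (tau v w) = f v w
            & forall psi : T -> Z, linear psi ->
                (forall v w, psi (tau v w) = f v w) -> psi =1 phi]
    & forall x v w, x ⋅ tau v w = tau (x ⋅ v) w + tau v (x ⋅ w)].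

(* [V] is isomorphic to the (external) direct sum of the family [M]: it is
   the internal direct sum of the images of homomorphisms [iota j]. *)
Definition iso_direct_sum V (J : eqType) (M : J -> lieModType L) :=
  exists iota : forall j, M j -> V,
    [/\ forall j, module_hom (iota j),
        forall v, exists (s : seq J) (x : forall j, M j),
          v = \sum_(j <- s) iota j (x j)
      & forall (s : seq J) (x : forall j, M j), uniq s ->
          \sum_(j <- s) iota j (x j) = 0 -> forall j, j \in s -> x j = 0].

End Modules.

Definition simple_lie (K : fieldType) (g : finLieAlgType K) :=
  (exists x y : g, [lie x, y] <> 0) /\
  forall U : {vspace g}, (forall x y, y \in U -> [lie x, y] \in U) ->
    U = 0%VS \/ U = fullv.

Section Cartan.
Context (K : fieldType) (g : finLieAlgType K).

Definition abelian_subspace (U : {vspace g}) :=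
  forall x y, x \in U -> y \in U -> [lie x, y] = 0.

Definition ad_diagonalizable (x : g) :=
  exists2 b : seq g, basis_of fullv b &
    forall y, y \in b -> exists a : K, [lie x, y] = a *: y.

(* Cartan subalgebras of a semisimple Lie algebra over an algebraically
   closed field of characteristic 0: maximal abelian subalgebras all of whose
   elements are ad-semisimple. *)
Definition cartan_subalgebra (h : {vspace g}) :=
  [/\ abelian_subspace h,
      forall U : {vspace g}, abelian_subspace U -> (h <= U)%VS -> U = h
    & forall x, x \in h -> ad_diagonalizable x].

Definition hdual (h : {vspace g}) := 'Hom(subvs_of h, K^o).

Definition is_root (h : {vspace g}) (beta : hdual h) :=
  beta <> 0 /\
  exists2 x : g, x <> 0 &
    forall H : subvs_of h, [lie vsval H, x] = (beta H : K) *: x.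

End Cartan.

Record invForm (K : fieldType) (g : lieAlgType K) := InvForm {
  form_fun :> g -> g -> K;
  form_linearl : forall y, linear (form_fun^~ y : g -> K^o);
  form_sym : forall x y, form_fun x y = form_fun y x;
  form_inv : forall x y z, form_fun [lie x, y] z = form_fun x [lie y, z]
}.

Section InvForm.
Context (K : fieldType) (g : lieAlgType K) (B : invForm g).

Lemma formDl x y z : B (x + y) z = B x z + B y z.
Proof. by have := form_linearl B z 1 x y; rewrite !scale1r. Qed.
Lemma form0l x : B 0 x = 0.
Proof. by apply: (@addrI _ (B 0 x)); rewrite -formDl !addr0. Qed.
Lemma formZl a x y : B (a *: x) y = a * B x y.
Proof. by have := form_linearl B y a x 0; rewrite form0l !addr0. Qed.
Lemma formDr x y z : B z (x + y) = B z x + B z y.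
Proof. by rewrite form_sym formDl !(form_sym B z). Qed.
Lemma form0r x : B x 0 = 0.
Proof. by rewrite form_sym form0l. Qed.
Lemma formZr a x y : B x (a *: y) = a * B x y.
Proof. by rewrite form_sym formZl form_sym. Qed.

Lemma form_linearr x : linear (B x : g -> K^o).
Proof. by move=> a y z; rewrite formDr formZr. Qed.
HB.instance Definition _ x :=
  GRing.isLinear.Build K g K^o _ (B x) (form_linearr x).

Definition nondegenerate := forall x, (forall y, B x y = 0) -> x = 0.
End InvForm.

Section DualForm.
Context (K : fieldType) (g : finLieAlgType K).
Context (B : invForm g) (h : {vspace g}).

Definition form_at (H : subvs_of h) : hdual h :=
  linfun ((B (vsval H) : g -> K^o) \o vsval).

Lemma form_atE (H H' : subvs_of h) : form_at H H' = B (vsval H) (vsval H').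
Proof. by rewrite lfunE. Qed.

Lemma form_at_is_linear : linear form_at.
Proof.
move=> a H H'; apply/lfunP => X.
by rewrite add_lfunE scale_lfunE !form_atE linearP formDl formZl.
Qed.
HB.instance Definition _ :=
  GRing.isLinear.Build K (subvs_of h) (hdual h) _ form_at form_at_is_linear.

(* [h -> h^*] induced by the form; bijective as soon as the form is
   nondegenerate on [h], so that [nu^-1] below is its inverse. *)
Definition nu : 'Hom(subvs_of h, hdual h) := linfun form_at.

Lemma nuE (H H' : subvs_of h) : nu H H' = B (vsval H) (vsval H').
Proof. by rewrite lfunE /= form_atE. Qed.

(* the form on [h^*] transported from [h] by [nu] *)
Definition dform (beta gamma : hdual h) : K :=
  B (vsval ((nu^-1)%VF beta)) (vsval ((nu^-1)%VF gamma)).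

Definition coroot (beta : hdual h) : subvs_of h :=
  (2 / dform beta beta) *: (nu^-1)%VF beta.

End DualForm.

(* [dform beta beta = 2] for the roots [beta] of maximal squared length *)
Definition normalized_form (K : numFieldType) (g : finLieAlgType K)
    (B : invForm g) (h : {vspace g}) :=
  [/\ nondegenerate B,
      forall beta : hdual h, is_root beta -> dform B beta beta <= 2
    & exists2 beta : hdual h, is_root beta & dform B beta beta = 2].

Section SimpleRoots.
Context (K : fieldType) (g : finLieAlgType K) (h : {vspace g}).
Context (I : finType) (alpha : I -> hdual h).

Definition simple_roots :=
  [/\ forall i, is_root (alpha i),
      basis_of fullv (codom alpha)
    & forall beta : hdual h, is_root beta ->
        exists n : I -> nat,
          beta = \sum_i (n i)%:R *: alpha i \/
          beta = - \sum_i (n i)%:R *: alpha i].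

Definition highest_root (theta : hdual h) :=
  is_root theta /\
  forall beta : hdual h, is_root beta ->
    exists n : I -> nat, theta - beta = \sum_i (n i)%:R *: alpha i.

End SimpleRoots.

Record cartanData (K : numFieldType) (g : finLieAlgType K) (I : finType) :=
  CartanData {
    cartan : {vspace g};
    nform : invForm g;
    alpha : I -> hdual cartan;
    omega : I -> hdual cartan;
    theta : hdual cartan;
    cartanP : cartan_subalgebra cartan;
    nformP : normalized_form nform cartan;
    alphaP : simple_roots alpha;
    omegaP : forall i j, omega i (coroot nform (alpha j)) = (i == j)%:R;
    thetaP : highest_root alpha theta
  }.

Section Loops.
Context (K : numFieldType) (g : lieAlgType K).

(* [g (x) K[t, t^-1]]: finitely supported families of elements of [g] indexed
   by the exponents of [t]; [<< x *g r >>] is [x (x) t^r]. *)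
Definition loops := {malg g[int]}.
HB.instance Definition _ := GRing.Zmodule.on loops.
Implicit Types f : loops.

Definition loops_scale (a : K) f : loops :=
  [malg r in msupp f => a *: f@_r].

Lemma mcoeff_scale a f r : (loops_scale a f)@_r = a *: f@_r.
Proof. by rewrite mcoeffE; case: msuppP; rewrite ?scaler0. Qed.

Fact loops_scaleA a b f :
  loops_scale a (loops_scale b f) = loops_scale (a * b) f.
Proof. by apply/malgP => r; rewrite !mcoeff_scale scalerA. Qed.
Fact loops_scale1 : left_id 1 loops_scale.
Proof. by move=> f; apply/malgP => r; rewrite mcoeff_scale scale1r. Qed.
Fact loops_scaleDr : right_distributive loops_scale +%R.
Proof.
by move=> a f f'; apply/malgP => r; rewrite mcoeffD !mcoeff_scale mcoeffD scalerDr.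
Qed.
Fact loops_scaleDl f : {morph loops_scale^~ f : a b / a + b}.
Proof.
by move=> a b; apply/malgP => r; rewrite mcoeffD !mcoeff_scale scalerDl.
Qed.
HB.instance Definition _ := GRing.Zmodule_isLmodule.Build K loops
  loops_scaleA loops_scale1 loops_scaleDr loops_scaleDl.

Definition loop_mono (r : int) (x : g) : loops := << x *g r >>.

Lemma loop_mono_is_linear r : linear (loop_mono r).
Proof.
move=> a x y; apply/malgP => s; rewrite mcoeffD mcoeff_scale !mcoeffU.
by case: eqP; rewrite ?mulr1n ?mulr0n ?scaler0 ?addr0.
Qed.
HB.instance Definition _ r :=
  GRing.isLinear.Build K g loops _ (loop_mono r) (loop_mono_is_linear r).

(* Linear extension of [x (x) t^r |-> F r x]. *)
Definition loop_lift (V : lmodType K) (F : int -> g -> V) f : V :=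
  \sum_(r <- msupp f) F r f@_r.

Section Lift.
Context (V : lmodType K) (F : int -> g -> V).
Hypothesis F_linear : forall r, linear (F r).

Let F0 r : F r 0 = 0.
Proof.
have := F_linear r 1 0 0; rewrite !scale1r addr0 => e.
by apply: (@addrI _ (F r 0)); rewrite -e addr0.
Qed.

Lemma loop_liftEw f (A : {fset int}) : (msupp f `<=` A)%fset ->
  loop_lift F f = \sum_(r <- A) F r f@_r.
Proof.
move=> sA; rewrite /loop_lift; apply: big_fset_incl => // r _ /mcoeff_outdom ->.
exact: F0.
Qed.

Lemma loop_lift_linear : linear (loop_lift F).
Proof.
move=> a f f'; pose A := (msupp f `|` msupp f' `|` msupp (a *: f + f'))%fset.
rewrite !(@loop_liftEw _ A); try by apply/fsubsetP => r; rewrite !inE => ->; rewrite ?orbT.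
rewrite scaler_sumr -big_split; apply: eq_bigr => r _ /=.
by rewrite mcoeffD mcoeff_scale F_linear.
Qed.

Lemma loop_lift_mono r x : loop_lift F (loop_mono r x) = F r x.
Proof.
by rewrite (@loop_liftEw _ [fset r]%fset) ?msuppU_le// big_seq_fset1 mcoeffUU.
Qed.
End Lift.

Lemma loops_ext (V : lmodType K) (F G : {linear loops -> V}) :
  (forall r x, F (loop_mono r x) = G (loop_mono r x)) -> F =1 G.
Proof.
move=> e f; rewrite (monalgE f) !raddf_sum.
by apply: eq_bigr => r _; apply: e.
Qed.

Lemma loops_ext0 (V : lmodType K) (F : {linear loops -> V}) :
  (forall r x, F (loop_mono r x) = 0) -> forall f, F f = 0.
Proof. by move=> e; apply: (@loops_ext _ F \0). Qed.

Lemma loop_lift_linear2 (V W : lmodType K) (F : W -> int -> g -> V) f :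
  (forall r x, linear (fun w => F w r x)) -> linear (fun w => loop_lift (F w) f).
Proof.
move=> lF a w w'; rewrite /loop_lift scaler_sumr -big_split /=.
by apply: eq_bigr => r _; rewrite lF.
Qed.

(* [[x (x) t^r, y (x) t^s] = [x, y] (x) t^(r + s)] *)
Definition loop_bracket f f' : loops :=
  loop_lift (fun r x => loop_lift (fun s y => loop_mono (r + s) [lie x, y]) f') f.
Definition loop_bracketr f' f := loop_bracket f f'.

Lemma loop_bracket_linearr f : linear (loop_bracket f).
Proof.
apply: loop_lift_linear2 => r x; apply: loop_lift_linear => s a y y'.
by rewrite linearP linearP.
Qed.
HB.instance Definition _ f :=
  GRing.isLinear.Build K loops loops _ (loop_bracket f) (loop_bracket_linearr f).

Let inner_linear f' r :
  linear (fun x => loop_lift (fun s y => loop_mono (r + s) [lie x, y]) f').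
Proof.
apply: (@loop_lift_linear2 _ g (fun x s y => loop_mono (r + s) [lie x, y])).
by move=> s y b z z'; rewrite lieDl lieZl linearP.
Qed.

Lemma loop_bracket_linearl f' : linear (loop_bracketr f').
Proof. exact/loop_lift_linear/inner_linear. Qed.
HB.instance Definition _ f' :=
  GRing.isLinear.Build K loops loops _ (loop_bracketr f')
    (loop_bracket_linearl f').

Lemma loop_bracket_mono r x s y :
  loop_bracket (loop_mono r x) (loop_mono s y) = loop_mono (r + s) [lie x, y].
Proof.
rewrite /loop_bracket (loop_lift_mono (inner_linear _)) loop_lift_mono // => t a z z'.
by rewrite !linearP.
Qed.

(* the derivation [d = t d/dt] *)
Definition loop_deriv f : loops := loop_lift (fun r x => loop_mono r (r%:~R *: x)) f.

Lemma loop_deriv_is_linear : linear loop_deriv.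
Proof.
by apply: loop_lift_linear => r a x y; rewrite scalerDr !scalerA mulrC -scalerA linearP.
Qed.
HB.instance Definition _ :=
  GRing.isLinear.Build K loops loops _ loop_deriv loop_deriv_is_linear.

Lemma loop_deriv_mono r x : loop_deriv (loop_mono r x) = r%:~R *: loop_mono r x.
Proof.
rewrite /loop_deriv loop_lift_mono ?linearZ // => s a y z.
by rewrite scalerDr !scalerA mulrC -scalerA linearP.
Qed.

(* [(x (x) t^r, y (x) t^s) |-> r delta_(r, -s) (x, y)] *)
Definition loop_cocycle (B : invForm g) f f' : K :=
  loop_lift (fun r x => r%:~R * B x f'@_(- r) : K^o) f.
Definition loop_cocycler B f' f := loop_cocycle B f f'.

Section Cocycle.
Context (B : invForm g).

Lemma loop_cocycle_linearr f : linear (loop_cocycle B f : loops -> K^o).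
Proof.
apply: (@loop_lift_linear2 K^o loops (fun f' r x => r%:~R * B x f'@_(- r))).
move=> r x a f1 f2 /=.
by rewrite mcoeffD mcoeff_scale formDr formZr mulrDr mulrCA.
Qed.
HB.instance Definition _ f :=
  GRing.isLinear.Build K loops K^o _ (loop_cocycle B f) (loop_cocycle_linearr f).

Let innerc_linear f' r : linear (fun x => r%:~R * B x f'@_(- r) : K^o).
Proof. by move=> a x y; rewrite formDl formZl mulrDr mulrCA. Qed.

Lemma loop_cocycle_linearl f' : linear (loop_cocycler B f' : loops -> K^o).
Proof. exact/loop_lift_linear/innerc_linear. Qed.
HB.instance Definition _ f' :=
  GRing.isLinear.Build K loops K^o _ (loop_cocycler B f')
    (loop_cocycle_linearl f').

Lemma loop_cocycle_mono r x s y :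
  loop_cocycle B (loop_mono r x) (loop_mono s y) = (r%:~R * B x y) *+ (r == - s).
Proof.
rewrite /loop_cocycle (loop_lift_mono (innerc_linear _)) mcoeffU [s == _]eq_sym eqr_oppLR.
by case: eqP; rewrite ?mulr1n ?mulr0n ?form0r ?mulr0.
Qed.
End Cocycle.

Lemma loop_bracketC f f' : loop_bracket f f' = - loop_bracket f' f.
Proof.
move: f; apply: (@loops_ext _ (loop_bracketr f') (\- loop_bracket f')) => r x.
rewrite /= /loop_bracketr; move: f'.
apply: (@loops_ext _ _ (\- loop_bracketr (loop_mono r x))) => s y /=.
by rewrite /= /loop_bracketr !loop_bracket_mono addrC lieC linearN.
Qed.

Lemma loop_bracketxx f : loop_bracket f f = 0.
Proof.
have := loop_bracketC f f; move: (loop_bracket f f) => x xN.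
have x2 : (2%:R : K) *: x = 0 by rewrite scaler_nat mulr2n {1}xN addNr.
have n2 : 2%:R != 0 :> K by rewrite pnatr_eq0.
by rewrite -[x]scale1r -(mulVf n2) -scalerA x2 scaler0.
Qed.

Lemma loop_jacobi f1 f2 f3 :
  loop_bracket f1 (loop_bracket f2 f3) + loop_bracket f2 (loop_bracket f3 f1)
  + loop_bracket f3 (loop_bracket f1 f2) = 0.
Proof.
move: f1; apply: (@loops_ext0 _
  ((loop_bracketr (loop_bracket f2 f3) \+ (loop_bracket f2 \o loop_bracket f3))
   \+ (loop_bracket f3 \o loop_bracketr f2))) => r x /=.
rewrite /loop_bracketr; move: f2; apply: (@loops_ext0 _
  (((loop_bracket (loop_mono r x) \o loop_bracketr f3)
   \+ loop_bracketr (loop_bracket f3 (loop_mono r x)))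
   \+ (loop_bracket f3 \o loop_bracket (loop_mono r x)))) => s y /=.
rewrite /loop_bracketr; move: f3; apply: (@loops_ext0 _
  (((loop_bracket (loop_mono r x) \o loop_bracket (loop_mono s y))
   \+ (loop_bracket (loop_mono s y) \o loop_bracketr (loop_mono r x)))
   \+ loop_bracketr (loop_bracket (loop_mono r x) (loop_mono s y)))) => t z /=.
rewrite /loop_bracketr !loop_bracket_mono.
rewrite [s + (t + r)]addrA [s + t + r]addrC [t + (r + s)]addrC -[r + s + t]addrA.
by rewrite -!linearD lie_jacobi linear0.
Qed.

Lemma loop_deriv_bracket f1 f2 : loop_deriv (loop_bracket f1 f2) =
  loop_bracket (loop_deriv f1) f2 + loop_bracket f1 (loop_deriv f2).
Proof.
move: f1; apply: (@loops_ext _ (@loop_deriv \o loop_bracketr f2)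
  ((loop_bracketr f2 \o @loop_deriv) \+ loop_bracketr (loop_deriv f2))) => r x /=.
rewrite /loop_bracketr; move: f2; apply: (@loops_ext _
  (@loop_deriv \o loop_bracket (loop_mono r x))
  (loop_bracket (loop_deriv (loop_mono r x))
   \+ (loop_bracket (loop_mono r x) \o @loop_deriv))) => s y /=.
rewrite !loop_deriv_mono linearZ /= -![loop_bracket (_ *: _) _]/(loop_bracketr _ _).
rewrite linearZ /= /loop_bracketr !loop_bracket_mono loop_deriv_mono.
by rewrite intrD scalerDl.
Qed.

Section Cocycle.
Context (B : invForm g).

Lemma loop_cocycleC f f' : loop_cocycle B f f' = - loop_cocycle B f' f.
Proof.
move: f; apply: (@loops_ext K^o (loop_cocycler B f')
  (\- (loop_cocycle B f' : loops -> K^o))) => r x.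
rewrite /= /loop_cocycler; move: f'.
apply: (@loops_ext K^o _
  (\- (loop_cocycler B (loop_mono r x) : loops -> K^o))) => s y /=.
rewrite /loop_cocycler !loop_cocycle_mono -eqr_oppLR eq_sym form_sym.
by case: eqP => [->|_]; rewrite ?mulr0n ?oppr0 // !mulr1n rmorphN mulNr opprK.
Qed.

Lemma loop_cocyclexx f : loop_cocycle B f f = 0.
Proof.
have := loop_cocycleC f f; move: (loop_cocycle B f f) => x /eqP.
by rewrite -addr_eq0 -mulr2n -mulr_natl mulf_eq0 pnatr_eq0 => /eqP.
Qed.

Lemma loop_cocycle_deriv f f' :
  loop_cocycle B f (loop_deriv f') = loop_cocycle B f' (loop_deriv f).
Proof.
move: f; apply: (@loops_ext K^o (loop_cocycler B (loop_deriv f'))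
  ((loop_cocycle B f' : loops -> K^o) \o @loop_deriv)) => r x.
rewrite /= /loop_cocycler; move: f'.
apply: (@loops_ext K^o ((loop_cocycle B (loop_mono r x) : loops -> K^o) \o @loop_deriv)
  (loop_cocycler B (loop_deriv (loop_mono r x)))) => s y /=.
rewrite /loop_cocycler !loop_deriv_mono.
have Z f1 k f2 : loop_cocycle B f1 (k *: f2) = k * loop_cocycle B f1 f2.
  exact: (linearZ_LR (loop_cocycle B f1 : {linear loops -> K^o})).
rewrite !Z !loop_cocycle_mono -[r == - s]eqr_oppLR [- r == s]eq_sym form_sym.
by case: eqP => [->|_]; rewrite ?mulr0n ?mulr0 // !mulr1n mulrCA.
Qed.

Lemma loop_cocycle_jacobi f1 f2 f3 :
  loop_cocycle B f1 (loop_bracket f2 f3) + loop_cocycle B f2 (loop_bracket f3 f1)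
  + loop_cocycle B f3 (loop_bracket f1 f2) = 0.
Proof.
move: f1; apply: (@loops_ext0 K^o
  (((loop_cocycler B (loop_bracket f2 f3) : loops -> K^o)
    \+ ((loop_cocycle B f2 : loops -> K^o) \o loop_bracket f3))
   \+ ((loop_cocycle B f3 : loops -> K^o) \o loop_bracketr f2))) => r x /=.
rewrite /loop_bracketr /loop_cocycler; move: f2; apply: (@loops_ext0 K^o
  ((((loop_cocycle B (loop_mono r x) : loops -> K^o) \o loop_bracketr f3)
    \+ (loop_cocycler B (loop_bracket f3 (loop_mono r x)) : loops -> K^o))
   \+ ((loop_cocycle B f3 : loops -> K^o) \o loop_bracket (loop_mono r x)))) => s y /=.
rewrite /loop_bracketr /loop_cocycler; move: f3; apply: (@loops_ext0 K^o
  ((((loop_cocycle B (loop_mono r x) : loops -> K^o) \o loop_bracket (loop_mono s y))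
    \+ ((loop_cocycle B (loop_mono s y) : loops -> K^o) \o loop_bracketr (loop_mono r x)))
   \+ (loop_cocycler B (loop_bracket (loop_mono r x) (loop_mono s y)) : loops -> K^o))) => t z /=.
rewrite /loop_bracketr /loop_cocycler !loop_bracket_mono !loop_cocycle_mono.
have eS (p q : int) : (p == - q) = (p + q == 0) by rewrite addr_eq0.
have e1 : s + (t + r) = r + (s + t) by rewrite addrA addrC.
have e2 : t + (r + s) = r + (s + t) by rewrite addrC addrA.
rewrite !eS e1 e2.
case: eqP => [e|_]; last by rewrite !mulr0n !addr0.
rewrite !mulr1n -[B x _]form_inv.
rewrite -[B y _]form_inv -[B z _]form_inv.
have e3 : B [lie y, z] x = B [lie x, y] z by rewrite form_sym form_inv.
have e4 : B [lie z, x] y = B [lie x, y] z by rewrite form_inv form_sym.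
by rewrite e3 e4 -!mulrDl -!rmorphD /= -addrA e mul0r.
Qed.
End Cocycle.

End Loops.

(* [(f, a, b)] stands for [f + a c + b d]; the argument [B] only matters for
   the bracket. *)
Definition affine (K : numFieldType) (g : lieAlgType K) (B : invForm g) :=
  (loops g * K^o * K^o)%type.

Section Affine.
Context (K : numFieldType) (g : lieAlgType K) (B : invForm g).
HB.instance Definition _ := GRing.Lmodule.on (affine B).
Implicit Types X Y Z : affine B.

Definition affine_bracket X Y : affine B :=
  let: (f, _, b) := X in let: (f', _, b') := Y in
  (loop_bracket f f' + (b : K) *: loop_deriv f' - (b' : K) *: loop_deriv f,
   loop_cocycle B f f',
   0).

Let pairE (U V : zmodType) (u u' : U) (v v' : V) :
  u = u' -> v = v' -> (u, v) = (u', v').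
Proof. by move=> -> ->. Qed.

Let linear_sum (V : lmodType K) (k : K) (u1 u2 p1 p2 q1 q2 : V) :
  (k *: u1 + u2) + (k *: p1 + p2) - (k *: q1 + q2)
  = k *: (u1 + p1 - q1) + (u2 + p2 - q2).
Proof.
by rewrite [k *: u1 + _ + _]addrACA opprD [LHS]addrACA scalerBr scalerDr.
Qed.

Fact affine_linearr X : linear (affine_bracket X).
Proof.
case: X => [[f a] b] k [[f1 a1] b1] [[f2 a2] b2].
apply: pairE; last by rewrite /= scaler0 addr0.
apply: pairE; last exact: loop_cocycle_linearr.
have C : (b : K) *: (k *: loop_deriv f1) = k *: ((b : K) *: loop_deriv f1).
  by rewrite !scalerA mulrC.
rewrite [LHS]/= loop_deriv_is_linear [loop_bracket _ _]loop_bracket_linearr.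
have C' : (k *: b1 : K) *: loop_deriv f = k *: ((b1 : K) *: loop_deriv f).
  by rewrite scalerA.
rewrite scalerDr scalerDl C C'; exact: linear_sum.
Qed.

Let opp_sum (V : zmodType) (u p q : V) : - u + p - q = - (u + q - p).
Proof. by rewrite opprB opprD addrA [p - u]addrC. Qed.

Fact affineC X Y : affine_bracket X Y = - affine_bracket Y X.
Proof.
case: X Y => [[f a] b] [[f' a'] b']; apply: pairE; last by rewrite oppr0.
apply: pairE; last exact: loop_cocycleC.
by rewrite /= loop_bracketC; exact: opp_sum.
Qed.

Fact affine_linearl Y : linear (affine_bracket^~ Y).
Proof.
move=> k X X'; rewrite affineC affine_linearr opprD -scalerN.
by rewrite -!(affineC _ Y).
Qed.

Fact affinexx X : affine_bracket X X = 0.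
Proof.
case: X => [[f a] b]; apply: pairE => //; apply: pairE.
  by rewrite addrK loop_bracketxx.
exact: loop_cocyclexx.
Qed.

Let jacobi_sum (V : zmodType) (j1 j2 j3 p1 p2 p3 p4 p5 p6 q1 q2 q3 : V) :
  (j1 + p1 - p2 + (p4 - p3 + q1 - q2))
  + (j2 + p5 - p4 + (p6 - p1 + q3 - q1))
  + (j3 + p3 - p6 + (p2 - p5 + q2 - q3)) = j1 + j2 + j3.
Proof.
rewrite !addrA.
rewrite ?(addrAC _ p1) ?(addrAC _ (- p1)) addrK.
rewrite ?(addrAC _ p2) ?(addrAC _ (- p2)) addrK.
rewrite ?(addrAC _ p3) ?(addrAC _ (- p3)) addrK.
rewrite ?(addrAC _ p4) ?(addrAC _ (- p4)) addrK.
rewrite ?(addrAC _ p5) ?(addrAC _ (- p5)) addrK.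
rewrite ?(addrAC _ p6) ?(addrAC _ (- p6)) addrK.
rewrite ?(addrAC _ q1) ?(addrAC _ (- q1)) addrK.
rewrite ?(addrAC _ q2) ?(addrAC _ (- q2)) addrK.
rewrite ?(addrAC _ q3) ?(addrAC _ (- q3)) addrK.
by [].
Qed.

Let bracket2 (f f' f'' : loops g) (b b' b'' : K) :
  let F := loop_bracket f' f'' + b' *: loop_deriv f'' - b'' *: loop_deriv f' in
  loop_bracket f F + b *: loop_deriv F - 0 *: loop_deriv f =
  loop_bracket f (loop_bracket f' f'')
  + b' *: loop_bracket f (loop_deriv f'')
  - b'' *: loop_bracket f (loop_deriv f')
  + (b *: loop_bracket f' (loop_deriv f'')
     - b *: loop_bracket f'' (loop_deriv f')
     + (b * b') *: loop_deriv (loop_deriv f'')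
     - (b * b'') *: loop_deriv (loop_deriv f')).
Proof.
have Dlin k u v : loop_deriv (u + k *: v) = loop_deriv u + k *: loop_deriv v
  by rewrite addrC loop_deriv_is_linear addrC.
have Blin w k u v : loop_bracket w (u + k *: v) =
    loop_bracket w u + k *: loop_bracket w v.
  by rewrite addrC loop_bracket_linearr addrC.
rewrite /= scale0r subr0 -![- (b'' *: _)]scaleNr !Blin !Dlin.
rewrite loop_deriv_bracket [loop_bracket (loop_deriv f') f'']loop_bracketC.
rewrite !scalerDr !scalerA mulrN !scaleNr scalerN.
by rewrite [- _ + b *: _]addrC.
Qed.

Fact affine_jacobi X Y Z :
  affine_bracket X (affine_bracket Y Z) + affine_bracket Y (affine_bracket Z X)
  + affine_bracket Z (affine_bracket X Y) = 0.
Proof.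
case: X Y Z => [[f1 a1] b1] [[f2 a2] b2] [[f3 a3] b3].
apply: pairE; last by rewrite /= !addr0.
apply: pairE.
  have := bracket2 f1 f2 f3 b1 b2 b3; have := bracket2 f2 f3 f1 b2 b3 b1.
  have := bracket2 f3 f1 f2 b3 b1 b2.
  rewrite [b2 * b1]mulrC [b3 * b1]mulrC [b3 * b2]mulrC => E3 E2 E1.
  rewrite [LHS](congr2 +%R (congr2 +%R E1 E2) E3) jacobi_sum.
  exact: loop_jacobi.
have Clin f k u v : loop_cocycle B f (u + k *: v) =
    loop_cocycle B f u + k * loop_cocycle B f v.
  by rewrite addrC [LHS]loop_cocycle_linearr addrC.
rewrite [LHS]/= -!scaleNr !Clin.
have := loop_cocycle_jacobi B f1 f2 f3.
rewrite !(loop_cocycle_deriv B f1) (loop_cocycle_deriv B f3 f2).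
move: (loop_cocycle B f1 _) (loop_cocycle B f2 _) (loop_cocycle B f3 _) => x y z.
move=> <-; rewrite !mulNr.
move: (b2 * _) (b3 * _) (b1 * _) => p q u; rewrite !addrA.
by rewrite ?(addrAC _ p) ?(addrAC _ (- p)) addrK
  ?(addrAC _ q) ?(addrAC _ (- q)) addrK ?(addrAC _ u) ?(addrAC _ (- u)) addrK.
Qed.

HB.instance Definition _ := isLieAlgebra.Build K (affine B)
  affine_linearl affine_linearr affinexx affine_jacobi.
End Affine.

Section AffineWeights.
Context (K : numFieldType) (g : finLieAlgType K) (I : finType).
Context (D : cartanData g I).

Notation h := (cartan D).
Notation ghat := (affine (nform D)).

(* [(H, a, b)] stands for [H + a c + b d]. *)
Definition hhat := (subvs_of h * K^o * K^o)%type.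
HB.instance Definition _ := Vector.on hhat.

Definition hhat_in (H : hhat) : ghat :=
  (loop_mono 0 (vsval H.1.1), H.1.2, H.2).

Definition weight := 'Hom(hhat, K^o).
Implicit Types lambda mu : weight.

(* Elements of [h^*] are extended by 0 on [c] and [d]. *)
Definition ext (beta : hdual h) : weight :=
  linfun ((beta : subvs_of h -> K^o) \o fst \o fst).
Definition Lambda0 : weight := linfun (snd \o fst).
Definition delta : weight := linfun snd.

(* The index set [I + {0}] is [option I], with [None] as [0]. *)
Definition ahat (i : option I) : weight :=
  if i is Some i then ext (alpha D i) else delta - ext (theta D).

Definition coroot_hat (i : option I) : hhat :=
  if i is Some i then (coroot (nform D) (alpha D i), 0, 0)
  else (- coroot (nform D) (theta D), 1, 0).

Definition Lambda_hat (i : option I) : weight :=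
  if i is Some i then
    ext (omega D i) + (omega D i (coroot (nform D) (theta D)) : K) *: Lambda0
  else Lambda0.

Lemma extE beta H : ext beta H = beta H.1.1.
Proof. by rewrite lfunE. Qed.
Lemma Lambda0E H : Lambda0 H = H.1.2.
Proof. by rewrite lfunE. Qed.
Lemma deltaE H : delta H = H.2.
Proof. by rewrite lfunE. Qed.

Lemma Lambda_hatE i j : Lambda_hat i (coroot_hat j) = (i == j)%:R.
Proof.
case: i j => [i|] [j|]; rewrite /= ?add_lfunE ?scale_lfunE ?extE ?Lambda0E //=.
- by rewrite scaler0 addr0 omegaP.
- by rewrite linearN /= [_ *: 1]mulr1 addNr.
Qed.

Lemma delta_coroot_hat j : delta (coroot_hat j) = 0.
Proof. by rewrite deltaE; case: j. Qed.

(* [lambda] lies in [hat P^+]: its values on the [h_i] are nonnegative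
   integers, and its value on [d] is an arbitrary scalar. *)
Definition dominant lambda :=
  forall i, exists n : nat, lambda (coroot_hat i) = n%:R.

Definition diagram_automorphism (sigma : {perm option I}) :=
  forall i k, ahat (sigma k) (coroot_hat (sigma i)) = ahat k (coroot_hat i).

(* The map [Lambda_i |-> Lambda_(sigma^-1 i)], [delta |-> delta]: each weight
   [lambda] is [\sum_i lambda (h_i) *: Lambda_i + lambda (d) *: delta]. *)
Definition twist (sigma : {perm option I}) lambda : weight :=
  \sum_i (lambda (coroot_hat i) : K) *: Lambda_hat ((sigma^-1)%g i)
  + (lambda (0, 0, 1) : K) *: delta.

Lemma twist_is_linear sigma : linear (twist sigma).
Proof.
move=> a l1 l2; rewrite /twist scalerDr scaler_sumr addrACA -big_split /=.
congr (_ + _); last by rewrite add_lfunE scale_lfunE scalerDl scalerA.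
by apply: eq_bigr => i _; rewrite add_lfunE scale_lfunE scalerDl scalerA.
Qed.

Lemma twist_Lambda_hat sigma i :
  twist sigma (Lambda_hat i) = Lambda_hat ((sigma^-1)%g i).
Proof.
rewrite /twist (bigD1 i) //= Lambda_hatE eqxx scale1r big1 => [|j ji].
  suff -> : Lambda_hat i (0, 0, 1) = 0 by rewrite scale0r !addr0.
  case: i => [i|] /=; rewrite ?add_lfunE ?scale_lfunE ?extE ?Lambda0E //=.
  by rewrite linear0 scaler0 addr0.
by rewrite Lambda_hatE eq_sym (negPf ji) scale0r.
Qed.

Lemma twist_delta sigma : twist sigma delta = delta.
Proof.
rewrite /twist big1 => [|i _]; last by rewrite delta_coroot_hat scale0r.
by rewrite deltaE /= scale1r add0r.
Qed.

(* [x] lies in the weight space of weight [lambda] for the adjoint action. *)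
Definition root_vector lambda (x : ghat) :=
  forall H, [lie hhat_in H, x] = (lambda H : K) *: x.

Section Module.
Context (V : lieModType ghat).

Definition weight_vector lambda (v : V) :=
  forall H, hhat_in H ⋅ v = (lambda H : K) *: v.

Definition locally_nilpotent (x : ghat) :=
  forall v : V, exists n, iter n (lie_act x) v = 0.

Definition integrable :=
  (forall v : V, exists s : seq (weight * V),
     (forall p, p \in s -> weight_vector p.1 p.2) /\ v = \sum_(p <- s) p.2) /\
  (forall i (x : ghat), root_vector (ahat i) x \/ root_vector (- ahat i) x ->
     locally_nilpotent x).

(* The last condition says that [v] is annihilated by the root spaces of all
   positive roots; weights that are not roots have zero root space. *)
Definition highest_weight_vector lambda (v : V) :=
  [/\ v <> 0, weight_vector lambda v
    & forall (c : option I -> nat) (x : ghat),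
        (exists i, c i <> 0%N) ->
        root_vector (\sum_i (c i)%:R *: ahat i) x -> x ⋅ v = 0].

(* [V] is (a model of) [V(lambda)]. *)
Definition is_simple_integrable lambda :=
  [/\ integrable, irreducible V & exists v, highest_weight_vector lambda v].

End Module.

(* [V] is isomorphic to the direct sum, over [Phi] in [hat P^+], of [m Phi]
   copies of [V(Phi)]. *)
Definition decomposes (V : lieModType ghat) (m : weight -> nat) :=
  exists M : {Phi : weight & 'I_(m Phi)} -> lieModType ghat,
    (forall j, dominant (tag j) /\ is_simple_integrable (M j) (tag j)) /\
    iso_direct_sum V M.

(* [[V : V(Phi)]]; by convention 0 when [V] is not a direct sum of modules
   [V(Phi)] with finite multiplicities. *)
Definition multiplicity (V : lieModType ghat) (Phi : weight) : nat :=
  if pselect (exists m, decomposes V m) is left e then sval (cid e) Phi else 0%N.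

End AffineWeights.

(* Main.v *)
Require Import Defs.
From HB Require Import structures.
From mathcomp Require Import all_boot all_order all_fingroup all_algebra.
From mathcomp Require Import finmap monalg.
From mathcomp Require Import boolp reals.
From mathcomp Require Import complex ring zify.
(* MathComp also exports [formZr], [formDl], etc.: give priority to [Defs]. *)
Import Defs.

(** A diagram automorphism [sigma] lifts to an automorphism [phi] of [hat g]
    with [phi e_i = e_(sigma i)], [phi f_i = f_(sigma i)], which acts on
    [hat h] by [s h_i = h_(sigma i)] and [s d = d'], where
    [alpha_k d' = delta_(k, j)].  Indeed the subalgebra of [hat g x hat g]
    generated by the pairs [(e_i, e_(sigma i))], [(f_i, f_(sigma i))] and
    [(H, s H)] surjects onto both factors, its part of weight 0 consists of the
    pairs [(H, s H)] only, and [hat g] has no nonzero ideal meeting [hat h]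
    trivially; hence this subalgebra is the graph of a bijection.  Surjectivity
    means that [hat g] is generated by the [e_i], [f_i] and [hat h], and
    [ [e_0, f_0] = h_0 ] requires [theta] to be a long root.

    Pulling back along [phi] and tensoring with a one-dimensional module on
    which only [d] acts turns [V(Lambda_j)] and [V(Lambda)] into [V(Lambda_0)]
    and [V(sigma Lambda)], hence the first tensor product into the second, and
    [V(Phi)] into [V(sigma Phi + a delta)].  Evaluating
    [Lambda_j + Lambda - Phi = \sum_i c_i alpha_i] at [d] and at [d'] gives
    [a = c_0 - c_j].  The multiplicity of [V(Phi)] does not depend on the chosen
    decomposition, since it is the dimension of the space of highest weight
    vectors of weight [Phi]. *)

Set Implicit Arguments.
Unset Strict Implicit.
Unset Printing Implicit Defensive.

Import Order.TTheory GRing.Theory Num.Theory.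
Local Open Scope ring_scope.

(** * Linear spans and weight vectors *)

Section LinearSpan.
Context (K : fieldType) (V : lmodType K).
Implicit Types (A U : V -> Prop) (u v : V).

(** Prescribing [phi] on generators would require a presentation of [hat g] by Serre relations. The
    graph replaces it by two facts that can be checked on loops: generation, and the absence of
    ideals away from [hat h]. Generation of [g] itself uses the invariant form: the orthogonal of
    the generated subalgebra is stable under all [e_i], [f_i], and a commutator has trace zero on
    its positive part. The length of [theta] enters because the loop bracket produces [t_theta],
    while [h_0] contains the coroot [2 t_theta / (theta, theta)]. Comparing root lengths requires
    [(beta, beta) > 0], which is extracted from the Killing form. The element [d'] is determined
    only modulo [c], so the pull-back of a weight is its image under [sigma] plus a multiple of
    [delta] depending on that choice. The one-dimensional modules absorb this multiple for
    [Lambda_j] and [Lambda], and their scalars add up in the tensor product. Since [multiplicity] is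
    0 by convention without a decomposition, decompositions have to be carried in both
    directions. *)

Definition subspace U := U 0 /\ forall (a : K) u v, U u -> U v -> U (a *: u + v).

(** Many of the spaces at hand are infinite dimensional, so spans are predicates, built one term at
    a time to allow induction without index sets. *)
Inductive lspan A : V -> Prop :=
| lspan0 : lspan A 0
| lspanS a u v : A u -> lspan A v -> lspan A (a *: u + v).

Lemma subspaceD U u v : subspace U -> U u -> U v -> U (u + v).
Proof. by move=> [_ UZ] Uu Uv; rewrite -[u]scale1r; apply: UZ. Qed.

Lemma subspaceZ U (a : K) u : subspace U -> U u -> U (a *: u).
Proof. by move=> [U0 UZ] Uu; rewrite -[_ *: u]addr0; apply: UZ. Qed.

Lemma subspaceN U u : subspace U -> U u -> U (- u).
Proof. by move=> sU Uu; rewrite -scaleN1r; apply: subspaceZ. Qed.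

Lemma subspaceB U u v : subspace U -> U u -> U v -> U (u - v).
Proof. by move=> sU Uu Uv; apply: subspaceD => //; apply: subspaceN. Qed.

Lemma subspace_sum U (J : Type) (r : seq J) (P : pred J) (F : J -> V) :
  subspace U -> (forall j, P j -> U (F j)) -> U (\sum_(j <- r | P j) F j).
Proof.
move=> sU UF; elim/big_ind: _ => //; first by case: sU.
by move=> u v; apply: subspaceD.
Qed.

Lemma subspace_sum_seq U (J : eqType) (r : seq J) (P : pred J) (F : J -> V) :
  subspace U -> (forall j, j \in r -> P j -> U (F j)) ->
  U (\sum_(j <- r | P j) F j).
Proof.
move=> sU UF; rewrite big_seq_cond; apply: subspace_sum => // j /andP[].
exact: UF.
Qed.

Lemma lspan_in A u : A u -> lspan A u.
Proof. by move=> Au; rewrite -[u]scale1r -[_ *: u]addr0; apply: lspanS => //; left. Qed.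

Lemma lspanD A u v : lspan A u -> lspan A v -> lspan A (u + v).
Proof.
elim=> [|a w w' Aw _ IH] Av; first by rewrite add0r.
by rewrite -addrA; apply: lspanS => //; apply: IH.
Qed.

Lemma lspan_subspace A : subspace (lspan A).
Proof.
split=> [|a u v]; first by left.
move=> Au Av; apply: lspanD => //; elim: Au => [|b w w' Aw _ IH].
  by rewrite scaler0; left.
by rewrite scalerDr scalerA; apply: lspanS.
Qed.

Lemma lspan_min A U : subspace U -> (forall u, A u -> U u) ->
  forall u, lspan A u -> U u.
Proof.
move=> [U0 UZ] AU u; elim=> // a w w' Aw _; apply: UZ; exact: AU.
Qed.

Lemma lspan_mono A A' : (forall u, A u -> A' u) -> forall u, lspan A u -> lspan A' u.
Proof.
by move=> AA'; apply: lspan_min; [apply: lspan_subspace | move=> u /AA'; apply: lspan_in].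
Qed.

Lemma subspace0 : subspace (fun v => v = 0).
Proof. by split=> // a u v -> ->; rewrite scaler0 addr0. Qed.

End LinearSpan.

Lemma lin0 (K : fieldType) (V W : lmodType K) (f : V -> W) : linear f -> f 0 = 0.
Proof.
move=> lf; have := lf 1 0 0; rewrite !scale1r addr0 => e.
by apply: (@addrI _ (f 0)); rewrite -e addr0.
Qed.

Lemma linD (K : fieldType) (V W : lmodType K) (f : V -> W) : linear f ->
  {morph f : u v / u + v}.
Proof. by move=> lf u v; have := lf 1 u v; rewrite !scale1r. Qed.

Lemma linZ (K : fieldType) (V W : lmodType K) (f : V -> W) : linear f ->
  forall a u, f (a *: u) = a *: f u.
Proof. by move=> lf a u; have := lf a u 0; rewrite (lin0 lf) !addr0. Qed.

Lemma linN (K : fieldType) (V W : lmodType K) (f : V -> W) : linear f ->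
  {morph f : u / - u}.
Proof. by move=> lf u; rewrite -scaleN1r linZ // scaleN1r. Qed.

Lemma linB (K : fieldType) (V W : lmodType K) (f : V -> W) : linear f ->
  {morph f : u v / u - v}.
Proof. by move=> lf u v; rewrite linD // linN. Qed.

Lemma lin_sum (K : fieldType) (V W : lmodType K) (f : V -> W) : linear f ->
  forall (J : Type) (r : seq J) (P : pred J) (F : J -> V),
  f (\sum_(j <- r | P j) F j) = \sum_(j <- r | P j) f (F j).
Proof.
move=> lf J r P F; apply: (big_morph f); last exact: lin0.
exact: linD.
Qed.

Lemma subspace_preim (K : fieldType) (V W : lmodType K) (f : V -> W)
    (U : W -> Prop) : linear f -> subspace U -> subspace (fun v => U (f v)).
Proof.
move=> lf [U0 UZ]; split=> [|a u v Uu Uv]; first by rewrite lin0.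
by rewrite lf; apply: UZ.
Qed.

Lemma subspaceI (K : fieldType) (V : lmodType K) (U U' : V -> Prop) :
  subspace U -> subspace U' -> subspace (fun v => U v /\ U' v).
Proof.
move=> [U0 UZ] [U'0 U'Z]; split=> // a u v [? ?] [? ?].
by split; [apply: UZ | apply: U'Z].
Qed.

Section Weights.
Context (K : fieldType) (V : lmodType K) (T : Type) (W : eqType).
Context (ev : W -> T -> K) (act : T -> V -> V).
Hypothesis ev_inj : forall m m', (forall t, ev m t = ev m' t) -> m = m'.
Hypothesis act_lin : forall t, linear (act t).

(** [T] indexes operators, [W] weights. Instances: [h] on [g], [hat h] on [hat g], on
    [hat g x hat g] and on modules, and [T = unit] for a single operator. *)
Definition has_weight (m : W) (v : V) := forall t, act t v = ev m t *: v.

Lemma has_weight_subspace m : subspace (has_weight m).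
Proof.
split=> [t|a u v mu mv t]; first by rewrite lin0 // scaler0.
by rewrite act_lin mu mv scalerDr !scalerA mulrC.
Qed.

(** Induction on the number of weights. An operator [t] separating [m] from [p.1] gives
    [act t - ev m t], which kills the component of weight [m] and multiplies the others by scalars,
    the one at [p] being nonzero. *)
Lemma weight_components_uniq (U : V -> Prop) (s : seq (W * V)) :
  subspace U -> (forall t v, U v -> U (act t v)) ->
  uniq (map fst s) -> (forall p, p \in s -> has_weight p.1 p.2) ->
  U (\sum_(p <- s) p.2) -> forall p, p \in s -> U p.2.
Proof.
move=> sU stU; have [k] := ubnP (size s); elim: k s => // k IH [//|[m v] s] /=.
rewrite ltnS => sk /andP[ms us] ws; rewrite big_cons /= => Us.
have wv : has_weight m v by apply: (ws (m, v)); rewrite mem_head.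
have wss p : p \in s -> has_weight p.1 p.2 by move=> ps; apply: ws; rewrite inE ps orbT.
have Uss p : p \in s -> U p.2.
  move=> ps; have mp : m <> p.1 by move=> e; case/negP: ms; rewrite e map_f.
  have [t tE] : exists t, ev m t <> ev p.1 t.
    by apply/existsNP => /= e; apply: mp; apply: ev_inj.
  have dE : ev p.1 t - ev m t != 0 by rewrite subr_eq0 eq_sym; apply/eqP.
  pose s' := [seq (q.1, (ev q.1 t - ev m t) *: q.2) | q <- s].
  have U' : U (\sum_(q <- s') q.2).
    rewrite big_map /=.
    have -> : \sum_(q <- s) (ev q.1 t - ev m t) *: q.2
      = act t (v + \sum_(q <- s) q.2) - ev m t *: (v + \sum_(q <- s) q.2).
      rewrite (linD (act_lin t)) wv scalerDr opprD addrACA subrr add0r.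
      rewrite (lin_sum (act_lin t)) scaler_sumr -sumrB.
      by apply: eq_big_seq => q qs; rewrite wss // scalerBl.
    by apply: subspaceB => //; [apply: stU | apply: subspaceZ].
  have := IH s' _ _ _ U' (p.1, (ev p.1 t - ev m t) *: p.2).
  rewrite /s' size_map -map_comp (eq_map (g := fst)) // => /(_ sk us) H.
  rewrite -[p.2]scale1r -(mulVf dE) -scalerA; apply: subspaceZ => //.
  apply: H; last by apply/mapP; exists p.
  move=> q /mapP[r rs ->] /=; apply: (subspaceZ _ (has_weight_subspace _)).
  exact: wss.
move=> p; rewrite inE => /predU1P[->|/Uss//] /=.
rewrite -[v](addrK (\sum_(q <- s) q.2)); apply: subspaceB => //.
by apply: subspace_sum_seq => // q qs _; apply: Uss.
Qed.

(** Components of equal weight are collected first, which yields a list with distinct weights; a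
    weight that does not occur contributes an empty sum. *)
Lemma weight_components (U : V -> Prop) (s : seq (W * V)) :
  subspace U -> (forall t v, U v -> U (act t v)) ->
  (forall p, p \in s -> has_weight p.1 p.2) ->
  U (\sum_(p <- s) p.2) -> forall m, U (\sum_(p <- s | p.1 == m) p.2).
Proof.
move=> sU stU ws Us m.
pose ms := undup (map fst s).
pose s' := [seq (n, \sum_(p <- s | p.1 == n) p.2) | n <- ms].
have wS n : has_weight n (\sum_(p <- s | p.1 == n) p.2).
  apply: (subspace_sum_seq (has_weight_subspace _)).
  by move=> p ps /eqP <-; apply: ws.
have Us' : U (\sum_(p <- s') p.2).
  rewrite big_map /= (exchange_big_dep xpredT) //=.
  suff -> : \sum_(p <- s) \sum_(n <- ms | p.1 == n) p.2 = \sum_(p <- s) p.2 by [].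
  apply: eq_big_seq => p ps; rewrite -big_filter.
  have -> : [seq n <- ms | p.1 == n] = [:: p.1].
    under eq_filter do rewrite eq_sym.
    by rewrite filter_pred1_uniq ?undup_uniq // mem_undup map_f.
  by rewrite big_seq1.
have [mm|mm] := boolP (m \in ms).
  have us' : uniq (map fst s') by rewrite -map_comp map_id_in ?undup_uniq.
  have ws' p : p \in s' -> has_weight p.1 p.2 by move=> /mapP[n _ ->]; apply: wS.
  have := weight_components_uniq sU stU us' ws' Us'.
  by move/(_ (m, \sum_(p <- s | p.1 == m) p.2)); apply; apply/mapP; exists m.
rewrite big_seq_cond big_pred0; first by case: sU.
move=> p; apply/negP => /andP[ps /eqP e].
by case/negP: mm; rewrite -e mem_undup map_f.
Qed.

Lemma lspan_weight_list (A : V -> Prop) (C : W -> V -> Prop) v :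
  (forall a u, A u -> exists2 m, C m (a *: u) & has_weight m u) -> lspan A v ->
  exists2 s : seq (W * V), (forall p, p \in s -> C p.1 p.2 /\ has_weight p.1 p.2)
    & v = \sum_(p <- s) p.2.
Proof.
move=> AC; elim=> [|a u w /(AC a)[m Cm mu] _ [s sP ->]].
  by exists [::]; rewrite ?big_nil.
exists ((m, a *: u) :: s); last by rewrite big_cons.
move=> p; rewrite inE => /predU1P[->|/sP//]; split=> //=.
exact: (subspaceZ _ (has_weight_subspace m)).
Qed.

(** Adjoining [-v] with weight [m] to a decomposition of [v] gives total 0. If [C m] failed, [-v]
    would be the whole component of weight [m], hence 0. *)
Lemma lspan_weight_class (A : V -> Prop) (C : W -> Prop) m v :
  (forall u, A u -> exists2 m', C m' & has_weight m' u) ->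
  lspan A v -> has_weight m v -> v <> 0 -> C m.
Proof.
move=> AC Av mv v0.
have [|s sP vE] := @lspan_weight_list A (fun m _ => C m) v _ Av.
  by move=> a u /AC.
have [//|Cm] := pselect (C m); case: v0.
have := @weight_components (fun u => u = 0) ((m, - v) :: s) (@subspace0 _ _).
rewrite big_cons /= -vE addNr => /(_ _ _ erefl m).
rewrite big_cons eqxx big_seq_cond big_pred0 => [|p]; last first.
  by apply/negP => /andP[/sP[Cp _] /eqP e]; apply: Cm; rewrite -e.
rewrite addr0 => H; apply/eqP; rewrite -oppr_eq0; apply/eqP; apply: H.
  by move=> t u ->; rewrite lin0.
move=> p; rewrite inE => /predU1P[->|/sP[]//] /=.
exact: (subspaceN (has_weight_subspace m)).
Qed.

(** Decompose [v] into weight vectors of the whole space; stability puts each component back into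
    [U]. *)
Lemma stable_weight_span (U : V -> Prop) v :
  subspace U -> (forall t v, U v -> U (act t v)) ->
  lspan (fun u => exists m, has_weight m u) v -> U v ->
  lspan (fun u => U u /\ exists m, has_weight m u) v.
Proof.
move=> sU stU Av Uv.
have [|s sP vE] := @lspan_weight_list _ (fun _ _ => True) v _ Av.
  by move=> a u [m mu]; exists m.
pose ms := undup (map fst s).
have -> : v = \sum_(n <- ms) \sum_(p <- s | p.1 == n) p.2.
  rewrite vE (exchange_big_dep xpredT) //=; apply: eq_big_seq => p ps.
  rewrite -big_filter (_ : [seq n <- ms | p.1 == n] = [:: p.1]) ?big_seq1 //.
  under eq_filter do rewrite eq_sym.
  by rewrite filter_pred1_uniq ?undup_uniq // mem_undup map_f.
apply: subspace_sum; first exact: lspan_subspace.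
move=> m _; apply: lspan_in; split.
  apply: weight_components => //; last by rewrite -vE.
  by move=> p /sP[].
exists m; apply: (subspace_sum_seq (has_weight_subspace _)).
by move=> p /sP[_ ?] /eqP <-.
Qed.

End Weights.

(** * Finite-dimensional linear algebra: bases of weight vectors and traces *)

Section FiniteDim.
Context (K : fieldType) (V : vectType K).

(** Adjoin vectors of [P] one at a time; the codimension drops strictly, so this stops. It gives
    predicates access to dimensions and bases. *)
Lemma subspace_vspace (P : V -> Prop) : subspace P ->
  exists U : {vspace V}, forall x, x \in U <-> P x.
Proof.
move=> sP.
suff: forall k (U : {vspace V}), (forall x, x \in U -> P x) ->
    (\dim (fullv : {vspace V}) - \dim U < k)%N ->
    exists U' : {vspace V}, forall x, x \in U' <-> P x.
  move=> /(_ (\dim (fullv : {vspace V}) - \dim (0%VS : {vspace V})).+1 0%VS); apply=> //.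
  by move=> x; rewrite memv0 => /eqP ->; case: sP.
elim=> // k IH U UP; rewrite ltnS => dU.
have [PU|] := pselect (forall x, P x -> x \in U); first by exists U => x; split; auto.
move=> /existsNP[x] /not_implyP[Px xU].
apply: (IH (U + <[x]>)%VS).
  move=> _ /memv_addP[u uU [_ /vlineP[a ->] ->]].
  by apply: subspaceD => //; [apply: UP | apply: subspaceZ].
apply: leq_trans dU; apply: ltn_sub2l.
  rewrite ltn_neqAle dimvS ?subvf // andbT; apply/negP => /eqP e.
  by have := eqEdim U fullv; rewrite subvf e leqnn => /eqP UE; case: xU; rewrite UE memvf.
rewrite ltn_neqAle dimvS ?addvSl // andbT; apply/negP => /eqP e.
have := eqEdim U (U + <[x]>); rewrite addvSl e leqnn => /eqP UE.
by case: xU; rewrite UE; apply: (subvP (addvSr _ _)); apply: memv_line.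
Qed.

Lemma lspan_span (b : seq V) v : v \in <<b>>%VS -> lspan (fun x => x \in b) v.
Proof.
move=> /(@coord_span _ _ _ (in_tuple b)) ->.
apply: (@subspace_sum _ _ (lspan (fun x => x \in b))) => [|i _].
  exact: lspan_subspace.
apply: (@subspaceZ _ _ (lspan (fun x => x \in b))); first exact: lspan_subspace.
by apply: lspan_in; apply: mem_nth.
Qed.

Lemma free_subseq (s : seq V) : exists s' : seq V,
  [/\ {subset s' <= s}, free s' & <<s'>>%VS = <<s>>%VS].
Proof.
elim: s => [|x s [s' [ss fs es]]]; first by exists [::]; split; rewrite ?nil_free.
have [xs|xs] := boolP (x \in <<s>>%VS).
  exists s'; split=> //; first by move=> y /ss ys; rewrite inE ys orbT.
  by rewrite es span_cons; apply/esym/addv_idPr.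
exists (x :: s'); split; last by rewrite !span_cons es.
  by move=> y; rewrite !inE => /orP[->//|/ss ->]; rewrite orbT.
by rewrite free_cons es xs.
Qed.

Lemma lspan_seq (A : V -> Prop) x : lspan A x ->
  exists2 s : seq V, (forall y, y \in s -> A y) & x \in <<s>>%VS.
Proof.
elim=> [|a u v Au _ [s sA vs]]; first by exists [::] => //; rewrite mem0v.
exists (u :: s); first by move=> y; rewrite inE => /predU1P[->|/sA].
rewrite span_cons; apply: memv_add => //; apply: memvZ; exact: memv_line.
Qed.

(** Each vector of [vbasis U] involves finitely many vectors satisfying [A]; together these span
    [U], and a free subfamily of them is the basis. *)
Lemma basis_of_lspan (U : {vspace V}) (A : V -> Prop) :
  (forall x, x \in U -> lspan (fun u => u \in U /\ A u) x) ->
  exists2 b : seq V, basis_of U b & forall x, x \in b -> A x.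
Proof.
move=> UA.
have [s sA Us] : exists2 s : seq V, (forall y, y \in s -> y \in U /\ A y) &
    (U <= <<s>>)%VS.
  suff H l : (forall x, x \in l -> x \in U) -> exists2 s : seq V,
      (forall y, y \in s -> y \in U /\ A y) & (<<l>> <= <<s>>)%VS.
    have [|s sA ls] := H (vbasis U); first by move=> x /vbasis_mem.
    by exists s => //; rewrite (span_basis (vbasisP U)) in ls.
  elim: l => [|x l IH] lU; first by exists [::] => //; rewrite subvv.
  have [s sA ls] := IH (fun y yl => lU y (mem_behead (s := x :: l) yl)).
  have [s' s'A xs] := lspan_seq (UA x (lU x (mem_head _ _))).
  exists (s' ++ s) => [y|].
    by rewrite mem_cat => /orP[ys|ys]; [apply: s'A | apply: sA].
  rewrite span_cons span_cat; apply: addvS => //.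
have [b [bs fb eb]] := free_subseq s; exists b; last by move=> x /bs/sA[].
rewrite /basis_of fb eb andbT eqEsubv Us andbT.
by apply/span_subvP => y /sA[].
Qed.

Lemma trace_commutator_eq0 n (b : n.-tuple V) (x y t : V -> V) (w : 'I_n -> K) :
  linear x -> linear y -> free b ->
  (forall i : 'I_n, x b`_i \in <<b>>%VS) -> (forall i : 'I_n, y b`_i \in <<b>>%VS) ->
  (forall i : 'I_n, t b`_i = w i *: b`_i) ->
  (forall i : 'I_n, x (y b`_i) - y (x b`_i) = t b`_i) -> \sum_i w i = 0.
Proof.
move=> lx ly fb xb yb tb xyb.
(* Row [i] holds the coordinates of the image of [b_i], so composing maps reverses the matrix
   product. *)
pose M (z : V -> V) := \matrix_(i < n, k < n) coord b k (z b`_i).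
have ME z (i : 'I_n) : z b`_i \in <<b>>%VS -> z b`_i = \sum_k M z i k *: b`_k.
  by move=> /coord_span {1}->; apply: eq_bigr => k _; rewrite mxE.
have MM z z' (i : 'I_n) : linear z -> z' b`_i \in <<b>>%VS ->
    (forall k : 'I_n, z b`_k \in <<b>>%VS) -> coord b i (z (z' b`_i)) = (M z' *m M z) i i.
  move=> lz bi zb; rewrite (ME _ _ bi) (lin_sum lz) linear_sum mxE.
  by apply: eq_bigr => k _; rewrite (linZ lz) linearZ /= !mxE.
have wE i : w i = (M y *m M x) i i - (M x *m M y) i i.
  rewrite -!MM // -linearB /= xyb tb linearZ /= coord_free // eqxx.
  by rewrite mulr1.
under eq_bigr do rewrite wE.
by rewrite sumrB -/(mxtrace _) -/(mxtrace _) mxtrace_mulC subrr.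
Qed.

Section FiniteWeights.
Context (T : Type) (W : eqType) (ev : W -> T -> K) (act : T -> V -> V) (w0 : W).
Hypothesis ev_inj : forall m m', (forall t, ev m t = ev m' t) -> m = m'.
Hypothesis act_lin : forall t, linear (act t).
Notation has_weight := (has_weight ev act).

Lemma weight_basis_full (b : seq V) (wt : V -> W) m v :
  basis_of fullv b -> (forall x, x \in b -> has_weight (wt x) x) ->
  has_weight m v -> v <> 0 -> m \in map wt b.
Proof.
move=> bb wb mv v0.
apply: (@lspan_weight_class _ _ _ _ ev act ev_inj act_lin (fun x => x \in b)
  (fun m => m \in map wt b) m v) => //.
  by move=> u ub; exists (wt u); [apply: map_f | apply: wb].
by apply: lspan_span; rewrite (span_basis bb) memvf.
Qed.

Lemma weight_basis_exists (U : {vspace V}) :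
  (forall t v, v \in U -> act t v \in U) ->
  (forall v, lspan (fun u => exists m, has_weight m u) v) ->
  exists (b : seq V) (wt : V -> W),
    basis_of U b /\ forall x, x \in b -> has_weight (wt x) x.
Proof.
move=> stU sp.
have [b bb wb] := @basis_of_lspan U (fun u => exists m, has_weight m u) (fun x xU =>
  stable_weight_span ev_inj act_lin (U := fun u => u \in U)
    (conj (mem0v U) (fun a u v uU vU => memvD (memvZ a uU) vU)) stU (sp x) xU).
(* [w0] is a default value on vectors that have no weight. *)
exists b, (fun x => if pselect (exists m, has_weight m x) is left e
  then sval (cid e) else w0).
split=> // x /wb; case: pselect => // e _; exact: (svalP (cid e)).
Qed.

End FiniteWeights.
End FiniteDim.

Lemma lfun_of_linear (K : fieldType) (U V : vectType K) (f : U -> V) :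
  linear f -> exists F : 'Hom(U, V), F =1 f.
Proof.
move=> lf; pose fL : {linear U -> V} := HB.pack f (GRing.isLinear.Build K U V _ f lf).
by exists (linfun fL) => u; rewrite lfunE.
Qed.

(** * Cartan subalgebras and roots *)

Section LieIdentities.
Context (K : fieldType) (L : lieAlgType K).
Implicit Types x y z : L.

Lemma lie_leibniz x y z : [lie x, [lie y, z]] = [lie [lie x, y], z] + [lie y, [lie x, z]].
Proof.
rewrite [[lie [lie x, y], z]]lieC [[lie x, z]]lieC linearN -opprD.
by apply/eqP; rewrite -addr_eq0 [[lie z, _] + _]addrC addrA lie_jacobi.
Qed.

Lemma lie_linearr x : linear (lie x).
Proof. by move=> a y z; rewrite lieDr lieZr. Qed.

Lemma lie_linearl y : linear (lie^~ y).
Proof. by move=> a x z; rewrite /= lieDl lieZl. Qed.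

Lemma lieNl x y : [lie - x, y] = - [lie x, y].
Proof. by rewrite -scaleN1r lieZl scaleN1r. Qed.

Lemma lie_suml (J : Type) (r : seq J) (P : pred J) (F : J -> L) y :
  [lie \sum_(j <- r | P j) F j, y] = \sum_(j <- r | P j) [lie F j, y].
Proof. exact: (lin_sum (lie_linearl y)). Qed.

End LieIdentities.

Section Cartan.
Context (K : numFieldType) (g : finLieAlgType K) (I : finType).
Context (D : cartanData g I).

Notation h := (cartan D).
Notation B := (nform D).
Implicit Types (x y z : g) (beta gamma : hdual h) (H : subvs_of h).

Definition ad_weight beta x := forall H, [lie vsval H, x] = (beta H : K) *: x.

Lemma hdual_inj beta gamma : (forall H, beta H = gamma H :> K) -> beta = gamma.
Proof. by move=> e; apply/lfunP. Qed.

Lemma cartan_lie H H' : [lie vsval H, vsval H'] = 0.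
Proof. by case: (cartanP D) => ab _ _; apply: ab; apply: subvsP. Qed.

Lemma ad_commute H H' x :
  [lie vsval H, [lie vsval H', x]] = [lie vsval H', [lie vsval H, x]].
Proof. by rewrite lie_leibniz cartan_lie lie0l add0r. Qed.

Lemma ad_h_eigen_span H x :
  lspan (fun u => exists a : K, [lie vsval H, u] = a *: u) x.
Proof.
case: (cartanP D) => _ _ /(_ _ (subvsP H))[b bb be].
apply: (@lspan_mono _ _ (fun u => u \in b)) => [u /be //|].
by apply: lspan_span; rewrite (span_basis bb) memvf.
Qed.

(** Simultaneous diagonalization, one element of [s] at a time: the joint eigenspace through a
    vector is stable under the next [ad H], because elements of [h] commute. *)
Lemma ad_joint_eigen_span (s : seq (subvs_of h)) x :
  lspan (fun u => forall H, H \in s -> exists a : K, [lie vsval H, u] = a *: u) x.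
Proof.
elim: s x => [|H s IH] x; first by apply: lspan_in.
apply: lspan_min (IH x); first exact: lspan_subspace.
move=> {}x xs.
have /choice[a aE] : forall H', exists a : K, H' \in s -> [lie vsval H', x] = a *: x.
  move=> H'; have [/xs[a aE]|//] := boolP (H' \in s); first by exists a.
  by exists 0.
pose U z := forall H', H' \in s -> [lie vsval H', z] = a H' *: z.
have sU : subspace U.
  split=> [H' _|c u v Uu Uv H' H's]; first by rewrite lie0r scaler0.
  by rewrite lieDr lieZr Uu // Uv // scalerDr !scalerA mulrC.
have := @stable_weight_span K g unit K (fun m _ => m) (fun _ => lie (vsval H)) _ _ U x.
have injK (m m' : K) : (unit -> m = m') -> m = m' by apply.
move=> /(_ injK (fun _ => lie_linearr _) sU) => S.
apply: (@lspan_mono _ _ _ _ _ _ (S _ _ aE)).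
- move=> u [Uu [m mu]] H'; rewrite inE => /predU1P[->|H's]; first by exists m; apply: mu.
  by exists (a H'); apply: Uu.
- by move=> _ v Uv H' H's; rewrite ad_commute Uv // lieZr.
- apply: lspan_mono (ad_h_eigen_span H x) => u [m mu]; by exists m.
Qed.

(** Joint eigenvalues on a basis [E] of [h] extend linearly to a weight. *)
Lemma ad_weight_span x : lspan (fun u => exists beta, ad_weight beta u) x.
Proof.
pose E := vbasis (fullv : {vspace subvs_of h}).
apply: lspan_mono (ad_joint_eigen_span E x) => u uE.
have /choice[a aE] : forall i : 'I_(\dim (fullv : {vspace subvs_of h})),
    exists a : K, [lie vsval E`_i, u] = a *: u.
  by move=> i; apply: uE; apply: mem_nth; rewrite size_tuple.
exists (\sum_i a i *: linfun (coord E i : subvs_of h -> K^o)) => H.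
rewrite {1}(coord_vbasis (memvf H)) linear_sum lie_suml sum_lfunE scaler_suml.
apply: eq_bigr => i _; rewrite linearZ lieZl aE scale_lfunE lfunE /= scalerA.
by rewrite mulrC.
Qed.

(** A vector centralizing [h] spans with it an abelian subspace, so it lies in [h] by maximality. *)
Lemma ad_weight0P x : ad_weight 0 x <-> x \in h.
Proof.
split=> [x0|xh H]; last first.
  by rewrite -(vsprojK xh) cartan_lie lfunE scale0r.
have xc y : y \in h -> [lie y, x] = 0.
  by move=> yh; have := x0 (vsproj h y); rewrite vsprojK // lfunE /= scale0r.
case: (cartanP D) => ab maxh _.
rewrite -(maxh (h + <[x]>)%VS) ?addvSl //.
  by apply: (subvP (addvSr _ _)); apply: memv_line.
move=> _ _ /memv_addP[u uh [_ /vlineP[a ->] ->]] /memv_addP[v vh [_ /vlineP[b ->] ->]].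
rewrite lieDl !lieDr !lieZl !lieZr liexx ab // xc // lieC xc //.
by rewrite !scaler0 oppr0 scaler0 !addr0.
Qed.

Lemma ad_weight_bracket beta gamma x y :
  ad_weight beta x -> ad_weight gamma y -> ad_weight (beta + gamma) [lie x, y].
Proof.
by move=> bx gy H; rewrite lie_leibniz bx gy lieZl lieZr add_lfunE scalerDl.
Qed.

Lemma ad_weight_subspace beta : subspace (ad_weight beta).
Proof. by apply: has_weight_subspace => H; apply: lie_linearr. Qed.

Lemma ad_weight_class (A : g -> Prop) (C : hdual h -> Prop) beta x :
  (forall u, A u -> exists2 m, C m & ad_weight m u) ->
  lspan A x -> ad_weight beta x -> x <> 0 -> C beta.
Proof.
exact: (@lspan_weight_class _ _ _ _ (fun beta H => beta H : K)
  (fun H => lie (vsval H)) hdual_inj (fun H => lie_linearr (vsval H))).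
Qed.

(** Invariance gives [(beta + gamma)(H) B x y = 0] for every [H]. *)
Lemma form_orth beta gamma x y :
  ad_weight beta x -> ad_weight gamma y -> beta + gamma <> 0 -> B x y = 0.
Proof.
move=> bx gy bg; have [//|Bxy] := eqVneq (B x y) 0.
case: bg; apply/hdual_inj => H; rewrite add_lfunE lfunE /=.
apply/eqP; have := form_inv B x (vsval H) y; rewrite lieC bx gy formZr -scaleNr formZl.
by move=> /eqP; rewrite -subr_eq0 -mulrBl mulf_eq0 (negPf Bxy) orbF -opprD oppr_eq0.
Qed.

Lemma form_eq0 x : (forall beta y, ad_weight beta y -> B x y = 0) -> x = 0.
Proof.
case: (nformP D) => nd _ _ xy; apply: nd => y.
elim: (ad_weight_span y) => [|a u v [beta /xy e] _ IH]; first by rewrite form0r.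
by rewrite formDr formZr e IH mulr0 addr0.
Qed.

(** The form is nondegenerate and pairs only opposite weights, so some vector of weight [-beta]
    pairs nontrivially with [x]; rescale it. *)
Lemma dual_weight_vector beta x : ad_weight beta x -> x <> 0 ->
  exists2 y, ad_weight (- beta) y & B x y = 1.
Proof.
move=> bx x0; have [y by_ Bxy] : exists2 y, ad_weight (- beta) y & B x y <> 0.
  apply: contrapT => no; apply: x0; apply: form_eq0 => gamma y gy.
  have [e|/eqP ne] := eqVneq (beta + gamma) 0; last exact: form_orth bx gy ne.
  apply: contrapT => Bxy; apply: no; exists y => //.
  by rewrite (addr0_eq e).
exists ((B x y)^-1 *: y); last by rewrite formZr mulVf //; apply/eqP.
exact: (subspaceZ _ (ad_weight_subspace _)).
Qed.

Lemma opp_root beta : is_root beta -> is_root (- beta).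
Proof.
case=> b0 [x x0 bx]; split; first by move=> /eqP; rewrite oppr_eq0 => /eqP.
have [y yb Bxy] := dual_weight_vector bx x0; exists y => // y0.
by move: Bxy; rewrite y0 form0r => /esym/eqP; rewrite oner_eq0.
Qed.

(** [h] is orthogonal to all vectors of nonzero weight, so an element of [h] orthogonal to [h] is
    orthogonal to all of [g]. *)
Lemma nu_ker0 : lker (nu B h) == 0%VS.
Proof.
rewrite -subv0; apply/subvP => H; rewrite memv_ker memv0 => /eqP nH.
suff H0 : vsval H = 0 by rewrite -(vsvalK H) H0 linear0.
apply: form_eq0 => beta y bey.
have [e|/eqP ne] := eqVneq beta 0.
  have yh : y \in h by apply/ad_weight0P; rewrite -e.
  by rewrite -(vsprojK yh) -nuE nH zero_lfunE.
apply: (form_orth (beta := 0) (gamma := beta)) => //; last by rewrite add0r.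
by apply/ad_weight0P/subvsP.
Qed.

Lemma nu_inj : injective (nu B h).
Proof. exact/lker0P/nu_ker0. Qed.

(** Usually written [t_beta]: the element of [h] representing [beta] through the form. *)
Definition tvec beta : subvs_of h := ((nu B h)^-1)%VF beta.

Lemma nu_tvec beta : nu B h (tvec beta) = beta.
Proof.
apply: limg_lfunVK; suff -> : limg (nu B h) = fullv by rewrite memvf.
apply/eqP; rewrite eqEdim subvf limg_dim_eq; last first.
  by rewrite (eqP nu_ker0) capv0.
by rewrite !dimvf /= /dim /= muln1.
Qed.

Lemma tvecE beta H : B (vsval (tvec beta)) (vsval H) = beta H.
Proof. by rewrite -nuE nu_tvec. Qed.

Lemma tvecD beta gamma : tvec (beta + gamma) = tvec beta + tvec gamma.
Proof. exact: linearD. Qed.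

Lemma tvecZ a beta : tvec (a *: beta) = a *: tvec beta.
Proof. exact: linearZ. Qed.

Lemma tvecN beta : tvec (- beta) = - tvec beta.
Proof. exact: linearN. Qed.

Lemma tvec_eq0 beta : tvec beta = 0 -> beta = 0.
Proof. by move=> t0; rewrite -[beta]nu_tvec t0 linear0. Qed.

Lemma dformE beta gamma : dform B beta gamma = gamma (tvec beta).
Proof. by rewrite /dform form_sym tvecE. Qed.

Lemma dformC beta gamma : dform B beta gamma = dform B gamma beta.
Proof. exact: form_sym. Qed.

Lemma corootE beta : coroot B beta = (2 / dform B beta beta) *: tvec beta.
Proof. by []. Qed.

Lemma cartan_eq0 H : (forall beta, beta H = 0 :> K) -> H = 0.
Proof.
move=> H0; apply: nu_inj; rewrite linear0.
by apply/hdual_inj => H'; rewrite nuE form_sym -nuE H0 lfunE.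
Qed.

(** The bracket has weight 0, so it lies in [h]; by invariance its pairing with [H] is
    [beta(H) B x y]. *)
Lemma opposite_bracket beta x y : ad_weight beta x -> ad_weight (- beta) y ->
  [lie x, y] = B x y *: vsval (tvec beta).
Proof.
move=> bx gy; have zh : [lie x, y] \in h.
  by apply/ad_weight0P; rewrite -(subrr beta); apply: ad_weight_bracket.
rewrite -(vsprojK zh) -linearZ; congr vsval; apply: nu_inj.
apply/hdual_inj => H; rewrite [nu B h (_ *: _)]linearZ /= nu_tvec nuE vsprojK //=.
by rewrite scale_lfunE form_sym -form_inv bx formZl mulrC.
Qed.

End Cartan.

(** * Root strings *)

Section Strings.
Context (K : numFieldType) (g : lieAlgType K).
Context (x y t v : g) (a b : K).
Hypothesis xy : [lie x, y] = t.
Hypothesis ty : [lie t, y] = b *: y.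
Hypothesis xv : [lie x, v] = 0.
Hypothesis tv : [lie t, v] = a *: v.

Let Y n := iter n (lie y) v.

Lemma string_weight n : [lie t, Y n] = (a + n%:R * b) *: Y n.
Proof.
elim: n => [|n IH]; first by rewrite mul0r addr0.
rewrite /= lie_leibniz ty lieZl IH lieZr -scalerDl; congr (_ *: _).
by rewrite -natr1; ring.
Qed.

(** The coefficient is twice the sum [a + (a + b) + ... + (a + n b)], doubled to avoid halves. The
    case [b = 0] is allowed, since isotropic roots have yet to be excluded. *)
Lemma string_raise n :
  2 *: [lie x, Y n.+1] = (n.+1%:R * (2 * a + n%:R * b)) *: Y n.
Proof.
elim: n => [|n IH].
  rewrite /= lie_leibniz xy tv xv lie0r addr0 scalerA; congr (_ *: _); ring.
have -> : Y n.+2 = [lie y, Y n.+1] by [].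
rewrite lie_leibniz xy string_weight scalerDr -lieZr IH lieZr.
by rewrite scalerA -scalerDl; congr (_ *: _); rewrite -!natr1; ring.
Qed.

Lemma string_length n : Y n != 0 -> Y n.+1 = 0 -> 2 * a = - (n%:R * b).
Proof.
move=> Yn Yn1; have /esym/eqP := string_raise n.
rewrite Yn1 lie0r scaler0 scaler_eq0 (negPf Yn) orbF mulf_eq0 pnatr_eq0 /=.
by rewrite addr_eq0 => /eqP.
Qed.

End Strings.

Section RootStrings.
Context (K : numFieldType) (g : finLieAlgType K) (I : finType).
Context (D : cartanData g I).

Notation h := (cartan D).
Notation B := (nform D).
Implicit Types (x y z v : g) (beta gamma : hdual h) (H : subvs_of h).
Notation ad_weight := (@ad_weight K g I D).

Lemma weight_basis_cartan (U : {vspace g}) : (forall H v, v \in U -> [lie vsval H, v] \in U) ->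
  exists (b : seq g) (wt : g -> hdual h),
    basis_of U b /\ forall x, x \in b -> ad_weight (wt x) x.
Proof.
move=> stU; apply: (@weight_basis_exists K g _ _ (fun beta H => beta H : K)
  (fun H => lie (vsval H)) 0 _ _ U stU).
- exact: hdual_inj.
- by move=> H; apply: lie_linearr.
- exact: ad_weight_span.
Qed.

Lemma ad_weight_iter beta gamma y v n : ad_weight beta y -> ad_weight gamma v ->
  ad_weight (gamma + n%:R *: beta) (iter n (lie y) v).
Proof.
move=> bey gv; elim: n => [|n IH]; first by rewrite scale0r addr0.
rewrite -natr1 scalerDl scale1r addrA [_ + beta]addrC /=.
exact: ad_weight_bracket.
Qed.

(** Otherwise the pairwise distinct weights [gamma + n beta] would all occur in [g], more than a
    basis allows. *)
Lemma ad_root_nilpotent beta gamma y v : beta <> 0 ->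
  ad_weight beta y -> ad_weight gamma v -> exists n, iter n (lie y) v = 0.
Proof.
move=> b0 bey gv; apply: contrapT => no.
have [|b [wt [bb wb]]] := @weight_basis_cartan fullv; first by move=> *; apply: memvf.
pose l := [seq gamma + n%:R *: beta | n <- iota 0 (size b).+1].
have ul : uniq l.
  rewrite map_inj_uniq ?iota_uniq // => m n /addrI /eqP.
  rewrite -subr_eq0 -scalerBl scaler_eq0 => /orP[|/eqP//].
  by rewrite subr_eq0 eqr_nat => /eqP.
have sl : {subset l <= map wt b}.
  move=> _ /mapP[n _ ->].
  apply: (@weight_basis_full K g _ _ (fun beta H => beta H : K)
    (fun H => lie (vsval H)) _ _ b wt _ (iter n (lie y) v)) => //.
  - exact: hdual_inj.
  - by move=> H; apply: lie_linearr.
  - exact: ad_weight_iter.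
  - by move=> e; apply: no; exists n.
by have := uniq_leq_size ul sl; rewrite !size_map size_iota ltnn.
Qed.

Lemma ad_root_string beta gamma y v : beta <> 0 ->
  ad_weight beta y -> ad_weight gamma v -> v <> 0 ->
  exists n, iter n (lie y) v != 0 /\ iter n.+1 (lie y) v = 0.
Proof.
move=> b0 bey gv v0; have [m] := ad_root_nilpotent b0 bey gv.
elim: m => [//|m IH] m1; have [/IH//|m0] := eqVneq (iter m (lie y) v) 0.
by exists m.
Qed.

Lemma root_pair beta : is_root beta -> exists x y,
  [/\ ad_weight beta x, ad_weight (- beta) y, B x y = 1
    & [lie x, y] = vsval (tvec beta)].
Proof.
case=> b0 [x x0 bx]; have [y bey Bxy] := dual_weight_vector bx x0.
by exists x, y; split=> //; rewrite (opposite_bracket bx bey) Bxy scale1r.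
Qed.

(** Climb [k] steps to the top of the string, then descend [n] steps to its bottom. Nothing is
    divided by [(beta, beta)], whose nonvanishing is derived from this identity. *)
Lemma root_string_value beta gamma v : is_root beta -> ad_weight gamma v -> v <> 0 ->
  exists n k : nat, 2 * gamma (tvec beta) = (n%:R - 2 * k%:R) * beta (tvec beta) :> K.
Proof.
move=> rb gv v0; have [x [y [bx bey _ xy]]] := root_pair rb; case: (rb) => b0 _.
have [k [xk xk1]] := ad_root_string b0 bx gv v0.
pose v' := iter k (lie x) v; have gv' : ad_weight (gamma + k%:R *: beta) v'.
  exact: ad_weight_iter.
have nb0 : - beta <> 0 by move=> /eqP; rewrite oppr_eq0 => /eqP.
have [n [yn yn1]] := ad_root_string nb0 bey gv' (elimN eqP xk).
have ty : [lie vsval (tvec beta), y] = (- beta (tvec beta) : K) *: y.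
  by rewrite bey opp_lfunE.
exists n, k; have := string_length xy ty xk1 (gv' _) yn yn1.
rewrite add_lfunE scale_lfunE mulrDr => /eqP.
rewrite -subr_eq0 => /eqP e; apply/eqP; rewrite -subr_eq0 -e; apply/eqP.
rewrite -[k%:R *: (beta _)]/(k%:R * (beta (tvec beta) : K)); ring.
Qed.

(** If [(beta, beta) = 0], string values force [gamma(t_beta) = 0] for every weight [gamma] of [g];
    then [t_beta] is central and spans an ideal, against simplicity. *)
Lemma root_norm_neq0 beta : simple_lie g -> is_root beta -> dform B beta beta != 0.
Proof.
move=> [[p [q pq]] simp] rb; apply/eqP; rewrite dformE => b0.
have tz z : [lie vsval (tvec beta), z] = 0.
  elim: (ad_weight_span D z) => [|a u w [gamma gu] _ IH]; first by rewrite lie0r.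
  rewrite lieDr lieZr IH addr0 gu.
  have [->|/eqP u0] := eqVneq u 0; first by rewrite !scaler0.
  have [n [k]] := root_string_value rb gu u0; rewrite b0 mulr0 => /eqP.
  by rewrite mulf_eq0 pnatr_eq0 => /eqP ->; rewrite scale0r scaler0.
have idl z w : w \in <[vsval (tvec beta)]>%VS -> [lie z, w] \in <[vsval (tvec beta)]>%VS.
  by move=> /vlineP[c ->]; rewrite lieZr lieC tz oppr0 scaler0 mem0v.
case: (simp _ idl) => [U0|Uf].
- case: rb => + _; apply; apply: (@tvec_eq0 _ _ _ D); apply: val_inj => /=.
  by apply/eqP; rewrite -memv0 -U0 memv_line.
- case: pq; have /vlineP[c ->] : p \in <[vsval (tvec beta)]>%VS by rewrite Uf memvf.
  by rewrite lieZl tz scaler0.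
Qed.

(** Here [v] is already the top of its string, so the descent alone gives the value. *)
Lemma root_highest_value beta gamma v : is_root beta -> ad_weight gamma v -> v <> 0 ->
  (forall u, ad_weight (gamma + beta) u -> u = 0) ->
  exists n : nat, 2 * gamma (tvec beta) = n%:R * beta (tvec beta) :> K.
Proof.
move=> rb gv v0 top; have [x [y [bx bey _ xy]]] := root_pair rb; case: (rb) => b0 _.
have nb0 : - beta <> 0 by move=> /eqP; rewrite oppr_eq0 => /eqP.
have [n [yn yn1]] := ad_root_string nb0 bey gv v0.
have ty : [lie vsval (tvec beta), y] = (- beta (tvec beta) : K) *: y.
  by rewrite bey opp_lfunE.
have xv : [lie x, v] = 0 by apply: top; rewrite addrC; apply: ad_weight_bracket.
by exists n; rewrite (string_length xy ty xv (gv _) yn yn1) mulrN opprK.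
Qed.

(** Descend [l] steps to the bottom of the string, then climb [q] steps to its top. The length
    formula gives [q = p + 2l], so the vector reached after [l + p] steps is still nonzero. *)
Lemma root_reflection beta gamma v (p : nat) : simple_lie g ->
  is_root beta -> ad_weight gamma v -> v <> 0 ->
  2 * gamma (tvec beta) = - (p%:R * beta (tvec beta) : K) ->
  exists2 u, ad_weight (gamma + p%:R *: beta) u & u <> 0.
Proof.
move=> sg rb gv v0 gp; have [x [y [bx bey _ xy]]] := root_pair rb; case: (rb) => b0 _.
have nb0 : - beta <> 0 by move=> /eqP; rewrite oppr_eq0 => /eqP.
have [l [yl yl1]] := ad_root_string nb0 bey gv v0.
pose v' := iter l (lie y) v.
have gv' : ad_weight (gamma + l%:R *: - beta) v' by apply: ad_weight_iter.
have [q [xq xq1]] := ad_root_string b0 bx gv' (elimN eqP yl).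
(* From the bottom, [x] takes the part of the iterated operator, with [-t_beta] in place of
   [t_beta]. *)
have yx : [lie y, x] = - vsval (tvec beta) by rewrite lieC xy.
have tx : [lie - vsval (tvec beta), x] = (- beta (tvec beta) : K) *: x.
  by rewrite lieNl bx scaleNr.
have tv' : [lie - vsval (tvec beta), v'] = (- (gamma + l%:R *: - beta) (tvec beta) : K) *: v'.
  by rewrite lieNl gv' scaleNr.
have qE : q = (p + 2 * l)%N.
  have := root_norm_neq0 sg rb; rewrite dformE => bt0.
  have := string_length yx tx yl1 tv' xq xq1; move: gp bt0.
  rewrite add_lfunE scale_lfunE opp_lfunE.
  move: (gamma _ : K) (beta _ : K) => G T gp bt0.
  change (2 * - (G + l%:R * - T) = - (q%:R * - T) -> q = (p + 2 * l)%N) => e.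
  have : (q%:R - (p%:R + 2 * l%:R)) * T = 0.
    have -> : (q%:R - (p%:R + 2 * l%:R)) * T =
      - (2 * - (G + l%:R * - T) - - (q%:R * - T)) - (2 * G - - (p%:R * T)) by ring.
    by rewrite e gp !subrr oppr0 addr0.
  move=> /eqP; rewrite mulf_eq0 (negPf bt0) orbF subr_eq0 -natrM -natrD eqr_nat.
  by move=> /eqP.
exists (iter (l + p) (lie x) v').
  have := ad_weight_iter (l + p) bx gv'.
  rewrite -addrA scalerN -scaleNr -scalerDl natrD.
  by rewrite addrA addNr add0r.
move=> e; case/eqP: xq.
have -> : q = (l + (l + p))%N by rewrite qE; lia.
by rewrite iterD e; elim: (l) => [//|m /= ->]; rewrite lie0r.
Qed.

End RootStrings.

(** * Root lengths *)

Section TraceForm.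
Context (K : numFieldType) (g : finLieAlgType K) (b : seq g).
Hypothesis bb : basis_of fullv b.
Implicit Types x y z : g.

Notation bt := (in_tuple b).

Definition ad_mx x : 'M[K]_(size b) := \matrix_(i, k) coord bt k [lie x, bt`_i].

Lemma ad_mxE x (i : 'I_(size b)) : [lie x, bt`_i] = \sum_k ad_mx x i k *: bt`_k.
Proof.
rewrite {1}(@coord_basis _ _ fullv _ bt [lie x, bt`_i]) ?memvf //.
by apply: eq_bigr => k _; rewrite mxE.
Qed.

Lemma ad_mx_comp x y (i k : 'I_(size b)) :
  coord bt k [lie x, [lie y, bt`_i]] = (ad_mx y *m ad_mx x) i k.
Proof.
rewrite ad_mxE (lin_sum (lie_linearr x)) linear_sum mxE.
by apply: eq_bigr => l _; rewrite lieZr linearZ /= !mxE.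
Qed.

Lemma ad_mx_bracket x y : ad_mx [lie x, y] = ad_mx y *m ad_mx x - ad_mx x *m ad_mx y.
Proof.
apply/matrixP => i k; rewrite [LHS]mxE [RHS]mxE [X in _ = _ + X]mxE -!ad_mx_comp.
rewrite -linearB /=; by rewrite (lie_leibniz x y) addrK.
Qed.

Lemma ad_mx_is_linear : linear ad_mx.
Proof.
by move=> a x y; apply/matrixP => i k; rewrite !mxE lieDl lieZl linearP.
Qed.

(** The Killing form, computed in the basis [b]. *)
Definition trace_form x y : K := \tr (ad_mx x *m ad_mx y).

Lemma trace_formC x y : trace_form x y = trace_form y x.
Proof. exact: mxtrace_mulC. Qed.

Lemma trace_form_inv x y z : trace_form [lie x, y] z = trace_form x [lie y, z].
Proof.
rewrite /trace_form !ad_mx_bracket mulmxBl mulmxBr !linearB /=.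
by rewrite -mulmxA mxtrace_mulC !mulmxA.
Qed.

Lemma trace_formP a x y z : trace_form (a *: x + y) z = a * trace_form x z + trace_form y z.
Proof. by rewrite /trace_form ad_mx_is_linear mulmxDl linearD -scalemxAl linearZ. Qed.

Lemma trace_form_linear z : linear (trace_form^~ z : g -> K^o).
Proof. by move=> a x y; rewrite trace_formP. Qed.

End TraceForm.

Lemma free_comb_eq0 (K : fieldType) (V : vectType K) (I : finType) (a : I -> V)
    (k : I -> K) :
  free (codom a) -> \sum_i k i *: a i = 0 -> forall i, k i = 0.
Proof.
move=> fa e i; have /freeP := (fa : free (codom_tuple a)).
move=> /(_ (fun j => k (enum_val j)))/(_ _ (enum_rank i)); rewrite enum_rankK; apply.
rewrite -[RHS]e (reindex (@enum_val I I)) /=; last first.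
  by apply: onW_bij; apply: enum_val_bij.
by apply: eq_bigr => j _; rewrite nth_codom.
Qed.

Section NatCombinations.
Context (K : numFieldType) (V : lmodType K) (I : finType) (a : I -> V).
Hypothesis comb_eq0 : forall k : I -> K, \sum_i k i *: a i = 0 -> forall i, k i = 0.

Lemma nat_comb_inj (n m : I -> nat) :
  \sum_i (n i)%:R *: a i = \sum_i (m i)%:R *: a i -> n =1 m.
Proof.
move=> e i; apply/eqP; rewrite -(eqr_nat K) -subr_eq0; apply/eqP.
apply: (comb_eq0 (k := fun i => (n i)%:R - (m i)%:R)).
by under eq_bigr do rewrite scalerBl; rewrite sumrB e subrr.
Qed.

Lemma nat_comb_eq0 (n : I -> nat) : \sum_k (n k)%:R *: a k = 0 -> forall k, n k = 0%N.
Proof.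
move=> e; apply: (nat_comb_inj (m := fun=> 0%N)); rewrite e big1 // => i _.
by rewrite scale0r.
Qed.

End NatCombinations.

Section NatCombinationsOps.
Context (K : numFieldType) (V : lmodType K) (I : finType) (a : I -> V).

Lemma nat_comb_delta i : \sum_k (k == i : nat)%:R *: a k = a i.
Proof.
rewrite (bigD1 i) //= eqxx scale1r big1 ?addr0 // => k /negPf ->.
by rewrite scale0r.
Qed.

Lemma nat_combD (n m : I -> nat) : \sum_k ((n k + m k)%N)%:R *: a k =
  \sum_k (n k)%:R *: a k + \sum_k (m k)%:R *: a k.
Proof. by rewrite -big_split; apply: eq_bigr => k _; rewrite natrD scalerDl. Qed.

Lemma nat_combM (p : nat) (n : I -> nat) : \sum_k ((p * n k)%N)%:R *: a k =
  p%:R *: \sum_k (n k)%:R *: a k.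
Proof. by rewrite scaler_sumr; apply: eq_bigr => k _; rewrite natrM scalerA. Qed.

End NatCombinationsOps.

Section RootLengths.
Context (K : numFieldType) (g : finLieAlgType K) (I : finType).
Context (D : cartanData g I).

Notation h := (cartan D).
Notation B := (nform D).
Implicit Types (x y z v : g) (beta gamma : hdual h) (H : subvs_of h).
Notation ad_weight := (@ad_weight K g I D).

Lemma simple_ideal (U : g -> Prop) : simple_lie g -> subspace U ->
  (forall x y, U y -> U [lie x, y]) -> (exists2 x, U x & x <> 0) -> forall x, U x.
Proof.
move=> [_ simp] sU idU [x Ux x0] y; have [V VU] := subspace_vspace sU.
case: (simp V) => [u v /VU Uv|V0|Vf].
- by apply/VU/idU.
- by case: x0; apply/eqP; rewrite -memv0 -V0; apply/VU.
- by apply/VU; rewrite Vf memvf.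
Qed.

Lemma trace_form_cartan (b : seq g) (wt : g -> hdual h) H :
  basis_of fullv b -> (forall x, x \in b -> ad_weight (wt x) x) ->
  trace_form b (vsval H) (vsval H) = \sum_(x <- b) (wt x H : K) ^+ 2.
Proof.
move=> bb wb.
have fb : free (in_tuple b) by rewrite (basis_free bb).
have E (i k : 'I_(size b)) : ad_mx b (vsval H) i k = wt b`_i H *+ (i == k).
  rewrite mxE wb ?mem_nth // linearZ /= coord_free //.
  by case: eqP; rewrite ?mulr1 ?mulr0.
rewrite (big_nth 0) big_mkord /trace_form /mxtrace; apply: eq_bigr => i _.
rewrite mxE (bigD1 i) //= big1 ?addr0 => [|k ki].
  by rewrite !E eqxx expr2.
by rewrite !E eq_sym (negPf ki) mul0r.
Qed.

(** By simplicity the Killing form is a multiple [c] of the given form. At [t_gamma] this reads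
    [4 c = s (gamma, gamma)] with [s] a positive sum of squared integers; the root of squared length
    2 shows that [c] is positive, and then so is every [(gamma, gamma)]. *)
Lemma root_norm_gt0 beta : simple_lie g -> is_root beta -> 0 < dform B beta beta.
Proof.
move=> sg; have [|b [wt [bb wb]]] := @weight_basis_cartan K g I D fullv.
  by move=> *; apply: memvf.
case: (nformP D) => _ _ [beta0 rb0 lb0].
pose kap := trace_form b.
(* As [B x y = 1], the value [kap x y] is the only possible factor. *)
have [x [y [bx bey Bxy xy]]] := root_pair rb0; pose c := kap x y.
pose t0 := vsval (tvec beta0).
have kapP a u v w : kap (a *: u + v) w = a * kap u w + kap v w by exact: trace_formP.
have kapC u v : kap u v = kap v u by exact: trace_formC.
have kapI u v w : kap [lie u, v] w = kap u [lie v, w] by exact: trace_form_inv.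
have kap0 w : kap 0 w = 0 by exact: (lin0 (trace_form_linear b w)).
have kapZ a u w : kap (a *: u) w = a * kap u w.
  by have := kapP a u 0 w; rewrite !addr0 kap0 addr0.
(* The [z] for which this holds for all [w] form an ideal, so it suffices to treat [t0], which is
   nonzero. *)
have kapE z w : kap z w = c * B z w.
  move: z w; apply: (simple_ideal (U := fun z => forall w, kap z w = c * B z w) sg).
  - split=> [w|a u v Uu Uv w]; first by rewrite form0l mulr0 kap0.
    by rewrite kapP Uu Uv formDl formZl mulrDr mulrCA.
  - move=> u z Uz w.
    by rewrite lieC -scaleN1r kapZ formZl kapI Uz form_inv mulrCA.
  exists t0; last first.
    move=> e; case: rb0 => + _; apply; apply: (@tvec_eq0 _ _ _ D); apply: val_inj.
    exact: e.
  move=> w; elim: (ad_weight_span D w) => [|a u v [gamma gu] _ IH].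
    by rewrite form0r mulr0 kapC kap0.
  rewrite formDr formZr mulrDr kapC kapP (kapC v) IH.
  congr (_ + _); rewrite [RHS]mulrCA; congr (_ * _).
  have [e|g0] := eqVneq gamma 0.
    have uh : u \in h by apply/ad_weight0P; rewrite -e.
    rewrite -(vsprojK uh) tvecE kapC /t0 -xy kapC -kapI bx.
    by rewrite kapZ mulrC.
  (* In nonzero weight both sides vanish: multiply by [gamma(H)] and move [H] across to [t0], which
     commutes with it. *)
  have [H Hg] : exists H, gamma H <> 0 :> K.
    apply/existsNP => e; case/eqP: g0; apply/hdual_inj => H.
    by rewrite e lfunE.
  apply: (mulfI (introN eqP Hg)); rewrite [RHS]mulrCA.
  have t0h : [lie t0, vsval H] = 0 by exact: cartan_lie.
  rewrite -formZr -kapZ -gu -form_inv t0h form0l mulr0.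
  by rewrite kapC -kapI t0h kap0.
move=> {}rb.
have S gamma : is_root gamma -> exists2 s : K, 0 < s & 4 * c = s * dform B gamma gamma.
  move=> rg; have n0 := root_norm_neq0 sg rg; set n := dform B gamma gamma in n0 *.
  (* The Cartan integer of [wt x] against [gamma]. It equals 2 on a basis vector of weight [gamma],
     so the sum of squares is positive. *)
  pose m x : K := 2 * (wt x (tvec gamma) : K) / n.
  have mz u : u \in b -> exists z : int, m u = z%:~R.
    move=> ub; have u0 : u <> 0.
      by apply/eqP; apply: free_not0 ub; apply: basis_free bb.
    have [p [k pk]] := root_string_value rg (wb u ub) u0.
    exists (p%:Z - 2 * k%:Z); rewrite /m pk -dformE -/n mulfK // rmorphB rmorphM /=.
    by rewrite !pmulrn.
  have m2 u : u \in b -> 0 <= m u ^+ 2.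
    by move=> /mz[z ->]; rewrite -rmorphXn ler0z sqr_ge0.
  exists (\sum_(u <- b) m u ^+ 2).
    have [[_ [v v0 gv]]] := (rg, rg); have := weight_basis_full
      (ev := fun beta H => beta H : K) (act := fun H => lie (vsval H)) (@hdual_inj _ _ _ D)
      (fun H => lie_linearr (vsval H)) bb wb gv v0.
    move=> /mapP[u ub ug].
    rewrite (big_rem u) //= ltr_wpDr //.
      by rewrite big_seq; apply: sumr_ge0 => w /mem_rem; apply: m2.
    by rewrite /m -ug -dformE -/n mulfK // exprn_gt0 // ltr0n.
  apply: (mulIf n0).
  have <- : B (vsval (tvec gamma)) (vsval (tvec gamma)) = n by rewrite tvecE -dformE.
  rewrite -!mulrA -kapE /kap (trace_form_cartan _ bb wb) tvecE -dformE -/n.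
  rewrite mulr_sumr mulr_suml; apply: eq_bigr => u _.
  rewrite /m !exprMn exprVn; field; exact: n0.
have [s0 s0_gt0 s0E] := S _ rb0; have [s s_gt0 sE] := S _ rb.
have : 0 < s * dform B beta beta.
  by rewrite -sE s0E lb0 mulr_gt0.
by rewrite pmulr_rgt0.
Qed.

Lemma root_norm_le2 beta : is_root beta -> dform B beta beta <= 2.
Proof. by case: (nformP D) => _ + _; apply. Qed.

(** A root [theta + alpha_i] would contradict the maximality of [theta]; if the sum were 0, then
    [theta - alpha_i = -2 alpha_i] would have to be nonnegative. *)
Lemma highest_root_add_eq0 i u : ad_weight (theta D + alpha D i) u -> u = 0.
Proof.
case: (thetaP D) => rth thmax; case: (alphaP D) => ra ba _.
move=> tu; apply: contrapT => u0.
have [e|/eqP ne] := eqVneq (theta D + alpha D i) 0.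
  have [n nE] := thmax _ (ra i).
  have := nat_comb_eq0 (fun k => free_comb_eq0 (basis_free ba)) (n := fun k => (n k + 2 * (k == i))%N).
  rewrite nat_combD (nat_combM _ 2 (fun k => (k == i : nat))) nat_comb_delta -nE.
  have -> : theta D = - alpha D i by apply/eqP; rewrite -addr_eq0 e.
  rewrite scaler_nat mulr2n addrACA addNr addr0 => /(_ erefl i).
  by rewrite eqxx; lia.
have [n nE] := thmax _ (conj ne (ex_intro2 _ _ u u0 tu)).
have := nat_comb_eq0 (fun k => free_comb_eq0 (basis_free ba)) (n := fun k => (n k + (k == i))%N).
rewrite nat_combD nat_comb_delta -nE opprD addrA subrr add0r addNr => /(_ erefl i).
by rewrite eqxx; lia.
Qed.

(* Reflecting a long root in simple roots makes it dominant; the dominant long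
   root [beta] then satisfies [(theta, theta) - (beta, beta) = (theta - beta, theta + beta) >= 0]. *)
Lemma highest_root_norm : simple_lie g -> dform B (theta D) (theta D) = 2.
Proof.
move=> sg; case: (thetaP D) => rth thmax; case: (alphaP D) => ra ba _.
have n2 : 2 != 0 :> K by rewrite pnatr_eq0.
have dD (u v w : hdual h) : dform B (u + v) w = dform B u w + dform B v w.
  by rewrite ![dform _ _ w]dformC !dformE add_lfunE.
have dZ a (u w : hdual h) : dform B (a *: u) w = a * dform B u w.
  by rewrite ![dform _ _ w]dformC !dformE scale_lfunE.
have dDr (u v w : hdual h) : dform B w (u + v) = dform B w u + dform B w v.
  by rewrite !(dformC w) dD.
have thi i : 0 <= dform B (alpha D i) (theta D).
  case: (rth) => _ [v v0 tv].
  have [|n e] := root_highest_value (ra i) tv v0; first exact: highest_root_add_eq0.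
  rewrite -(pmulr_rge0 _ (ltr0n _ 2)) (dformE (alpha D i)) e mulr_ge0 ?ler0n //.
  by rewrite -dformE ltW // root_norm_gt0.
(* Induction on the height of [theta - beta], which each reflection making progress strictly
   lowers. *)
suff key N : forall beta, is_root beta -> dform B beta beta = 2 ->
    forall n : I -> nat, theta D - beta = \sum_i (n i)%:R *: alpha D i ->
    (\sum_i n i < N)%N -> 2 <= dform B (theta D) (theta D).
  case: (nformP D) => _ _ [beta rb lb]; have [n nE] := thmax _ rb.
  apply/eqP; rewrite eq_le root_norm_le2 //=; exact: key rb lb _ nE (ltnSn _).
elim: N => // N IH beta rb lb n nE; rewrite ltnS => nN.
have [dom|/existsNP[i ndom]] := pselect (forall i, 0 <= dform B (alpha D i) beta).
  have -> : dform B (theta D) (theta D) =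
      dform B beta beta + dform B (theta D - beta) (theta D + beta).
    rewrite dD dDr -scaleN1r dZ dDr (dformC beta (theta D)); ring.
  rewrite lb lerDl nE.
  have dl (w : hdual h) : linear ((fun u : hdual h => dform B u w) : hdual h -> K^o).
    by move=> a u v; rewrite dD dZ.
  rewrite (lin_sum (dl _)); apply: sumr_ge0 => i _.
  by rewrite dZ mulr_ge0 ?ler0n // dDr addr_ge0.
have n_gt0 := root_norm_gt0 sg (ra i).
case: (rb) => _ [v v0 bv]; have [q [k qk]] := root_string_value (ra i) bv v0.
rewrite -!dformE in qk.
(* The order of [K] is only partial; the string value turns the failure of dominance into a negative
   integer [q - 2k]. *)
have kq : (q < 2 * k)%N.
  rewrite ltnNge; apply/negP => kq; apply: ndom.
  rewrite -(pmulr_rge0 _ (ltr0n _ 2)) qk mulr_ge0 ?(ltW n_gt0) //.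
  by rewrite -natrM subr_ge0 ler_nat.
pose p := (2 * k - q)%N.
have pE : 2 * dform B (alpha D i) beta = - (p%:R * dform B (alpha D i) (alpha D i)).
  by rewrite qk -[RHS]mulNr /p natrB 1?ltnW // opprB natrM.
have [|u bu u0] := root_reflection (p := p) sg (ra i) bv v0.
  by rewrite -!dformE.
have lb' : dform B (beta + p%:R *: alpha D i) (beta + p%:R *: alpha D i) = 2.
  rewrite dD !dDr lb (dformC beta) !dZ (dformC (alpha D i) (_ *: _)) dZ.
  transitivity (2 + p%:R * (2 * dform B (alpha D i) beta
     + p%:R * dform B (alpha D i) (alpha D i))); first by ring.
  by rewrite pE addNr mulr0 addr0.
have rb' : is_root (beta + p%:R *: alpha D i).
  split; last by exists u.
  by move=> b0; move: lb'; rewrite b0 dformE zero_lfunE => /esym/eqP; rewrite (negPf n2).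
have [n' n'E] := thmax _ rb'.
apply: (IH _ rb' lb' _ n'E).
have nn' : forall k, n k = (n' k + p * (k == i))%N.
  apply: (nat_comb_inj (fun k => free_comb_eq0 (basis_free ba))).
  rewrite (nat_combD _ n' (fun k => p * (k == i))%N) (nat_combM _ p (fun k => (k == i : nat))).
  by rewrite nat_comb_delta -nE -n'E opprD addrA subrK.
apply: leq_trans nN; under [X in (_ < X)%N]eq_bigr do rewrite nn'.
rewrite big_split /= -big_distrr /= [X in (p * X)%N](bigD1 i) //= eqxx.
have p_gt0 : (0 < p)%N by rewrite /p subn_gt0.
set s := (\sum_i n' i)%N; by rewrite -[X in (X < _)%N]addn0 ltn_add2l muln_gt0 p_gt0.
Qed.

End RootLengths.

(** * Generation of [g] by simple root vectors *)

Section Generation.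
Context (K : numFieldType) (g : finLieAlgType K) (I : finType).
Context (D : cartanData g I).

Notation h := (cartan D).
Notation B := (nform D).
Implicit Types (x y z v : g) (beta gamma : hdual h) (H : subvs_of h).
Notation ad_weight := (@ad_weight K g I D).

Definition lie_closed (L : lieAlgType K) (S : L -> Prop) :=
  subspace S /\ forall x y : L, S x -> S y -> S [lie x, y].

(** Such an [x] has a dual vector of weight 0 unless it vanishes, and that vector lies in [h], hence
    in [S]. *)
Lemma orthogonal_weight0_eq0 (S : g -> Prop) x : (forall H, S (vsval H)) ->
  ad_weight 0 x -> (forall s, S s -> B x s = 0) -> x = 0.
Proof.
move=> Sh x0 ox; have [//|/eqP xn] := eqVneq x 0.
have [y y0 Bxy] := dual_weight_vector x0 xn; rewrite oppr0 in y0.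
move: Bxy; have yh : y \in h by apply/ad_weight0P.
by rewrite -(vsprojK yh) ox // => /esym/eqP; rewrite oner_eq0.
Qed.

Section Half.
Context (a : I -> hdual h) (e f : I -> g) (c : I -> K) (S : g -> Prop).
Hypothesis simple_a : simple_roots a.
Hypothesis ea : forall i, ad_weight (a i) (e i).
Hypothesis fa : forall i, ad_weight (- a i) (f i).
Hypothesis ef : forall i, [lie e i, f i] = c i *: vsval (tvec (a i)).
Hypothesis c0 : forall i, c i != 0.
Hypothesis S_closed : lie_closed S.
Hypothesis Sh : forall H, S (vsval H).
Hypothesis Se : forall i, S (e i).
Hypothesis Sf : forall i, S (f i).

Let fra (k : I -> K) : \sum_i k i *: a i = 0 -> forall i, k i = 0.
Proof. by case: simple_a => _ ba _; apply: free_comb_eq0; apply: basis_free ba. Qed.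

(** Positivity is relative to the system [a], which will be [alpha] and then its opposite. *)
Let positive beta := exists2 n : I -> nat,
  (exists i, n i <> 0%N) & beta = \sum_i (n i)%:R *: a i.

Let posspan := lspan (fun u => exists2 beta, positive beta & ad_weight beta u).

Let orth x := forall s, S s -> B x s = 0.

Let orth_stable x y : S y -> orth x -> orth [lie y, x].
Proof.
case: S_closed => _ SS Sy ox s Ss.
by rewrite lieC -scaleN1r formZl form_inv ox ?mulr0 //; apply: SS.
Qed.

Let orth_subspace : subspace orth.
Proof.
split=> [s _|k u v ou ov s Ss]; first by rewrite form0l.
by rewrite formDl formZl ou // ov // mulr0 addr0.
Qed.

(* [h_i] has trace zero on the part of [S^perp] spanned by positive root vectors, so the
   roots occurring there sum to zero. *)
Lemma orthogonal_positive_eq0 beta x : positive beta -> ad_weight beta x ->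
  orth x -> x = 0.
Proof.
move=> pb bx ox; have [U UE] := subspace_vspace (subspaceI orth_subspace
  (lspan_subspace (fun u => exists2 beta, positive beta & ad_weight beta u))).
have hU H v : v \in U -> [lie vsval H, v] \in U.
  move=> /UE[ov pv]; apply/UE; split; first exact: orth_stable.
  elim: pv => [|k u w [gamma pg gu] _ IH]; first by rewrite lie0r; left.
  rewrite lieDr lieZr gu; apply: lspanD => //.
  apply: subspaceZ; first exact: lspan_subspace.
  apply: subspaceZ; first exact: lspan_subspace.
  by apply: lspan_in; exists gamma.
have [b [wt [bb wb]]] := weight_basis_cartan hU.
have eb : free b := basis_free bb.
have bU u : u \in b -> orth u /\ posspan u by move=> /(basis_mem bb)/UE.
have b0 u : u \in b -> u <> 0 by move=> ub; apply/eqP; apply: free_not0 ub.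
have pwt u : u \in b -> positive (wt u).
  move=> ub; have [_ pu] := bU u ub.
  exact: (ad_weight_class _ pu (wb u ub) (b0 u ub)).
have addi beta' i : positive beta' -> positive (a i + beta').
  move=> [n _ ->]; exists (fun k => ((k == i) + n k)%N); last first.
    by rewrite nat_combD nat_comb_delta.
  by exists i; rewrite eqxx.
have eU u i : u \in b -> [lie e i, u] \in U.
  move=> ub; have [ou pu] := bU u ub; apply/UE; split; first exact: orth_stable.
  apply: lspan_in; exists (a i + wt u); first exact/addi/pwt.
  exact: ad_weight_bracket (ea i) (wb u ub).
(* Lowering could leave the positive cone only from [wt u = a i]: if the result were [-m] with
   [m >= 0], then [n + m] would be the single simple root [a i], so the result has weight 0, where
   the orthogonal of [S] is trivial. *)
have fU u i : u \in b -> [lie f i, u] \in U.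
  move=> ub; have [ou pu] := bU u ub; apply/UE.
  have ofu : orth [lie f i, u] by exact: orth_stable.
  split=> //; have wfu := ad_weight_bracket (fa i) (wb u ub).
  have [->|/eqP fu0] := eqVneq [lie f i, u] 0; first by left.
  have [g0|/eqP g0] := eqVneq (- a i + wt u) 0.
    by case: fu0; apply: (orthogonal_weight0_eq0 Sh) => //; rewrite -g0.
  apply: lspan_in; exists (- a i + wt u) => //.
  have rg : is_root (- a i + wt u) by split=> //; exists [lie f i, u].
  case: simple_a => _ _ /(_ _ rg)[m [mE|mE]].
    exists m => //; apply: contrapT => m0; apply: g0; rewrite mE big1 // => k _.
    by have [->|mk] := eqVneq (m k) 0%N; rewrite ?scale0r //; case: m0; exists k; apply/eqP.
  have [n [k nk] nE] := pwt u ub.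
  have nm l : (n l + m l = (l == i))%N.
    apply: (nat_comb_inj fra (n := fun l => (n l + m l)%N) (m := fun l => (l == i : nat))).
    rewrite nat_combD nat_comb_delta -nE -[X in _ + X]opprK -mE opprD opprK.
    by rewrite addrC subrK.
  have ki : k = i by apply/eqP; move: (nm k); case: eqP => //; lia.
  case: g0; rewrite nE (eq_bigr (fun l => (l == i : nat)%:R *: a l)) ?nat_comb_delta ?addNr //.
  move=> l _; congr (_%:R *: _); have := nm l; case: (eqVneq l i) => [->|_] /=; last by lia.
  by have := nm i; rewrite eqxx -ki; lia.
have tr i : \sum_(u <- b) (wt u (tvec (a i)) : K) = 0.
  have := @trace_commutator_eq0 K g _ (in_tuple b) (lie (e i)) (lie (f i))
    (lie [lie e i, f i]) (fun k => c i * (wt b`_k (tvec (a i)) : K)).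
  rewrite (span_basis bb) => H.
  suff : c i * \sum_(u <- b) (wt u (tvec (a i)) : K) = 0.
    by move/eqP; rewrite mulf_eq0 (negPf (c0 i)) => /eqP.
  rewrite (big_nth 0) big_mkord mulr_sumr; apply: H => //.
  - exact: lie_linearr.
  - exact: lie_linearr.
  - by move=> k; apply: eU; apply: mem_nth.
  - by move=> k; apply: fU; apply: mem_nth.
  - by move=> k; rewrite ef lieZl wb ?mem_nth // scalerA.
  - by move=> k; rewrite lie_leibniz addrK.
(* Pairing to zero with all simple roots, [G] vanishes; as a sum of nonzero nonnegative
   combinations, it can vanish only if [b] is empty. *)
pose G := \sum_(u <- b) wt u.
have G0 : G = 0.
  apply: (@tvec_eq0 _ _ _ D); apply: cartan_eq0 => beta'.
  case: simple_a => _ ba _; have : beta' \in <<codom a>>%VS.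
    by rewrite (span_basis ba) memvf.
  move=> /lspan_span; elim=> [|k u v /codomP[i ->] _ IH]; first by rewrite lfunE.
  rewrite add_lfunE IH addr0 scale_lfunE -dformE dformC dformE.
  by rewrite /G sum_lfunE tr scaler0.
have : x \in U by apply/UE; split=> //; apply: lspan_in; exists beta.
suff b_nil : b = [::] by move: bb; rewrite b_nil => /span_basis <-; rewrite span_nil memv0 => /eqP.
have /choice[n nP] : forall u, exists n : I -> nat, u \in b ->
    (exists i, n i <> 0%N) /\ wt u = \sum_i (n i)%:R *: a i.
  move=> u; have [/pwt[n ? ?]|_] := boolP (u \in b); first by exists n.
  by exists (fun=> 0%N).
have nE i : (\sum_(u <- b) n u i = 0)%N.
  apply: (nat_comb_eq0 fra (n := fun i => (\sum_(u <- b) n u i)%N)).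
  rewrite -[RHS]G0 /G; under eq_bigr do rewrite natr_sum scaler_suml.
  by rewrite exchange_big /=; apply: eq_big_seq => u /nP[].
case: (b) nP nE => // u b' nP nE; have [[i ni] _] := nP u (mem_head _ _); case: ni.
by have := nE i; rewrite big_cons; lia.
Qed.

End Half.

Lemma opp_simple_roots : simple_roots (fun i => - alpha D i).
Proof.
case: (alphaP D) => ra ba pos; split.
- by move=> i; apply: opp_root.
- have [N NE] := @lfun_of_linear K (hdual h) (hdual h) -%R (fun k p q =>
    etrans (opprD _ _) (congr1 (+%R^~ (- q)) (esym (scalerN k p)))).
  have kN : lker N == 0%VS by apply/lker0P => p q; rewrite !NE => /oppr_inj.
  have := limg_basis_of (f := N) (X := codom (alpha D)) (U := fullv).
  rewrite (eqP kN) capv0 lker0_limgf // => /(_ erefl ba).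
  suff -> : map N (codom (alpha D)) = codom (fun i => - alpha D i) by [].
  by rewrite !codomE -map_comp; apply: eq_map => i /=; rewrite NE.
- move=> beta /pos[n nE]; exists n.
  have -> : \sum_i (n i)%:R *: - alpha D i = - \sum_i (n i)%:R *: alpha D i.
    by rewrite -sumrN; apply: eq_bigr => i _; rewrite scalerN.
  by rewrite opprK; case: nE => ->; [right | left].
Qed.

(** Restricting [B x] to [U] embeds [g] into the dual of [U], so [dim g <= dim U]. *)
Lemma orthogonal_full (U : {vspace g}) :
  (forall x, (forall s, s \in U -> B x s = 0) -> x = 0) -> U = fullv.
Proof.
move=> U0; pose P x : 'Hom(subvs_of U, K^o) := linfun ((B x : g -> K^o) \o vsval).
have PE x s : P x s = B x (vsval s) by rewrite lfunE.
have [F FE] : exists F : 'Hom(g, 'Hom(subvs_of U, K^o)), F =1 P.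
  apply: lfun_of_linear => k x y; apply/lfunP => s.
  by rewrite add_lfunE scale_lfunE !PE formDl formZl.
apply/eqP; rewrite eqEdim subvf /=.
have kF : lker F == 0%VS.
  rewrite -subv0; apply/subvP => x; rewrite memv_ker memv0 FE => /eqP Px.
  apply/eqP/U0 => s sU; rewrite -(vsprojK sU) -PE Px lfunE; exact: erefl.
have := dimvS (subvf (F @: fullv)); rewrite limg_dim_eq; last by rewrite (eqP kF) capv0.
by rewrite !dimvf /= /dim /= muln1.
Qed.

(** The orthogonal of [S] is stable under [h], so only its weight vectors matter: weight 0 is
    excluded by nondegeneracy on [h], positive roots by the trace argument, negative roots by the
    same argument for [-alpha] with [e] and [f] exchanged. *)
Lemma chevalley_generation (e f : I -> g) (c : I -> K) (S : g -> Prop) :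
  (forall i, ad_weight (alpha D i) (e i)) ->
  (forall i, ad_weight (- alpha D i) (f i)) ->
  (forall i, [lie e i, f i] = c i *: vsval (tvec (alpha D i))) ->
  (forall i, c i != 0) ->
  lie_closed S -> (forall H, S (vsval H)) -> (forall i, S (e i)) ->
  (forall i, S (f i)) -> forall x, S x.
Proof.
move=> ea fa ef c0 S_closed Sh Se Sf x.
have [U UE] := subspace_vspace S_closed.1.
apply/UE; rewrite (_ : U = fullv) ?memvf //; apply: orthogonal_full => {}x ox.
have {}ox s : S s -> B x s = 0 by move/UE; apply: ox.
pose orth y := forall s, S s -> B y s = 0.
have sorth : subspace orth.
  split=> [s _|k u v ou ov s Ss]; first by rewrite form0l.
  by rewrite formDl formZl ou // ov // mulr0 addr0.
have storth H v : orth v -> orth [lie vsval H, v].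
  move=> ov s Ss; rewrite lieC -scaleN1r formZl form_inv ov ?mulr0 //.
  by apply: S_closed.2.
have := stable_weight_span (ev := fun beta H => beta H : K)
  (act := fun H => lie (vsval H)) (@hdual_inj _ _ _ D)
  (fun H => lie_linearr (vsval H)) sorth storth (ad_weight_span D x) ox.
elim=> // k u v [ou [beta bu]] _ ->; rewrite addr0.
suff -> : u = 0 by rewrite scaler0.
apply: contrapT => u0; apply: (u0).
have [b0|/eqP b0] := eqVneq beta 0.
  by apply: (orthogonal_weight0_eq0 Sh) => //; rewrite -b0.
have rb : is_root beta by split=> //; exists u.
have nz (a : I -> hdual h) (n : I -> nat) : beta = \sum_i (n i)%:R *: a i ->
    exists i, n i <> 0%N.
  move=> bE; apply: contrapT => no; apply: b0; rewrite bE big1 // => i _.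
  by have [->|ni] := eqVneq (n i) 0%N; rewrite ?scale0r //; case: no; exists i; apply/eqP.
case: (alphaP D) => _ _ /(_ _ rb)[n [nE|nE]].
  apply: (orthogonal_positive_eq0 (alphaP D) ea fa ef c0 S_closed Sh Se Sf _ bu ou).
  by exists n => //; apply: nz nE.
have fe i : [lie f i, e i] = c i *: vsval (tvec (- alpha D i)).
  by rewrite lieC ef tvecN -scalerN.
have ea' i : ad_weight (- - alpha D i) (e i) by rewrite opprK.
apply: (orthogonal_positive_eq0 opp_simple_roots fa ea' fe c0 S_closed Sh Sf Se _ bu ou).
have nE' : beta = \sum_i (n i)%:R *: - alpha D i.
  by rewrite nE -sumrN; apply: eq_bigr => i _; rewrite scalerN.
by exists n => //; apply: nz nE'.
Qed.

End Generation.

(** * Root vectors of the affine algebra *)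

Lemma big_option (V : nmodType) (I : finType) (F : option I -> V) :
  \sum_i F i = F None + \sum_i F (Some i).
Proof.
rewrite (bigD1 None) //=; congr (_ + _).
rewrite (reindex_omap Some id) => [|[]//].
by apply: eq_bigl => i; rewrite eqxx.
Qed.

Section LoopCoefficients.
Context (K : numFieldType) (g : lieAlgType K).

Definition loop_coef r (f : loops g) : g := f@_r.

Lemma loop_coef_is_linear r : linear (loop_coef r).
Proof. by move=> a f f'; rewrite /loop_coef mcoeffD mcoeff_scale. Qed.
HB.instance Definition _ r :=
  GRing.isLinear.Build K (loops g) g _ (loop_coef r) (loop_coef_is_linear r).

Lemma loop_coef_mono r s (x : g) : loop_coef r (loop_mono s x) = if s == r then x else 0.
Proof. by rewrite /loop_coef mcoeffU; case: eqP; rewrite ?mulr1n ?mulr0n. Qed.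

Lemma loop_coef_bracket0 r (x : g) f :
  loop_coef r (loop_bracket (loop_mono 0 x) f) = [lie x, loop_coef r f].
Proof.
move: f; apply: (@loops_ext K g g (loop_coef r \o loop_bracket (loop_mono 0 x))
  (lie x \o loop_coef r)) => s y /=.
by rewrite loop_bracket_mono add0r !loop_coef_mono; case: eqP; rewrite ?lie0r.
Qed.

Lemma loop_coef_deriv r f : loop_coef r (loop_deriv f) = r%:~R *: loop_coef r f.
Proof.
move: f; apply: (@loops_ext K g g (loop_coef r \o @loop_deriv K g)
  ( *:%R r%:~R \o loop_coef r)) => s y /=.
by rewrite loop_deriv_mono linearZ /= !loop_coef_mono; case: eqP => [->|]; rewrite ?scaler0.
Qed.

Lemma loop_coef_ext (f f' : loops g) : (forall r, loop_coef r f = loop_coef r f') -> f = f'.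
Proof. by move=> e; apply/malgP => r; apply: e. Qed.

Lemma loop_mono_span (P : loops g -> Prop) : subspace P ->
  (forall r x, P (loop_mono r x)) -> forall f, P f.
Proof.
move=> sP Pm f; have -> : f = \sum_(r <- msupp f) loop_mono r f@_r by exact: monalgE.
have := @subspace_sum K (loops g) P _ (msupp f) xpredT (fun r => loop_mono r f@_r) sP.
by apply => r _; apply: Pm.
Qed.

End LoopCoefficients.

Section AffineRoots.
Context (K : numFieldType) (g : finLieAlgType K) (I : finType).
Context (D : cartanData g I).

Notation h := (cartan D).
Notation B := (nform D).
Notation ghat := (affine (nform D)).
Notation ad_weight := (@ad_weight K g I D).
Notation root_vector := (@root_vector K g I D).
Notation hhat_in := (@hhat_in K g I D).
Implicit Types (x y : g) (beta : hdual h) (X Y Z : ghat) (mu : weight D) (H : hhat D).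

Definition mono r x : ghat := (loop_mono r x, 0, 0).

Lemma affine_pairE (f f' : loops g) (a a' b b' : K^o) : f = f' -> a = a' -> b = b' ->
  (f, a, b) = (f', a', b') :> ghat.
Proof. by move=> -> -> ->. Qed.

Lemma mono_linear r : linear (mono r).
Proof.
move=> a x y; apply: affine_pairE; first exact: loop_mono_is_linear.
  by rewrite /= scaler0 addr0.
by rewrite /= scaler0 addr0.
Qed.

Lemma hhat_in_linear : linear hhat_in.
Proof.
move=> a [[H1 a1] b1] [[H2 a2] b2]; apply: affine_pairE => //.
exact: (loop_mono_is_linear 0 a (vsval H1) (vsval H2)).
Qed.

Lemma mono_bracket r x s y : [lie mono r x, mono s y] =
  (loop_mono (r + s) [lie x, y], (r%:~R * B x y) *+ (r == - s), 0) :> ghat.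
Proof.
apply: affine_pairE => //=; last exact: loop_cocycle_mono.
by rewrite !scale0r addr0 subr0 loop_bracket_mono.
Qed.

Lemma hhat_in_mono H r x : [lie hhat_in H, mono r x] =
  mono r ((H.2 * r%:~R : K) *: x + [lie vsval H.1.1, x]).
Proof.
case: H => [[H0 a] b]; apply: affine_pairE => //=; last first.
  by rewrite loop_cocycle_mono mul0r mul0rn.
rewrite scale0r subr0 loop_bracket_mono add0r loop_deriv_mono.
by rewrite scalerA loop_mono_is_linear addrC.
Qed.

Lemma hhat_lie H H' : [lie hhat_in H, hhat_in H'] = 0.
Proof.
case: H H' => [[H0 a] b] [[H0' a'] b']; apply: affine_pairE => //=; last first.
  by rewrite loop_cocycle_mono mul0r mul0rn.
rewrite loop_bracket_mono cartan_lie !loop_deriv_mono !scale0r !scaler0 linear0.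
by rewrite addr0 subr0.
Qed.

Lemma weight_inj mu mu' : (forall H, mu H = mu' H :> K) -> mu = mu'.
Proof. by move=> e; apply/lfunP. Qed.

Lemma ad_hhat_linear H : linear (lie (hhat_in H) : ghat -> ghat).
Proof. exact: lie_linearr. Qed.

Lemma root_vector_bracket mu nu X Y : root_vector mu X -> root_vector nu Y ->
  root_vector (mu + nu) [lie X, Y].
Proof.
by move=> mX nY H; rewrite lie_leibniz mX nY lieZl lieZr add_lfunE scalerDl.
Qed.

Lemma root_vector_mono beta r x : ad_weight beta x ->
  root_vector (ext beta + r%:~R *: delta D) (mono r x).
Proof.
move=> bx H; rewrite hhat_in_mono bx -scalerDl addrC (linZ (mono_linear r)).
by rewrite add_lfunE scale_lfunE extE deltaE mulrC.
Qed.

Lemma affine_span (P : ghat -> Prop) : subspace P ->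
  (forall beta r x, ad_weight beta x -> P (mono r x)) -> (forall H, P (hhat_in H)) ->
  forall X, P X.
Proof.
move=> sP Pm Ph [[f a] b].
have -> : ((f, a, b) : ghat) = ((f, 0, 0) : ghat) + hhat_in (0, a, b).
  by apply: affine_pairE; rewrite /= ?linear0 ?addr0 ?add0r // linear0 addr0.
apply: subspaceD => //.
have lin : linear (fun f : loops g => (f, 0, 0) : ghat).
  by move=> c f1 f2; apply: affine_pairE; rewrite /= ?scaler0 ?addr0.
move: f; apply: (loop_mono_span (subspace_preim lin sP)) => r x.
elim: (ad_weight_span D x) => [|c u v [beta bu] _ IH].
  by rewrite linear0; have := lin0 lin => ->; case: sP.
rewrite linearP lin; apply: subspaceD => //; apply: subspaceZ => //.
exact: Pm bu.
Qed.

Definition Qcomb (c : option I -> nat) : weight D := \sum_i (c i)%:R *: ahat D i.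

Lemma ext_linear : linear (@ext K g I D).
Proof.
move=> a u v; apply: weight_inj => H.
by rewrite add_lfunE scale_lfunE !extE add_lfunE scale_lfunE.
Qed.

Lemma QcombE c H : Qcomb c H = \sum_i (c i)%:R * (ahat D i H : K) :> K.
Proof. by rewrite sum_lfunE; apply: eq_bigr => i _; rewrite scale_lfunE. Qed.

(** The value at [d] isolates the coefficient of [alpha_0]; the rest is freeness of the simple roots
    of [g]. *)
Lemma ahat_comb_eq0 (k : option I -> K) :
  (forall H, \sum_i k i * (ahat D i H : K) = 0) -> forall i, k i = 0.
Proof.
move=> e.
have k0 : k None = 0.
  have := e (0, 0, 1); rewrite big_option /= add_lfunE opp_lfunE extE deltaE /=.
  rewrite linear0 subr0 mulr1 big1 ?addr0 // => i _.
  by rewrite extE linear0 mulr0.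
move=> [i|//]; case: (alphaP D) => _ /basis_free fa _.
apply: (free_comb_eq0 (k := fun i => k (Some i)) fa); apply: hdual_inj => H.
rewrite zero_lfunE -(e (H, 0, 0)) big_option k0 mul0r add0r sum_lfunE.
by apply: eq_bigr => j _; rewrite scale_lfunE extE.
Qed.

Lemma Qcomb_inj (c c' : option I -> nat) : Qcomb c = Qcomb c' -> c =1 c'.
Proof.
move=> e i; apply/eqP; rewrite -(eqr_nat K) -subr_eq0; apply/eqP.
apply: (ahat_comb_eq0 (k := fun i => (c i)%:R - (c' i)%:R)) => H.
under eq_bigr do rewrite mulrBl; rewrite sumrB -!QcombE e.
exact: subrr.
Qed.

Lemma Qcomb_eq0 (c : option I -> nat) : Qcomb c = 0 -> forall i, c i = 0%N.
Proof.
move=> e; apply: (@Qcomb_inj c (fun=> 0%N)); apply: weight_inj => H.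
by rewrite e zero_lfunE QcombE big1 // => i _; rewrite mul0r.
Qed.

Lemma QcombD (c c' : option I -> nat) : Qcomb (fun i => c i + c' i)%N = Qcomb c + Qcomb c'.
Proof.
apply: weight_inj => H; rewrite add_lfunE !QcombE -big_split.
by apply: eq_bigr => i _; rewrite natrD mulrDl.
Qed.

Lemma QcombM (p : nat) (c : option I -> nat) : Qcomb (fun i => p * c i)%N = p%:R *: Qcomb c.
Proof.
apply: weight_inj => H; rewrite scale_lfunE !QcombE [RHS]mulr_sumr.
by apply: eq_bigr => i _; rewrite natrM mulrA.
Qed.

Lemma Qcomb_delta i : Qcomb (fun k => (k == i : nat)) = ahat D i.
Proof.
apply: weight_inj => H; rewrite QcombE (bigD1 i) //= eqxx mul1r big1 ?addr0 //.
by move=> k /negPf ->; rewrite mul0r.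
Qed.

Definition lift_comb (n : I -> nat) (i : option I) : nat := if i is Some i then n i else 0%N.

Lemma Qcomb_lift n : Qcomb (lift_comb n) = ext (\sum_i (n i)%:R *: alpha D i).
Proof.
apply: weight_inj => H; rewrite QcombE big_option mul0r add0r extE sum_lfunE.
by apply: eq_bigr => i _; rewrite scale_lfunE extE.
Qed.

(** If [theta] were negative, maximality against the root [-theta] would give [2 theta >= 0], hence
    [theta = 0]. *)
Lemma highest_root_pos : exists n : I -> nat, theta D = \sum_i (n i)%:R *: alpha D i.
Proof.
case: (thetaP D) => rth thmax; case: (alphaP D) => _ ba pos.
have [n [nE|nE]] := pos _ rth; first by exists n.
have [m mE] := thmax _ (opp_root (D := D) rth).
have z : forall i, (m i + 2 * n i)%N = 0%N.
  apply: (nat_comb_eq0 (a := alpha D) (fun k => free_comb_eq0 (basis_free ba))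
    (n := fun i => m i + 2 * n i)%N).
  rewrite nat_combD (nat_combM _ 2 n) -mE opprK nE scaler_nat mulr2n.
  by rewrite -opprD addNr.
case: rth => + _; case; rewrite nE big1 ?oppr0 // => i _.
have -> : n i = 0%N by have := z i; lia.
by rewrite scale0r.
Qed.

Lemma delta_pos : exists2 c, delta D = Qcomb c & c None = 1%N.
Proof.
have [n nE] := highest_root_pos.
exists (fun i => (i == None) + lift_comb n i)%N => //.
by rewrite QcombD Qcomb_delta Qcomb_lift -nE /= subrK.
Qed.

(** Written as [r delta + alpha_0 + (theta + beta)]; the last term is nonnegative because [beta] is
    0 or [-beta] is a root below [theta]. *)
Lemma affine_weight_pos beta (r : nat) : beta = 0 \/ is_root beta ->
  exists2 c, ext beta + r.+1%:R *: delta D = Qcomb c & c None = r.+1.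
Proof.
move=> b0; have [d dE d0] := delta_pos; have [n nE] := highest_root_pos.
have [m mE] : exists m : I -> nat, theta D + beta = \sum_i (m i)%:R *: alpha D i.
  case: b0 => [->|rb]; first by exists n; rewrite addr0.
  case: (thetaP D) => _ /(_ _ (opp_root (D := D) rb))[m].
  by rewrite opprK; exists m.
exists (fun i => r * d i + (i == None) + lift_comb m i)%N; last by rewrite d0 /=; lia.
rewrite (QcombD (fun i => r * d i + (i == None))%N (lift_comb m)).
rewrite (QcombD (fun i => r * d i)%N (fun i => (i == None : nat))).
rewrite Qcomb_delta Qcomb_lift -mE.
rewrite QcombM -dE; apply: weight_inj => H.
rewrite !add_lfunE !scale_lfunE !extE add_lfunE opp_lfunE extE.
move: (delta D H : K) (theta D _ : K) (beta _ : K) => e t u.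
change (u + r.+1%:R * e = r%:R * e + (e - t) + (t + u)).
by rewrite -natr1; ring.
Qed.

Definition pos_vector X := exists2 c, (exists i, c i <> 0%N) & root_vector (Qcomb c) X.
Definition neg_vector X := exists2 c, (exists i, c i <> 0%N) & root_vector (- Qcomb c) X.

(** A monomial of weight [beta + r delta] is positive or negative according to the sign of [r]; for
    [r = 0] the root [beta] decides, and for [beta = 0] the monomial lies in [h]. *)
Lemma triangular_span (P : ghat -> Prop) : subspace P ->
  (forall X, pos_vector X -> P X) -> (forall X, neg_vector X -> P X) ->
  (forall H, P (hhat_in H)) -> forall X, P X.
Proof.
move=> sP Pp Pn Ph; apply: affine_span => // beta r x bx.
have [->|/eqP x0] := eqVneq x 0.
  by rewrite (lin0 (mono_linear r)); case: sP.
have br : beta = 0 \/ is_root beta.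
  have [->|/eqP b0] := eqVneq beta 0; first by left.
  by right; split=> //; exists x.
have nbr : - beta = 0 \/ is_root (- beta).
  by case: br => [->|/opp_root]; [left; rewrite oppr0 | right].
have rv := root_vector_mono r bx.
case: r rv => [[|r]|r] rv.
- case: br => [b0|rb].
    suff -> : mono 0 x = hhat_in (vsproj h x, 0, 0) by apply: Ph.
    by rewrite /mono /hhat_in /= vsprojK //; apply/ad_weight0P; rewrite -b0.
  have rb0 : beta <> 0 by case: rb.
  rewrite scale0r addr0 in rv; case: (alphaP D) => _ _ /(_ _ rb)[n nE].
  have nz : exists i, lift_comb n i <> 0%N.
    apply: contrapT => no; apply: rb0; case: nE => ->; rewrite big1 ?oppr0 // => i _;
    by have [->|/eqP ni] := eqVneq (n i) 0%N; rewrite ?scale0r //; case: no; exists (Some i).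
  case: nE => nE; [apply: Pp | apply: Pn]; exists (lift_comb n) => //; rewrite Qcomb_lift.
    by rewrite -nE.
  by rewrite -(linN ext_linear) -nE.
- have [c cE c0] := affine_weight_pos r br.
  by apply: Pp; exists c; [exists None; rewrite c0 | rewrite -cE].
- have [c cE c0] := affine_weight_pos r nbr.
  apply: Pn; exists c; first by exists None; rewrite c0.
  suff <- : ext beta + (Negz r)%:~R *: delta D = - Qcomb c by [].
  rewrite -cE; apply: weight_inj => H.
  rewrite !(add_lfunE, scale_lfunE, opp_lfunE, extE).
  move: (delta D H : K) (beta _ : K) => e u.
  change (u + (Negz r)%:~R * e = - (- u + r.+1%:R * e)).
  by rewrite NegzE mulrNz mulNr opprD opprK.
Qed.

Lemma Qcomb_vector_eq0 c : (exists i, c i <> 0%N) -> Qcomb c <> 0.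
Proof. by move=> [i ci] /Qcomb_eq0/(_ i). Qed.

Lemma hhat_lie_coef H X r : loop_coef r [lie hhat_in H, X].1.1 =
  [lie vsval H.1.1, loop_coef r X.1.1] + (H.2 * r%:~R : K) *: loop_coef r X.1.1.
Proof.
case: H X => [[H0 p] q] [[f a] b]; rewrite /= loop_deriv_mono scale0r scaler0 subr0.
rewrite (linD (loop_coef_is_linear r)) (linZ (loop_coef_is_linear r)).
by rewrite loop_coef_bracket0 loop_coef_deriv scalerA.
Qed.

Lemma hhat_lie_tail H X : [lie hhat_in H, X].1.2 = 0 /\ [lie hhat_in H, X].2 = 0.
Proof.
case: H X => [[H0 p] q] [[f a] b]; split=> //=.
move: f; apply: (@loop_mono_span K g (fun f => loop_cocycle B (loop_mono 0 (vsval H0)) f = 0)).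
  have lin := loop_cocycle_linearr B (loop_mono 0 (vsval H0)).
  by split=> [|c u v u0 v0]; [exact: (lin0 lin) | rewrite lin u0 v0 scaler0 addr0].
by move=> r x; rewrite loop_cocycle_mono mul0r mul0rn.
Qed.

Lemma root_vector_coef mu X r (x := loop_coef r X.1.1) : root_vector mu X -> x <> 0 ->
  mu (0, 0, 1) = r%:~R :> K /\ forall H : subvs_of h, [lie vsval H, x] = (mu (H, 0, 0) : K) *: x.
Proof.
move=> rv x0.
have E H : [lie vsval H.1.1, x] + (H.2 * r%:~R : K) *: x = (mu H : K) *: x.
  by rewrite -hhat_lie_coef rv -(linZ (loop_coef_is_linear r)).
split=> [|H]; last by have := E (H, 0, 0); rewrite /= mul0r scale0r addr0.
have /eqP := E (0, 0, 1); rewrite [X in X + _]lie0l add0r mul1r.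
by rewrite -subr_eq0 -scalerBl scaler_eq0 subr_eq0 => /orP[/eqP ->//|/eqP].
Qed.

(** The elements [c] and [d] have weight 0, so they do not occur in nonzero weight. *)
Lemma root_vector_tail mu X : root_vector mu X -> mu <> 0 -> X.1.2 = 0 /\ X.2 = 0.
Proof.
move=> rv m0; have [H mH] : exists H, mu H <> 0 :> K.
  by apply/existsNP => e; apply: m0; apply: weight_inj => H; rewrite e zero_lfunE.
have /eqP mH0 := mH; have [t1 t2] := hhat_lie_tail H X; move: t1 t2; rewrite rv /=.
by move=> /eqP + /eqP; rewrite !scaler_eq0 (negPf mH0) => /eqP -> /eqP ->.
Qed.

Lemma ideal_weight_span (J : ghat -> Prop) X : subspace J -> (forall Y Z, J Z -> J [lie Y, Z]) -> J X ->
  lspan (fun Y => J Y /\ exists mu, root_vector mu Y) X.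
Proof.
move=> sJ JI JX.
apply: (stable_weight_span (ev := fun mu H => mu H : K) (act := fun H => lie (hhat_in H))
  weight_inj ad_hhat_linear sJ _ _ JX) => [H Y|]; first exact: JI.
move: X {JX}; apply: affine_span; first exact: lspan_subspace.
  by move=> beta r x bx; apply: lspan_in; eexists; apply: root_vector_mono bx.
move=> H; apply: lspan_in; exists 0 => H'.
by rewrite hhat_lie zero_lfunE scale0r.
Qed.

(** The ideal is graded by weights. A weight vector in it with a coefficient [x] of weight [beta] at
    [t^r] brackets with a dual [y t^(-r)] to [t_beta + r c]. Hence [beta = 0] and [r = 0], so the
    vector lies in [hat h] and is 0. *)
Lemma ideal_eq0 (J : ghat -> Prop) : subspace J -> (forall Y Z, J Z -> J [lie Y, Z]) ->
  (forall H, J (hhat_in H) -> H = 0) -> forall X, J X -> X = 0.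
Proof.
move=> sJ JI Jh X /(ideal_weight_span sJ JI).
apply: (@lspan_min _ _ _ (fun X => X = 0)); first exact: subspace0.
move=> {}X [JX [mu rv]]; apply: contrapT => X0.
have in_h f a b : X = (f, a, b) -> forall x, x \in h -> f = loop_mono 0 x -> False.
  move=> XE x xh fE; apply: X0; suff XH : X = hhat_in (vsproj h x, a, b).
    by rewrite XH in JX *; rewrite (Jh _ JX) (lin0 hhat_in_linear).
  by rewrite XE fE /hhat_in /= vsprojK.
case XE : X => [[f a] b].
have [[r x0]|no] := pselect (exists r, loop_coef r f <> 0); last first.
  apply: (in_h _ _ _ XE 0 (mem0v _)); apply: loop_coef_ext => r; rewrite linear0 linear0.
  by apply: contrapT => fr; apply: no; exists r.
set x := loop_coef r f in x0.
have /(_ r) := root_vector_coef (X := X) rv; rewrite XE -/x => -[]// md mh.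
have [beta bE] : exists beta : hdual h, forall H : subvs_of h, beta H = mu (H, 0, 0) :> K.
  apply: (@lfun_of_linear K _ _ (fun H : subvs_of h => mu (H, 0, 0))) => k H H'.
  rewrite -linearP; congr (mu _).
  by congr (_, _, _); rewrite /= scaler0 addr0.
have bx : ad_weight beta x by move=> H; rewrite mh bE.
have [y bey Bxy] := dual_weight_vector bx x0.
have xy := opposite_bracket bx bey.
have JXY : J [lie X, mono (- r) y] by rewrite lieC; apply: subspaceN => //; apply: JI.
have fE : f = loop_mono r x.
  apply: loop_coef_ext => s; rewrite loop_coef_mono; case: eqP => [<-//|rs].
  apply: contrapT => fs; apply: rs.
  have /(_ s) := root_vector_coef (X := X) rv; rewrite XE => -[]// mds _.
  by apply/eqP; rewrite -(eqr_int K) -md mds.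
(* A term [b d] of [X] would add [-r b y t^(-r)] to the bracket computed next. It vanishes: [b = 0]
   in nonzero weight, and weight 0 forces [r = 0]. *)
have br : (b : K) * r%:~R = 0.
  have [m0|/eqP m0] := eqVneq mu 0; first by rewrite -md m0 zero_lfunE mulr0.
  by have [_] := root_vector_tail rv m0; rewrite XE /= => ->; rewrite mul0r.
have XY : [lie X, mono (- r) y] = hhat_in (tvec beta, r%:~R, 0).
  rewrite XE fE; apply: affine_pairE => //=.
    rewrite loop_bracket_mono subrr xy Bxy scale1r loop_deriv_mono scalerA.
    by rewrite rmorphN mulrN br oppr0 scale0r addr0 scale0r subr0.
  by rewrite loop_cocycle_mono opprK eqxx mulr1n Bxy mulr1.
have := Jh (tvec beta, r%:~R, 0); rewrite -XY => /(_ JXY) e.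
have b0 : beta = 0 by apply: (@tvec_eq0 _ _ _ D); exact: (congr1 (fun H => H.1.1) e).
have r0 : r = 0.
  have /eqP := congr1 (fun H : hhat D => H.1.2 : K) e.
  by rewrite /= -[0]/(0%:~R) eqr_int => /eqP.
apply: (in_h _ _ _ XE x); last by rewrite fE r0.
by apply/ad_weight0P; rewrite -b0.
Qed.

End AffineRoots.

(** * Chevalley generators of the affine algebra *)

Section AffineChevalley.
Context (K : numFieldType) (g : finLieAlgType K) (I : finType).
Context (D : cartanData g I).

Notation h := (cartan D).
Notation B := (nform D).
Notation ghat := (affine (nform D)).
Notation ad_weight := (@ad_weight K g I D).
Notation root_vector := (@root_vector K g I D).
Notation hhat_in := (@hhat_in K g I D).
Notation mono := (@mono K g I D).
Implicit Types (x y : g) (beta : hdual h) (X Y Z : ghat) (mu : weight D) (H : hhat D).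

Lemma root_vector_class mu X : root_vector mu X -> X <> 0 ->
  exists c, mu = Qcomb D c \/ mu = - Qcomb D c.
Proof.
pose C mu := exists c, mu = Qcomb D c \/ mu = - Qcomb D c.
apply: (@lspan_weight_class K ghat _ _ (fun mu H => mu H : K) (fun H => lie (hhat_in H))
  (@weight_inj K g I D) (@ad_hhat_linear K g I D)
  (fun Y => exists2 nu, C nu & root_vector nu Y) C) => //.
apply: triangular_span => [|Y [c _ rY]|Y [c _ rY]|H].
- exact: lspan_subspace.
- by apply: lspan_in; exists (Qcomb D c) => //; exists c; left.
- by apply: lspan_in; exists (- Qcomb D c) => //; exists c; right.
- apply: lspan_in; exists 0 => [|H']; last by rewrite hhat_lie zero_lfunE scale0r.
  exists (fun=> 0%N); left; apply: weight_inj => H'.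
  by rewrite zero_lfunE QcombE big1 // => i _; rewrite mul0r.
Qed.

(** No root has simple coefficients of both signs; this is what makes [[e_i, f_k]] vanish for
    [i <> k]. *)
Lemma simple_difference_eq0 i k X : i != k ->
  root_vector (ahat D i - ahat D k) X -> X = 0.
Proof.
move=> ik rX; apply: contrapT => X0.
have [c [cE|cE]] := root_vector_class rX X0.
  have /Qcomb_inj/(_ k) : Qcomb D (fun l => c l + (l == k))%N = Qcomb D (fun l => (l == i : nat)).
    by rewrite QcombD !Qcomb_delta -cE subrK.
  by rewrite eqxx eq_sym (negPf ik); lia.
have /Qcomb_inj/(_ i) : Qcomb D (fun l => c l + (l == i))%N = Qcomb D (fun l => (l == k : nat)).
  by rewrite QcombD !Qcomb_delta -[Qcomb D c]opprK -cE opprB subrK.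
by rewrite eqxx (negPf ik); lia.
Qed.

Lemma mono0_bracket x s y : s != 0 -> [lie mono 0 x, mono s y] = mono s [lie x, y].
Proof.
move=> s0; rewrite mono_bracket; apply: affine_pairE => //; first by rewrite add0r.
by rewrite eq_sym oppr_eq0 (negPf s0).
Qed.

Lemma mono00_bracket x y : [lie mono 0 x, mono 0 y] = mono 0 [lie x, y].
Proof.
by rewrite mono_bracket; apply: affine_pairE; rewrite ?addr0 // mul0r mul0rn.
Qed.

(** For [r <> 0] the [x] with [x t^r] in [S] form an ideal of [g], hence all of [g] once it is
    nonzero; a nonzero bracket in [g] then leads from each power of [t] or [t^(-1)] to the next. *)
Lemma loop_generation (S : ghat -> Prop) : simple_lie g -> lie_closed S ->
  (forall H, S (hhat_in H)) -> (forall x, S (mono 0 x)) ->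
  (exists2 x, S (mono 1 x) & x <> 0) -> (exists2 x, S (mono (- 1) x) & x <> 0) ->
  forall X, S X.
Proof.
move=> sg [sS cS] Sh S0 S1 Sm.
have all_mono (r : int) : r != 0 -> (exists2 x, S (mono r x) & x <> 0) -> forall x, S (mono r x).
  move=> r0; apply: (simple_ideal (U := fun x => S (mono r x)) sg).
    exact: (subspace_preim (@mono_linear _ _ _ D r) sS).
  by move=> x y Sy; rewrite -mono0_bracket //; apply: cS.
have step (s : int) : s != 0 -> (exists2 x, S (mono s x) & x <> 0) ->
    forall n x, S (mono (s * n.+1%:Z) x).
  move=> s0 Ss; elim=> [|n IH]; first by rewrite mulr1; apply: all_mono.
  have s1 : s * n.+2%:Z != 0 by rewrite mulf_neq0.
  apply: (all_mono _ s1); case: (sg) => -[p [q pq]] _; exists [lie p, q] => //.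
  suff <- : [lie mono s p, mono (s * n.+1%:Z) q] = mono (s * n.+2%:Z) [lie p, q].
    by apply: cS => //; apply: all_mono.
  have sE : s + s * n.+1%:Z = s * n.+2%:Z by rewrite -{1}[s]mulr1 -mulrDr.
  rewrite mono_bracket; apply: affine_pairE => //; first by rewrite sE.
  by rewrite -[s == _]subr_eq0 opprK sE (negPf s1).
apply: affine_span => // beta [[|n]|n] x _; first exact: S0.
  by rewrite -[Posz _]mul1r; apply: step.
by rewrite NegzE -mulN1r; apply: step.
Qed.

Lemma affine_chevalley : simple_lie g -> exists e f : option I -> ghat,
  [/\ forall i, root_vector (ahat D i) (e i),
      forall i, root_vector (- ahat D i) (f i),
      forall i k, [lie e i, f k] = if i == k then hhat_in (coroot_hat D i) else 0
    & forall S, lie_closed S -> (forall H, S (hhat_in H)) -> (forall i, S (e i)) ->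
        (forall i, S (f i)) -> forall X, S X].
Proof.
move=> sg; case: (thetaP D) => rth _; case: (alphaP D) => ra _ _.
have [xt [yt [txt tyt Bt xyt]]] := root_pair rth.
have /choice[x xP] : forall i, exists x, exists y,
    [/\ ad_weight (alpha D i) x, ad_weight (- alpha D i) y, B x y = 1
      & [lie x, y] = vsval (tvec (alpha D i))] by move=> i; apply: root_pair.
have {xP} /choice[y xyP] := xP.
(* This factor turns [t_(alpha i)] into the coroot. *)
pose c i : K := 2 / dform B (alpha D i) (alpha D i).
have c0 i : c i != 0.
  by rewrite mulf_neq0 ?pnatr_eq0 // invr_eq0 root_norm_neq0.
(* For the index 0 the vectors are [y_theta t] and [x_theta t^(-1)], whose bracket is
   [c - t_theta]. *)
pose e i := if i is Some i then mono 0 (x i) else mono 1 yt.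
pose f i := if i is Some i then mono 0 (c i *: y i) else mono (- 1) xt.
have ax i : ad_weight (alpha D i) (x i) by case: (xyP i).
have ay i : ad_weight (- alpha D i) (c i *: y i).
  by apply: (subspaceZ _ (ad_weight_subspace _)); case: (xyP i).
have axy i : [lie x i, c i *: y i] = c i *: vsval (tvec (alpha D i)).
  by rewrite lieZr; case: (xyP i) => _ _ _ ->.
have re i : root_vector (ahat D i) (e i).
  case: i => [i|] /=.
    have := root_vector_mono 0 (ax i); congr root_vector; apply: weight_inj => H.
    by rewrite add_lfunE scale_lfunE extE scale0r addr0.
  have := root_vector_mono 1 tyt; congr root_vector; apply: weight_inj => H.
  by rewrite !(add_lfunE, scale_lfunE, opp_lfunE, extE) scale1r addrC.
have rf i : root_vector (- ahat D i) (f i).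
  case: i => [i|] /=.
    have := root_vector_mono 0 (ay i); congr root_vector; apply: weight_inj => H.
    by rewrite !(add_lfunE, scale_lfunE, opp_lfunE, extE) scale0r addr0.
  have := root_vector_mono (- 1) txt; congr root_vector; apply: weight_inj => H.
  by rewrite !(add_lfunE, scale_lfunE, opp_lfunE, extE) scaleN1r opprB.
exists e, f; split=> // [i k|S [sS cS] Sh Se Sf].
  have [<-|ik] := eqVneq i k; last first.
    by apply: (simple_difference_eq0 ik); apply: root_vector_bracket.
  (* Squared length 2 makes the coroot of [theta] equal to [t_theta]. *)
  have tE : coroot B (theta D) = tvec (theta D).
    by rewrite corootE highest_root_norm // divff ?pnatr_eq0 // scale1r.
  case: i => [i|]; rewrite /e /f mono_bracket; apply: affine_pairE => //.
  - by rewrite addr0 axy.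
  - by rewrite mul0r mul0rn.
  - by rewrite subrr lieC xyt -tE.
  - by rewrite opprK eqxx mulr1n mul1r form_sym Bt.
apply: loop_generation => //.
- apply: (chevalley_generation ax ay axy c0 (S := fun x => S (mono 0 x))).
  + split=> [|u v Su Sv]; first exact: (subspace_preim (@mono_linear _ _ _ D 0) sS).
    by rewrite -mono00_bracket; apply: cS.
  + by move=> H; apply: (Sh (H, 0, 0)).
  + by move=> i; apply: (Se (Some i)).
  + by move=> i; apply: (Sf (Some i)).
- exists yt; first exact: (Se None).
  by move=> y0; move: Bt; rewrite y0 form0r => /esym/eqP; rewrite oner_eq0.
- exists xt; first exact: (Sf None).
  by move=> x0; move: Bt; rewrite x0 form0l => /esym/eqP; rewrite oner_eq0.
Qed.

End AffineChevalley.

(** * The lift of a diagram automorphism *)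

Section CartanTwist.
Context (K : numFieldType) (g : finLieAlgType K) (I : finType).
Context (D : cartanData g I).

Notation h := (cartan D).
Notation B := (nform D).
Implicit Types (beta : hdual h) (mu : weight D) (H : hhat D).

(** [nu] carries the simple coroots to nonzero multiples of the simple roots, a basis of the dual;
    the [omega i] then read off the coefficients. *)
Lemma coroot_expansion (H : subvs_of h) :
  H = \sum_i (omega D i H : K) *: coroot B (alpha D i).
Proof.
pose c i := 2 / dform B (alpha D i) (alpha D i).
(* By the convention on division by 0, a zero length would make the coroot 0, against
   [omega i (h_i) = 1]. *)
have c0 i : c i != 0.
  apply/eqP => ci; have := omegaP D i i; rewrite corootE -/(c i) ci scale0r linear0 eqxx.
  by move=> /esym/eqP; rewrite oner_eq0.
suff [k kE] : exists k : I -> K, H = \sum_i k i *: coroot B (alpha D i).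
  rewrite {1}kE; apply: eq_bigr => i _; congr (_ *: _).
  rewrite kE linear_sum (bigD1 i) //= linearZ /= omegaP eqxx big1 => [|l li].
    by rewrite addr0 [_ *: 1]mulr1.
  by rewrite linearZ /= omegaP eq_sym (negPf li) scaler0.
case: (alphaP D) => _ ba _; have : nu B h H \in <<codom (alpha D)>>%VS.
  by rewrite (span_basis ba) memvf.
move=> /lspan_span Hs.
suff [k kE] : exists k : I -> K, tvec (nu B h H) = \sum_i k i *: coroot B (alpha D i).
  by exists k; rewrite -kE; apply: nu_inj; rewrite nu_tvec.
elim: Hs => [|a u v /codomP[i ->] _ [k kE]].
  by exists (fun=> 0); rewrite /tvec linear0 big1 // => i _; rewrite scale0r.
exists (fun l => (a / c i) *+ (l == i) + k l).
under eq_bigr do rewrite scalerDl; rewrite big_split /= tvecD kE tvecZ; congr (_ + _).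
rewrite (bigD1 i) //= eqxx big1 => [|l /negPf ->]; last by rewrite mulr0n scale0r.
by rewrite addr0 corootE -/(c i) scalerA mulr1n divfK.
Qed.

Lemma hhat_expansion H :
  H = \sum_i (Lambda_hat D i H : K) *: coroot_hat D i + (delta D H : K) *: ((0, 0, 1) : hhat D).
Proof.
case: H => [[H a] b]; rewrite big_option /= Lambda0E deltaE /=.
have sumE (F : I -> subvs_of h) :
    \sum_i ((F i, 0, 0) : hhat D) = ((\sum_i F i, 0, 0) : hhat D).
  elim/big_ind2: _ => // x1 x2 y1 y2 -> ->; by congr (_, _, _); rewrite /= addr0.
pose G i : K := omega D i H + (omega D i (coroot B (theta D)) : K) * a.
have -> : \sum_i (Lambda_hat D (Some i) (H, a, b) : K) *: coroot_hat D (Some i)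
   = \sum_i ((G i *: coroot B (alpha D i), 0, 0) : hhat D).
  apply: eq_bigr => i _; rewrite /= add_lfunE scale_lfunE extE Lambda0E /=.
  by congr (_, _, _); rewrite /= scaler0.
rewrite sumE; congr (_, _, _) => /=.
- rewrite /G; under eq_bigr do rewrite scalerDl; rewrite big_split /= -coroot_expansion.
  rewrite scaler0 addr0 addrCA -[LHS]addr0; congr (_ + _).
  under eq_bigr do rewrite mulrC -scalerA; rewrite -scaler_sumr -coroot_expansion.
  by rewrite scalerN addNr.
- by rewrite [a *: 1]mulr1 scaler0 !addr0.
- by rewrite [b *: 1]mulr1 scaler0 !add0r.
Qed.

Lemma coweight_hat j : exists d' : hhat D, forall k, ahat D k d' = (k == j)%:R :> K.
Proof.
(* The fundamental coweight is a multiple of [t_(omega i)], because [alpha k (t_(omega i)) = omega i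
   (t_(alpha k))]. *)
have om (i : I) : exists H : subvs_of h, forall k, alpha D k H = (k == i)%:R :> K.
  exists ((2 / dform B (alpha D i) (alpha D i)) *: tvec (omega D i)) => k.
  rewrite linearZ /= -[alpha D k _]dformE (dformC (omega D i)) (dformE (alpha D k)).
  have := omegaP D i k; rewrite corootE linearZ /= eq_sym.
  have [->|ki] := eqVneq k i; first by [].
  move=> /eqP; rewrite mulf_eq0 mulf_eq0 => /orP[/orP[|]|/eqP -> ]; last by rewrite scaler0.
    by rewrite pnatr_eq0.
  rewrite invr_eq0 => /eqP e; have := omegaP D k k.
  by rewrite corootE e invr0 mulr0 scale0r linear0 eqxx => /esym/eqP; rewrite oner_eq0.
have [H HE] : exists H : subvs_of h, forall k, alpha D k H = (Some k == j)%:R :> K.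
  case: j => [i|]; first by have [H HE] := om i; exists H.
  by exists 0 => k; rewrite linear0.
(* The coefficient of [d] adjusts the value of [alpha_0 = delta - theta]; that of [c] is free and
   set to 0. *)
exists (H, 0, (theta D H : K) + (None == j)%:R) => -[k|] /=.
  by rewrite extE HE.
by rewrite add_lfunE opp_lfunE extE deltaE /= addrAC subrr add0r.
Qed.

Section Map.
Context (sigma : {perm option I}) (d' : hhat D).
Hypothesis diag : diagram_automorphism D sigma.
Hypothesis d'E : forall k, ahat D k d' = (k == sigma None)%:R :> K.

(** The functionals [Lambda_i] and [delta] are the coordinates of [hat h] in the basis [h_i],
    [d]. *)
Definition hhat_twist H : hhat D :=
  \sum_i (Lambda_hat D i H : K) *: coroot_hat D (sigma i) + (delta D H : K) *: d'.

Lemma hhat_twist_linear : linear hhat_twist.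
Proof.
move=> a H H'; rewrite /hhat_twist.
have E mu : mu (a *: H + H') = a * (mu H : K) + (mu H' : K) :> K
  by rewrite linearP.
under eq_bigr do rewrite E scalerDl -scalerA.
by rewrite E scalerDl -scalerA big_split /= -scaler_sumr addrACA -scalerDr.
Qed.

Lemma hhat_twist_eval mu H : mu (hhat_twist H) =
  \sum_i (Lambda_hat D i H : K) * (mu (coroot_hat D (sigma i)) : K) + (delta D H : K) * (mu d' : K) :> K.
Proof.
rewrite linearD linear_sum linearZ; congr (_ + _).
by apply: eq_bigr => i _; rewrite linearZ.
Qed.

Lemma hhat_eval mu H : mu H = \sum_i (Lambda_hat D i H : K) * (mu (coroot_hat D i) : K)
  + (delta D H : K) * (mu (0, 0, 1) : K) :> K.
Proof.
rewrite {1}(hhat_expansion H) linearD linear_sum linearZ; congr (_ + _).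
by apply: eq_bigr => i _; rewrite linearZ.
Qed.

Lemma hhat_twist_coroot i : hhat_twist (coroot_hat D i) = coroot_hat D (sigma i).
Proof.
rewrite /hhat_twist delta_coroot_hat scale0r addr0 (bigD1 i) //= Lambda_hatE eqxx.
rewrite scale1r big1 ?addr0 // => k ki.
by rewrite Lambda_hatE (negPf ki) scale0r.
Qed.

Lemma ahat_hhat_twist k H : ahat D (sigma k) (hhat_twist H) = ahat D k H :> K.
Proof.
rewrite hhat_twist_eval (hhat_eval (ahat D k)) d'E; congr (_ + _ * _).
  by apply: eq_bigr => i _; rewrite diag.
rewrite (inj_eq perm_inj); case: k => [k|]; rewrite /= ?extE ?linear0 //.
by rewrite add_lfunE opp_lfunE extE deltaE /= linear0 subr0.
Qed.

(** If all [alpha_k] vanish at [H], only a multiple of [c] is left; its coefficient is read off from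
    the image by [Lambda_(sigma 0)]. *)
Lemma hhat_twist_inj H : hhat_twist H = 0 -> H = 0.
Proof.
move=> H0; have aH k : ahat D k H = 0 :> K by rewrite -ahat_hhat_twist H0 linear0.
case: H H0 aH => [[H a] b] H0 aH.
have HE : H = 0.
  apply: cartan_eq0 => beta; case: (alphaP D) => _ ba _.
  have : beta \in <<codom (alpha D)>>%VS by rewrite (span_basis ba) memvf.
  move=> /lspan_span; elim=> [|k u v /codomP[i ->] _ IH]; first by rewrite lfunE.
  rewrite add_lfunE IH addr0 scale_lfunE.
  by have := aH (Some i); rewrite /= extE /= => ->; rewrite scaler0.
have bE : b = 0.
  have := aH None; rewrite /= add_lfunE opp_lfunE extE deltaE /= HE linear0 subr0.
  by [].
have := congr1 (fun X => Lambda_hat D (sigma None) X : K) H0.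
rewrite hhat_twist_eval linear0 deltaE /= bE mul0r addr0 (bigD1 None) //=.
rewrite Lambda_hatE eqxx mulr1 Lambda0E /= big1 ?addr0 => [-> |k ki]; last first.
  by rewrite Lambda_hatE (inj_eq perm_inj) eq_sym (negPf ki) mulr0.
by rewrite HE.
Qed.

(** The pull-back of [mu] and its image under [sigma] agree on all [h_i]; at [d] they differ by
    [mu(d') - mu(d)], whence a multiple of [delta]. *)
Lemma twistE mu H : twist sigma mu H = mu (hhat_twist H)
  - (mu d' - mu (0, 0, 1) : K) * (delta D H : K) :> K.
Proof.
rewrite hhat_twist_eval /twist add_lfunE scale_lfunE sum_lfunE.
rewrite (reindex_inj (@perm_inj _ sigma)) /=.
rewrite (eq_bigr (fun i => (Lambda_hat D i H : K) * (mu (coroot_hat D (sigma i)) : K))).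
  by rewrite -[_ *: delta D H]/((mu (0, 0, 1) : K) * (delta D H : K)); ring.
by move=> i _; rewrite scale_lfunE permK mulrC.
Qed.

End Map.
End CartanTwist.

(** * Words in the product of two Lie algebras *)

Section PairWords.
Context (K : fieldType) (L1 L2 : lieAlgType K) (J : Type).
Implicit Types p q r : (L1 * L2)%type.

Definition pair_lie p q : (L1 * L2)%type := ([lie p.1, q.1], [lie p.2, q.2]).

Lemma pair_lie_linearr p : linear (pair_lie p).
Proof. by move=> a q r; congr (_, _) => /=; rewrite lieDr lieZr. Qed.

Lemma pair_lie_linearl p : linear (pair_lie^~ p).
Proof. by move=> a q r; congr (_, _) => /=; rewrite lieDl lieZl. Qed.

Lemma pair_lieC p q : pair_lie p q = - pair_lie q p.
Proof. by congr (_, _) => /=; rewrite lieC. Qed.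

Lemma pair_lie_leibniz p q r :
  pair_lie p (pair_lie q r) = pair_lie (pair_lie p q) r + pair_lie q (pair_lie p r).
Proof. by congr (_, _) => /=; rewrite lie_leibniz. Qed.

Context (E : J -> (L1 * L2)%type).

(** Right-normed brackets suffice, since the Jacobi identity reduces other bracketings to them. The
    list of letters determines the weight. *)
Inductive word : seq J -> (L1 * L2)%type -> Prop :=
| word1 i : word [:: i] (E i)
| wordS i s p : word s p -> word (i :: s) (pair_lie (E i) p).

Definition is_word p := exists s, word s p.

Context (T : Type) (Hp : T -> (L1 * L2)%type) (a : J -> T -> K) (b : J -> T -> K).
Context (F : J -> (L1 * L2)%type).
Hypothesis HE : forall t i, pair_lie (Hp t) (E i) = a i t *: E i.
Hypothesis HF : forall t i, pair_lie (Hp t) (F i) = b i t *: F i.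
Hypothesis FE : forall i k, pair_lie (F i) (E k) = 0 \/ exists t, pair_lie (F i) (E k) = Hp t.

Lemma word_weight s p t : word s p -> pair_lie (Hp t) p = (\sum_(i <- s) a i t) *: p.
Proof.
elim=> [i|i {}s {}p _ IH]; first by rewrite big_seq1.
rewrite pair_lie_leibniz HE (linZ (pair_lie_linearl p)) IH (linZ (pair_lie_linearr _)).
by rewrite -scalerDl big_cons.
Qed.

(** [F i] moves through the word by the Leibniz rule. Against a letter it gives 0 or some [Hp t],
    which acts on the rest of the word by a scalar; for a one-letter word [Hp t] itself remains. *)
Lemma lower_word i p : is_word p ->
  lspan (fun q => is_word q \/ exists t, q = Hp t) (pair_lie (F i) p).
Proof.
have sS := lspan_subspace (fun q => is_word q \/ exists t, q = Hp t).
case=> s; elim=> [k|k {}s {}p ps IH].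
  by case: (FE i k) => [->|[t ->]]; [left | apply: lspan_in; right; exists t].
rewrite pair_lie_leibniz; apply: subspaceD => //.
  case: (FE i k) => [->|[t ->]].
    by rewrite (lin0 (pair_lie_linearl p)); left.
  rewrite (word_weight _ ps); apply: subspaceZ => //.
  by apply: lspan_in; left; exists s.
have := subspace_preim (pair_lie_linearr (E k)) sS => sP.
apply: (lspan_min sP _ IH) => q [[s' qs']|[t ->]].
  by apply: lspan_in; left; exists (k :: s'); right.
rewrite pair_lieC HE; apply: subspaceN => //; apply: subspaceZ => //.
by apply: lspan_in; left; exists [:: k]; left.
Qed.

End PairWords.

(** * The generated subalgebra is the graph of an automorphism *)

Section Automorphism.
Context (K : numFieldType) (g : finLieAlgType K) (I : finType).
Context (D : cartanData g I).

Notation h := (cartan D).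
Notation B := (nform D).
Notation ghat := (affine (nform D)).
Notation root_vector := (@root_vector K g I D).
Notation hhat_in := (@hhat_in K g I D).
Implicit Types (X Y Z : ghat) (mu : weight D) (H : hhat D).

Context (sigma : {perm option I}) (d' : hhat D).
Hypothesis simple_g : simple_lie g.
Hypothesis diag : diagram_automorphism D sigma.
Hypothesis d'E : forall k, ahat D k d' = (k == sigma None)%:R :> K.

Notation s := (hhat_twist sigma d').

Context (e f : option I -> ghat).
Hypothesis re : forall i, root_vector (ahat D i) (e i).
Hypothesis rf : forall i, root_vector (- ahat D i) (f i).
Hypothesis ef : forall i k, [lie e i, f k] = if i == k then hhat_in (coroot_hat D i) else 0.
Hypothesis gen : forall S, lie_closed S -> (forall H, S (hhat_in H)) ->
  (forall i, S (e i)) -> (forall i, S (f i)) -> forall X, S X.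

Definition Epair i : (ghat * ghat)%type := (e i, e (sigma i)).
Definition Fpair i : (ghat * ghat)%type := (f i, f (sigma i)).
Definition Hpair H : (ghat * ghat)%type := (hhat_in H, hhat_in (s H)).

(* The subalgebra of [hat g x hat g] generated by the pairs above; it is the
   graph of the lift of [sigma]. *)
Definition graph : (ghat * ghat)%type -> Prop :=
  lspan (fun p => (is_word Epair p \/ is_word Fpair p) \/ exists H, p = Hpair H).

Let graphS : subspace graph.
Proof. exact: lspan_subspace. Qed.

Lemma hhat_in_inj H H' : hhat_in H = hhat_in H' -> H = H'.
Proof.
case: H H' => [[H a] b] [[H' a'] b'] e0.
have := congr1 (fun X : ghat => loop_coef 0 X.1.1) e0.
rewrite !loop_coef_mono eqxx => /subvs_inj /= ->.
have -> : a = a' by exact: (congr1 (fun X : ghat => X.1.2) e0).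
by have -> : b = b' by exact: (congr1 (fun X : ghat => X.2) e0).
Qed.

Lemma Hpair_lie H H' : pair_lie (Hpair H) (Hpair H') = 0.
Proof. by congr (_, _); apply: hhat_lie. Qed.

Lemma Hpair_linear : linear Hpair.
Proof.
move=> a H H'; congr (_, _); first exact: hhat_in_linear.
by rewrite /= hhat_twist_linear; exact: hhat_in_linear.
Qed.

Lemma Hpair_E H i : pair_lie (Hpair H) (Epair i) = (ahat D i H : K) *: Epair i.
Proof. by congr (_, _) => /=; rewrite re // ahat_hhat_twist. Qed.

Lemma Hpair_F H i : pair_lie (Hpair H) (Fpair i) = (- ahat D i H : K) *: Fpair i.
Proof. by congr (_, _) => /=; rewrite rf opp_lfunE // ahat_hhat_twist. Qed.

Lemma EF_pair i k : pair_lie (Epair i) (Fpair k) = 0 \/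
  exists H, pair_lie (Epair i) (Fpair k) = Hpair H.
Proof.
rewrite /pair_lie /= !ef (inj_eq perm_inj); have [_|_] := eqVneq i k; last by left.
by right; exists (coroot_hat D i); rewrite /Hpair hhat_twist_coroot.
Qed.

Lemma FE_pair i k : pair_lie (Fpair i) (Epair k) = 0 \/
  exists H, pair_lie (Fpair i) (Epair k) = Hpair H.
Proof.
rewrite pair_lieC; case: (EF_pair k i) => [->|[H ->]]; first by left; rewrite oppr0.
by right; exists (- H); rewrite (linN Hpair_linear).
Qed.

Let word_graph (b : bool) p : is_word (if b then Epair else Fpair) p -> graph p.
Proof. by move=> wp; apply: lspan_in; left; case: b wp; [left | right]. Qed.

Lemma graph_Hpair H : graph (Hpair H).
Proof. by apply: lspan_in; right; exists H. Qed.

Lemma graph_Hstable H p : graph p -> graph (pair_lie (Hpair H) p).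
Proof.
move: p; apply: (lspan_min (subspace_preim (pair_lie_linearr _) graphS)).
move=> p [[[w wp]|[w wp]]|[H' ->]].
- rewrite (word_weight (a := fun i H => ahat D i H : K) Hpair_E _ wp).
  by apply: subspaceZ => //; apply: (word_graph (b := true)); exists w.
- rewrite (word_weight (a := fun i H => - ahat D i H : K) Hpair_F _ wp).
  by apply: subspaceZ => //; apply: (word_graph (b := false)); exists w.
- by rewrite Hpair_lie; left.
Qed.

Lemma graph_Estable i p : graph p -> graph (pair_lie (Epair i) p).
Proof.
move: p; apply: (lspan_min (subspace_preim (pair_lie_linearr _) graphS)).
move=> p [[[w wp]|wp]|[H' ->]].
- by apply: (word_graph (b := true)); exists (i :: w); right.
- have := lower_word (a := fun i H => - ahat D i H : K) (F := Epair) Hpair_F EF_pair i wp.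
  by apply: lspan_mono => q [wq|?]; [left; right | right].
- rewrite pair_lieC Hpair_E; apply: subspaceN => //; apply: subspaceZ => //.
  by apply: (word_graph (b := true)); exists [:: i]; left.
Qed.

Lemma graph_Fstable i p : graph p -> graph (pair_lie (Fpair i) p).
Proof.
move: p; apply: (lspan_min (subspace_preim (pair_lie_linearr _) graphS)).
move=> p [[wp|[w wp]]|[H' ->]].
- have := lower_word (a := fun i H => ahat D i H : K) (F := Fpair) Hpair_E FE_pair i wp.
  by apply: lspan_mono => q [wq|?]; [left; left | right].
- by apply: (word_graph (b := false)); exists (i :: w); right.
- rewrite pair_lieC Hpair_F; apply: subspaceN => //; apply: subspaceZ => //.
  by apply: (word_graph (b := false)); exists [:: i]; left.
Qed.

(** The elements whose bracket preserves the graph are closed under brackets by the Jacobi identity,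
    and they include all generators. *)
Lemma graph_lie p q : graph p -> graph q -> graph (pair_lie p q).
Proof.
pose N p := forall q, graph q -> graph (pair_lie p q).
have sN : subspace N.
  split=> [r _|a p1 p2 N1 N2 r gr].
    by rewrite (lin0 (pair_lie_linearl r)); left.
  rewrite (pair_lie_linearl r); apply: subspaceD; [exact: graphS| |exact: N2].
  by apply: subspaceZ; [exact: graphS | apply: N1].
have NN p1 p2 : N p1 -> N p2 -> N (pair_lie p1 p2).
  move=> N1 N2 r gr.
  have -> : pair_lie (pair_lie p1 p2) r =
      pair_lie p1 (pair_lie p2 r) - pair_lie p2 (pair_lie p1 r).
    by rewrite (pair_lie_leibniz p1) addrK.
  by apply: (subspaceB graphS); [apply/N1/N2 | apply/N2/N1].
move=> gp; apply: (lspan_min sN _ gp) => r [[[w wp]|[w wp]]|[H ->]].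
- elim: wp => [i|i w' p' _ IH]; first exact: graph_Estable.
  by apply: NN => //; exact: graph_Estable.
- elim: wp => [i|i w' p' _ IH]; first exact: graph_Fstable.
  by apply: NN => //; exact: graph_Fstable.
- exact: graph_Hstable.
Qed.

Let hhat_twist_surj H : exists H', s H' = H.
Proof.
have [F FE] := lfun_of_linear (@hhat_twist_linear K g I D sigma d').
have kF : lker F == 0%VS.
  rewrite -subv0; apply/subvP => X; rewrite memv_ker memv0 FE => /eqP.
  by move=> /(hhat_twist_inj diag d'E) ->.
by exists ((F^-1)%VF H); rewrite -FE lker0_lfunVK.
Qed.

Lemma graph_total X : exists Y, graph (X, Y).
Proof.
apply: (gen (S := fun X => exists Y, graph (X, Y))).
- split; last first.
    by move=> x y [x' gx] [y' gy]; exists [lie x', y']; exact: graph_lie gx gy.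
  split=> [|a x y [x' gx] [y' gy]]; first by exists 0; left.
  by exists (a *: x' + y'); apply: (subspaceD graphS (subspaceZ a graphS gx) gy).
- by move=> H; exists (hhat_in (s H)); apply: graph_Hpair.
- by move=> i; exists (e (sigma i)); apply: (word_graph (b := true)); exists [:: i]; left.
- by move=> i; exists (f (sigma i)); apply: (word_graph (b := false)); exists [:: i]; left.
Qed.

Lemma graph_onto Y : exists X, graph (X, Y).
Proof.
apply: (gen (S := fun Y => exists X, graph (X, Y))).
- split; last first.
    by move=> x y [x' gx] [y' gy]; exists [lie x', y']; exact: graph_lie gx gy.
  split=> [|a x y [x' gx] [y' gy]]; first by exists 0; left.
  by exists (a *: x' + y'); apply: (subspaceD graphS (subspaceZ a graphS gx) gy).
- move=> H; have [H' <-] := hhat_twist_surj H.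
  by exists (hhat_in H'); apply: graph_Hpair.
- move=> i; exists (e ((sigma^-1)%g i)); rewrite -{2}(permKV sigma i).
  by apply: (word_graph (b := true)); exists [:: (sigma^-1)%g i]; left.
- move=> i; exists (f ((sigma^-1)%g i)); rewrite -{2}(permKV sigma i).
  by apply: (word_graph (b := false)); exists [:: (sigma^-1)%g i]; left.
Qed.

Lemma sum_ahat_Qcomb (w : seq (option I)) H :
  \sum_(i <- w) (ahat D i H : K) = Qcomb D (fun i => count_mem i w) H.
Proof.
rewrite QcombE; elim: w => [|i w IH].
  by rewrite big_nil big1 // => i _; rewrite mul0r.
rewrite big_cons IH -Qcomb_delta QcombE -big_split; apply: eq_bigr => k _ /=.
by rewrite natrD mulrDl eq_sym.
Qed.

(** Write [p] as a combination of words plus some [Hpair H]. A word is nonempty, so its weight is a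
    nonzero sum of simple roots or of their opposites, and the words contribute nothing in weight
    0. *)
Lemma graph_weight0 p : graph p -> (forall H, pair_lie (Hpair H) p = 0) ->
  exists H, p = Hpair H.
Proof.
move=> gp p0; have [u [H [wu pE]]] : exists u H,
    lspan (fun p => is_word Epair p \/ is_word Fpair p) u /\ p = u + Hpair H.
  elim: gp => [|a q r [wq|[H ->]] _ [u [H' [wu ->]]]].
  - by exists 0, 0; rewrite (lin0 Hpair_linear) addr0; split=> //; left.
  - by exists (a *: q + u), H'; rewrite addrA; split=> //; right.
  - exists u, (a *: H + H'); rewrite Hpair_linear; split=> //.
    by rewrite addrCA.
exists H; suff u0 : u = 0 by rewrite pE u0 add0r.
have hu : has_weight (fun mu H => mu H : K) (fun H => pair_lie (Hpair H)) (0 : weight D) u.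
  move=> H'; rewrite zero_lfunE scale0r -(p0 H') pE.
  by rewrite (linD (pair_lie_linearr _)) Hpair_lie addr0.
apply: contrapT => un0.
have := lspan_weight_class (C := fun mu => mu <> 0) (@weight_inj K g I D)
  (fun H => pair_lie_linearr (Hpair H)) _ wu hu un0.
have nz (w : seq (option I)) i : Qcomb D (fun k => count_mem k (i :: w)) <> 0.
  by move=> /Qcomb_eq0/(_ i); rewrite /= eqxx.
have wn0 (E : option I -> (ghat * ghat)%type) w q : word E w q -> exists i w', w = i :: w'.
  by case=> [i|i w' p' _]; [exists i, [::] | exists i, w'].
apply=> // q [[w wq]|[w wq]].
- have [i [w' wE]] := wn0 _ _ _ wq; exists (Qcomb D (fun k => count_mem k w)).
    by rewrite wE; apply: nz.
  move=> H'; rewrite (word_weight (a := fun i H => ahat D i H : K) Hpair_E _ wq).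
  by rewrite sum_ahat_Qcomb.
- have [i [w' wE]] := wn0 _ _ _ wq; exists (- Qcomb D (fun k => count_mem k w)).
    by rewrite wE => /eqP; rewrite oppr_eq0 => /eqP; apply: nz.
  move=> H'; rewrite (word_weight (a := fun i H => - ahat D i H : K) Hpair_F _ wq).
  by rewrite sumrN sum_ahat_Qcomb opp_lfunE.
Qed.

(** The [Y] with [(0, Y)] in the graph form an ideal, because the graph projects onto the second
    factor. An element of [hat h] in it gives a pair of weight 0, so it is [s H'] for some [H']
    whose first component is 0. *)
Lemma graph_functional Y : graph (0, Y) -> Y = 0.
Proof.
move: Y; apply: ideal_eq0.
- split=> [|a u v gu gv]; first by left.
  have -> : (0, a *: u + v) = a *: (0, u) + (0, v) :> ghat * ghat.
    by congr (_, _); rewrite /= scaler0 addr0.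
  by apply: (subspaceD graphS) => //; apply: (subspaceZ _ graphS).
- move=> Y Z gZ; have [X gX] := graph_onto Y.
  by have := graph_lie gX gZ; rewrite /pair_lie /= lie0r.
- move=> H gH; have [|H' HE] := graph_weight0 gH.
    by move=> H'; congr (_, _) => /=; rewrite ?lie0r // hhat_lie.
  have H'0 : H' = 0.
    apply: hhat_in_inj; rewrite (lin0 (@hhat_in_linear K g I D)).
    exact: (esym (congr1 fst HE)).
  apply: hhat_in_inj; apply: (etrans (congr1 snd HE)); rewrite /= H'0.
  by rewrite (lin0 (@hhat_twist_linear K g I D sigma d')).
Qed.

Lemma graph_injective X : graph (X, 0) -> X = 0.
Proof.
move: X; apply: ideal_eq0.
- split=> [|a u v gu gv]; first by left.
  have -> : (a *: u + v, 0) = a *: (u, 0) + (v, 0) :> ghat * ghat.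
    by congr (_, _); rewrite /= scaler0 addr0.
  by apply: (subspaceD graphS) => //; apply: (subspaceZ _ graphS).
- move=> X Z gZ; have [Y gY] := graph_total X.
  by have := graph_lie gY gZ; rewrite /pair_lie /= lie0r.
- move=> H gH; have [|H' HE] := graph_weight0 gH.
    by move=> H'; congr (_, _) => /=; rewrite ?lie0r // hhat_lie.
  have HH' : H = H' by apply: hhat_in_inj; exact: (congr1 fst HE).
  apply: (hhat_twist_inj diag d'E); apply: hhat_in_inj.
  rewrite (lin0 (@hhat_in_linear K g I D)) HH'.
  exact: (esym (congr1 snd HE)).
Qed.

Lemma diagram_lift : exists phi psi : ghat -> ghat,
  [/\ linear phi, forall X Y, phi [lie X, Y] = [lie phi X, phi Y],
      cancel phi psi, cancel psi phi & forall H, phi (hhat_in H) = hhat_in (s H)].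
Proof.
have [phi phiP] := choice graph_total; have [psi psiP] := choice graph_onto.
have phi_uniq X Y : graph (X, Y) -> phi X = Y.
  move=> gXY; apply/eqP; rewrite -subr_eq0; apply/eqP/graph_functional.
  have -> : (0, phi X - Y) = (X, phi X) - (X, Y) :> ghat * ghat.
    by congr (_, _); rewrite /= subrr.
  exact: (subspaceB graphS).
exists phi, psi; split.
- by move=> a X Y; apply: phi_uniq; exact: (subspaceD graphS (subspaceZ a graphS (phiP X)) (phiP Y)).
- by move=> X Y; apply: phi_uniq; apply: graph_lie (phiP X) (phiP Y).
- move=> X; apply/eqP; rewrite -subr_eq0; apply/eqP/graph_injective.
  have -> : (psi (phi X) - X, 0) = (psi (phi X), phi X) - (X, phi X) :> ghat * ghat.
    by congr (_, _); rewrite /= subrr.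
  exact: (subspaceB graphS).
- by move=> Y; apply: phi_uniq.
- by move=> H; apply: phi_uniq; apply: graph_Hpair.
Qed.

End Automorphism.

(** * Twisted modules *)

Section LieTwist.
Context (K : fieldType) (L : lieAlgType K).

Record lie_twist := LieTwist {
  tw_map : L -> L;
  tw_inv : L -> L;
  tw_chi : L -> K;
  tw_map_linear : linear tw_map;
  tw_map_lie : forall x y, tw_map [lie x, y] = [lie tw_map x, tw_map y];
  tw_mapK : cancel tw_map tw_inv;
  tw_invK : cancel tw_inv tw_map;
  tw_chi_linear : linear (tw_chi : L -> K^o);
  tw_chi_lie : forall x y, tw_chi [lie x, y] = 0
}.

(* The pull-back of [V] along [tw_map], tensored with the character [tw_chi]. *)
Definition twisted (t : lie_twist) (V : lieModType L) : Type := V.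

Section Twisted.
Context (t : lie_twist) (V : lieModType L).

HB.instance Definition _ := GRing.Lmodule.on (twisted t V).

Definition twisted_act (x : L) (v : twisted t V) : twisted t V :=
  lie_act (tw_map t x) (v : V) + tw_chi t x *: v.

Lemma act_linearr (W : lieModType L) (x : L) : linear (lie_act x : W -> W).
Proof. exact: lie_act_is_linearr. Qed.

Lemma act_linearl (W : lieModType L) (v : W) : linear (lie_act^~ v : L -> W).
Proof. exact: lie_act_is_linearl. Qed.

Lemma twisted_linearl v : linear (twisted_act^~ v).
Proof.
move=> a x y; rewrite /twisted_act tw_map_linear (act_linearl (v : V)).
by rewrite (tw_chi_linear t) scalerDl -scalerA scalerDr addrACA.
Qed.

Lemma twisted_linearr x : linear (twisted_act x).
Proof.
move=> a u v; rewrite /twisted_act (act_linearr (W := V)) !scalerDr !scalerA.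
by rewrite [tw_chi t x * a]mulrC addrACA.
Qed.

Lemma twisted_bracket x y v : twisted_act [lie x, y] v =
  twisted_act x (twisted_act y v) - twisted_act y (twisted_act x v).
Proof.
have E (Z : zmodType) (p q r s u : Z) :
    p + r + (s + u) - (q + s + (r + u)) = p - q.
  by rewrite -[p + r + _]addrA -[q + s + _]addrA [r + (s + u)]addrCA opprD addrACA subrr addr0.
rewrite /twisted_act tw_map_lie lie_act_bracket tw_chi_lie scale0r addr0.
rewrite !(linD (act_linearr (W := V) _)) !(linZ (act_linearr (W := V) _)) !scalerDr !scalerA.
by rewrite [tw_chi t y * tw_chi t x]mulrC E.
Qed.

HB.instance Definition _ := isLieModule.Build K L (twisted t V)
  twisted_linearl twisted_linearr twisted_bracket.

Lemma twistedE x (v : twisted t V) :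
  x ⋅ v = lie_act (tw_map t x) (v : V) + tw_chi t x *: v.
Proof. by []. Qed.

(** A subspace is preserved by the scalars [tw_chi], and [tw_map] is onto, so both actions have the
    same stable subspaces. *)
Lemma twisted_submodule (U : V -> Prop) :
  @submodule K L (twisted t V) U -> submodule U.
Proof.
case=> U0 UD Ux; split=> // x u Uu.
have := Ux (tw_inv t x) u Uu; rewrite twistedE tw_invK => Uy.
have -> : x ⋅ u = (- tw_chi t (tw_inv t x)) *: u + (x ⋅ u + tw_chi t (tw_inv t x) *: u).
  by rewrite addrCA scaleNr addNr addr0.
exact: UD.
Qed.

Lemma twisted_irreducible : irreducible V -> irreducible (twisted t V).
Proof.
by case=> nz irr; split=> // U /twisted_submodule/irr.
Qed.

End Twisted.

(** The spaces and [tau] are unchanged; both factors act through the same automorphism, and the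
    scalar terms add. *)
Lemma twisted_tensor (t t1 t2 : lie_twist) (V W T : lieModType L) (tau : V -> W -> T) :
  tw_map t1 =1 tw_map t -> tw_map t2 =1 tw_map t ->
  (forall x, tw_chi t x = tw_chi t1 x + tw_chi t2 x) ->
  tensor_product tau ->
  @tensor_product K L (twisted t1 V) (twisted t2 W) (twisted t T) tau.
Proof.
move=> e1 e2 echi [btau utau htau]; split=> // x v w.
rewrite !twistedE htau e1 e2 echi scalerDl addrACA; congr (_ + _).
  rewrite [RHS](linD (btau.1 w)); congr (_ + _).
  by rewrite (linZ (btau.1 w)).
rewrite [RHS](linD (btau.2 v)); congr (_ + _).
by rewrite (linZ (btau.2 v)).
Qed.

Section Inverse.
Context (t : lie_twist).

Fact inv_linear : linear (tw_inv t).
Proof.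
move=> a x y; rewrite -{1}[x](tw_invK t) -{1}[y](tw_invK t).
by rewrite -tw_map_linear tw_mapK.
Qed.

Fact inv_lie x y : tw_inv t [lie x, y] = [lie tw_inv t x, tw_inv t y].
Proof.
rewrite -{1}[x](tw_invK t) -{1}[y](tw_invK t).
by rewrite -tw_map_lie tw_mapK.
Qed.

Fact inv_chi_linear : linear ((fun x => - tw_chi t (tw_inv t x)) : L -> K^o).
Proof.
move=> a x y; rewrite inv_linear (tw_chi_linear t) opprD; congr (_ + _).
by apply/esym; exact: mulrN.
Qed.

Fact inv_chi_lie x y : - tw_chi t (tw_inv t [lie x, y]) = 0.
Proof. by rewrite inv_lie tw_chi_lie oppr0. Qed.

(** The character is chosen to cancel that of [t], so that twisting by [t] and then by its inverse
    restores the action. *)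
Definition inv_twist := LieTwist inv_linear inv_lie (tw_invK t) (tw_mapK t)
  inv_chi_linear inv_chi_lie.

Lemma inv_twist_hom (T T' : lieModType L) (F : T -> T') (G : T' -> T) :
  @module_hom K L (twisted t T) T' F -> cancel F G -> cancel G F ->
  @module_hom K L (twisted inv_twist T') T G.
Proof.
case=> lF hF FK GK; have Finj : injective F := can_inj FK; split.
  by move=> a u v; apply: Finj; rewrite lF !GK.
move=> x w; apply: Finj; rewrite GK twistedE /=.
have := hF (tw_inv t x) (G w); rewrite twistedE tw_invK.
rewrite (linD lF) (linZ lF) GK => <-.
by rewrite scaleNr addrK.
Qed.

End Inverse.
End LieTwist.

(** * Uniqueness of tensor products *)

Section TensorUniqueness.
Context (K : fieldType) (L : lieAlgType K).

(** The two universal properties give the maps; that they are inverse and commute with the action is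
    checked on pure tensors, through the uniqueness clause. *)
Lemma tensor_iso (V W T V' W' T' : lieModType L) (tau : V -> W -> T)
    (tau' : V' -> W' -> T') (f : V -> V') (f' : V' -> V) (k : W -> W') (k' : W' -> W) :
  tensor_product tau -> tensor_product tau' ->
  module_hom f -> cancel f f' -> cancel f' f ->
  module_hom k -> cancel k k' -> cancel k' k ->
  exists (F : T -> T') (G : T' -> T), [/\ module_hom F, cancel F G & cancel G F].
Proof.
move=> [bt ut ht] [bt' ut' ht'] [lf hf] fK f'K [lk hk] kK k'K.
have lf' : linear f' by move=> a u v; apply: (can_inj fK); rewrite lf !f'K.
have lk' : linear k' by move=> a u v; apply: (can_inj kK); rewrite lk !k'K.
have b1 : bilinear_map (fun v w => tau' (f v) (k w)).
  split=> [w a u v|v a u w]; first by rewrite lf bt'.1.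
  by rewrite lk bt'.2.
have b2 : bilinear_map (fun v w => tau (f' v) (k' w)).
  split=> [w a u v|v a u w]; first by rewrite lf' bt.1.
  by rewrite lk' bt.2.
have [F [lF FE _]] := ut _ _ b1; have [G [lG GE _]] := ut' _ _ b2.
have FK : cancel F G.
  have [P [_ _ Pu]] := ut _ _ bt.
  have e1 : G \o F =1 P.
    by apply: Pu => [a u w|u w] /=; rewrite ?lF ?lG // FE GE fK kK.
  have e2 : id =1 P by apply: Pu.
  by move=> v; rewrite -[LHS]/((G \o F) v) e1 -e2.
have GK : cancel G F.
  have [P [_ _ Pu]] := ut' _ _ bt'.
  have e1 : F \o G =1 P.
    by apply: Pu => [a u w|u w] /=; rewrite ?lG ?lF // GE FE f'K k'K.
  have e2 : id =1 P by apply: Pu.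
  by move=> v; rewrite -[LHS]/((F \o G) v) e1 -e2.
exists F, G; split=> //; split=> // x v.
have actl (M : lieModType L) : linear (lie_act x : M -> M) by exact: lie_act_is_linearr.
have b3 : bilinear_map (fun v w => F (x ⋅ tau v w)).
  split=> [w a u u'|u a w w']; first by rewrite bt.1 actl lF.
  by rewrite bt.2 actl lF.
have [P [_ _ Pu]] := ut _ _ b3.
have e1 : (fun v => F (x ⋅ v)) =1 P by apply: Pu => // a u w; rewrite actl lF.
have e2 : (fun v => x ⋅ F v) =1 P.
  apply: Pu => [a u w|u w]; first by rewrite lF actl.
  by rewrite FE ht' ht (linD lF) !FE hf hk.
exact: (etrans (e1 v) (esym (e2 v))).
Qed.

End TensorUniqueness.

(** * Highest weight modules *)

Section ProductModule.
Context (K : fieldType) (L : lieAlgType K).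

Definition prodmod (V W : lieModType L) : Type := (V * W)%type.

Context (V W : lieModType L).
HB.instance Definition _ := GRing.Lmodule.on (prodmod V W).

Definition prod_act (x : L) (p : prodmod V W) : prodmod V W := (x ⋅ p.1, x ⋅ p.2).

Lemma prod_act_linearl p : linear (prod_act^~ p).
Proof. by move=> a x y; congr (_, _) => /=; apply: lie_act_is_linearl. Qed.

Lemma prod_act_linearr x : linear (prod_act x).
Proof. by move=> a p q; congr (_, _) => /=; apply: lie_act_is_linearr. Qed.

Lemma prod_act_bracket x y p :
  prod_act [lie x, y] p = prod_act x (prod_act y p) - prod_act y (prod_act x p).
Proof. by congr (_, _) => /=; apply: lie_act_bracket. Qed.

HB.instance Definition _ := isLieModule.Build K L (prodmod V W)
  prod_act_linearl prod_act_linearr prod_act_bracket.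
End ProductModule.

Section HighestWeight.
Context (K : numFieldType) (g : finLieAlgType K) (I : finType).
Context (D : cartanData g I).

Notation ghat := (affine (nform D)).
Notation root_vector := (@root_vector K g I D).
Notation hhat_in := (@hhat_in K g I D).
Notation weight := (weight D).
Implicit Types (X Y Z : ghat) (mu : weight) (H : hhat D) (c : option I -> nat).

Section Module.
Context (V : lieModType ghat).
Implicit Types (u v w : V).

Lemma mod_act_linear X : linear (lie_act X : V -> V).
Proof. exact: lie_act_is_linearr. Qed.

Lemma weight_vector_subspace mu : subspace (weight_vector mu : V -> Prop).
Proof. exact: (has_weight_subspace _ (fun H => mod_act_linear (hhat_in H))). Qed.

Lemma weight_vector_class (A : V -> Prop) (C : weight -> Prop) mu v :
  (forall u, A u -> exists2 m, C m & weight_vector m u) ->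
  lspan A v -> weight_vector mu v -> v <> 0 -> C mu.
Proof.
exact: (@lspan_weight_class _ V _ _ (fun mu H => mu H : K) (fun H => lie_act (hhat_in H))
  (@weight_inj K g I D) (fun H => mod_act_linear (hhat_in H))).
Qed.

Lemma weight_vector_act nu mu X v : root_vector nu X -> weight_vector mu v ->
  weight_vector (nu + mu) (X ⋅ v).
Proof.
move=> nX mv H; have := lie_act_bracket (hhat_in H) X v.
rewrite nX (linZ (lie_act_is_linearl v)) mv (linZ (mod_act_linear X)) => /eqP.
by rewrite eq_sym subr_eq -scalerDl add_lfunE => /eqP.
Qed.

(** Letters are arbitrary vectors of negative weight in any order, so no PBW basis is involved; the
    index records the weight lost. *)
Inductive low_word v : (option I -> nat) -> V -> Prop :=
| low_word0 : low_word v (fun=> 0%N) v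
| low_wordS c c' Y w : low_word v c w -> (exists i, c' i <> 0%N) ->
    root_vector (- Qcomb D c') Y -> low_word v (fun i => c' i + c i)%N (Y ⋅ w).

Definition low_span v := lspan (fun w => exists c, low_word v c w).
Definition lower_span v :=
  lspan (fun w => exists2 c, (exists i, c i <> 0%N) & low_word v c w).

Context (lambda : weight) (v0 : V).
Hypothesis hw : highest_weight_vector lambda v0.

Lemma low_word_weight c w : low_word v0 c w -> weight_vector (lambda - Qcomb D c) w.
Proof.
elim=> [|{}c c' Y {}w _ IH _ rY].
  suff -> : lambda - Qcomb D (fun=> 0%N) = lambda by case: hw.
  apply: weight_inj => H; rewrite add_lfunE opp_lfunE QcombE big1 ?subr0 // => i _.
  by rewrite mul0r.
suff -> : lambda - Qcomb D (fun i => c' i + c i)%N = - Qcomb D c' + (lambda - Qcomb D c).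
  exact: weight_vector_act.
by rewrite QcombD opprD addrCA.
Qed.

(** [X] moves past the first letter at the cost of a bracket acting on a shorter word; on [v0]
    itself the triangular decomposition concludes. *)
Lemma low_span_submodule : submodule (low_span v0).
Proof.
have sS : subspace (low_span v0) by exact: lspan_subspace.
case: sS => S0 SZ; split=> //; move=> X u lu.
have sS : subspace (low_span v0) by [].
suff word_act c w : low_word v0 c w -> forall X, low_span v0 (X ⋅ w).
  move: u lu; apply: (lspan_min (subspace_preim (mod_act_linear X) sS)).
  by move=> w [c wc]; apply: word_act wc _.
elim=> [|{}c c' Y {}w wc IH c'0 rY] {}X.
  have actl : linear (lie_act^~ v0 : ghat -> V) by exact: lie_act_is_linearl.
  move: X; apply: (triangular_span (subspace_preim actl sS)) => [X [d d0 rX]|X [d d0 rX]|H].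
  - by case: hw => _ _ /(_ d X d0 rX) ->; case: sS.
  - by apply: lspan_in; eexists; apply: low_wordS d0 rX; left.
  - case: hw => _ -> _; apply: (subspaceZ _ sS); apply: lspan_in.
    by exists (fun=> 0%N); left.
have -> : X ⋅ (Y ⋅ w) = [lie X, Y] ⋅ w + Y ⋅ (X ⋅ w) by rewrite lie_act_bracket subrK.
apply: (subspaceD sS); first exact: IH.
apply: (lspan_min (subspace_preim (mod_act_linear Y) sS) _ (IH X)) => z [d zd].
by apply: lspan_in; eexists; apply: low_wordS zd c'0 rY.
Qed.

Lemma low_span_split u : low_span v0 u ->
  exists (a : K) w, u = a *: v0 + w /\ lower_span v0 w.
Proof.
elim=> [|a w u' [c wc] _ [b [w' [-> lw']]]].
  by exists 0, 0; rewrite scale0r addr0; split=> //; left.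
case: wc => [|{}c c' Y {}w wc c'0 rY].
  by exists (a + b), w'; rewrite scalerDl addrA.
exists b, (a *: (Y ⋅ w) + w'); rewrite addrCA; split=> //; right => //.
exists (fun i => c' i + c i)%N; last exact: low_wordS.
by case: c'0 => i ci; exists i; lia.
Qed.

Lemma low_span_weight u mu : low_span v0 u -> weight_vector mu u -> u <> 0 ->
  exists c, mu = lambda - Qcomb D c.
Proof.
move=> lu mu_u u0.
apply: (weight_vector_class (C := fun mu => exists c, mu = lambda - Qcomb D c) _ lu mu_u u0).
move=> w [c wc].
by exists (lambda - Qcomb D c); [exists c | apply: low_word_weight].
Qed.

(** Words with at least one letter have weights different from [lambda], so only multiples of [v0]
    survive. *)
Lemma low_span_top u : low_span v0 u -> weight_vector lambda u -> exists a : K, u = a *: v0.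
Proof.
move=> /low_span_split[a [w [uE lw]]] lu; exists a; rewrite uE.
suff -> : w = 0 by rewrite addr0.
apply: contrapT => w0; have wv : weight_vector lambda w.
  have -> : w = u - a *: v0 by rewrite uE addrAC subrr add0r.
  apply: (subspaceB (weight_vector_subspace _)) => //.
  by apply: (subspaceZ _ (weight_vector_subspace _)); case: hw.
have [] := weight_vector_class (C := fun mu => mu <> lambda) _ lw wv w0 => //.
move=> u' [c [i ci] u'c]; exists (lambda - Qcomb D c); last exact: low_word_weight.
move=> e; apply: ci; apply: (@Qcomb_eq0 _ _ _ D c).
by apply/eqP; rewrite -oppr_eq0 -[- _](addKr lambda) e addNr.
Qed.

Lemma low_span_full : irreducible V -> forall u, low_span v0 u.
Proof.
case=> _ /(_ _ low_span_submodule)[z|//]; case: hw => v00 _ _; case: v00.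
by apply: z; apply: lspan_in; exists (fun=> 0%N); left.
Qed.

End Module.

(** Each weight lies below the other, so both differences vanish, and the space of highest weight is
    a line. *)
Lemma highest_weight_unique (V : lieModType ghat) lambda mu (v w : V) :
  irreducible V -> highest_weight_vector lambda v -> highest_weight_vector mu w ->
  mu = lambda /\ exists a : K, w = a *: v.
Proof.
move=> irr hv hw; have [v0 vl _] := hv; have [w0 wm _] := hw.
have [c cE] := low_span_weight hv (low_span_full hv irr w) wm w0.
have [d dE] := low_span_weight hw (low_span_full hw irr v) vl v0.
have ml : mu = lambda.
  rewrite cE; apply: weight_inj => H; rewrite add_lfunE opp_lfunE.
  have /Qcomb_eq0 e : Qcomb D (fun i => c i + d i)%N = 0.
    apply: weight_inj => H'; rewrite QcombD add_lfunE zero_lfunE.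
    have := congr1 (fun m : weight => m H' : K) cE; rewrite add_lfunE opp_lfunE.
    have := congr1 (fun m : weight => m H' : K) dE; rewrite add_lfunE opp_lfunE.
    move: (lambda H' : K) (mu H' : K) (Qcomb D c H' : K) (Qcomb D d H' : K) => l m p q.
    change (l = m - q -> m = l - p -> p + q = 0) => -> /eqP.
    by rewrite -[X in X == _]addr0 -addrA (inj_eq (addrI _)) -opprD eq_sym oppr_eq0 addrC => /eqP.
  rewrite QcombE big1 ?subr0 // => i _.
  have -> : c i = 0%N by have := e i; lia.
  by rewrite mul0r.
split=> //; apply: (low_span_top hv (low_span_full hv irr w)).
by rewrite -ml.
Qed.

(** The submodule of [V x W] generated by [(v, w)] is the graph of the isomorphism: irreducibility
    makes its projections onto and its intersections with the factors trivial. *)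
Lemma highest_weight_iso (V W : lieModType ghat) lambda (v : V) (w : W) :
  irreducible V -> irreducible W ->
  highest_weight_vector lambda v -> highest_weight_vector lambda w ->
  exists (F : V -> W) (G : W -> V), [/\ module_hom F, cancel F G & cancel G F].
Proof.
move=> irrV irrW [v0 lv pv] [w0 lw pw].
pose p : prodmod V W := (v, w).
have hp : highest_weight_vector lambda p.
  split; first by move=> /(congr1 fst).
    by move=> H; congr (_, _); [apply: lv | apply: lw].
  move=> c X c0 rX; congr (_, _) => /=; [exact: pv c0 rX | exact: pw c0 rX].
pose U := low_span p; have [U0 UD UX] := low_span_submodule hp.
have sU : subspace U by split.
have Up : U p by apply: lspan_in; exists (fun=> 0%N); left.
have top u : U u -> weight_vector lambda u -> exists a : K, u = a *: p.
  exact: low_span_top.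
have totV u : exists u', U (u, u').
  have sm : submodule (fun u : V => exists u', U (u, u')).
    split=> [|a x y [x' Ux] [y' Uy]|X x [x' Ux]]; first by exists 0.
      by exists (a *: x' + y'); apply: (UD a _ _ Ux Uy).
    by exists (X ⋅ x'); apply: (UX X _ Ux).
  case: (irrV) => _ /(_ _ sm)[z|//]; case: v0; apply: z; by exists w.
have totW u : exists u', U (u', u).
  have sm : submodule (fun u : W => exists u', U (u', u)).
    split=> [|a x y [x' Ux] [y' Uy]|X x [x' Ux]]; first by exists 0.
      by exists (a *: x' + y'); apply: (UD a _ _ Ux Uy).
    by exists (X ⋅ x'); apply: (UX X _ Ux).
  case: (irrW) => _ /(_ _ sm)[z|//]; case: w0; apply: z; by exists v.
have funW u : U (0, u) -> u = 0.
  have sm : submodule (fun u : W => U (0, u)).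
    split=> [//|a x y Ux Uy|X x Ux].
      have -> : (0, a *: x + y) = a *: (0, x) + (0, y) :> prodmod V W.
        by congr (_, _); rewrite /= scaler0 addr0.
      exact: UD.
    have := UX X _ Ux; congr U; congr (_, _) => /=; exact: (lin0 (mod_act_linear X)).
  (* Otherwise [(0, w)] lies in [U] with weight [lambda], so it is a multiple of [(v, w)], which
     forces [w = 0]. *)
  case: (irrW) => _ /(_ _ sm)[z|z]; first exact: z.
  have [|a aE] := top _ (z w).
    by move=> H; congr (_, _) => /=; rewrite ?scaler0 ?(lin0 (mod_act_linear _)).
  case: w0; have /eqP := congr1 fst aE; rewrite eq_sym /= scaler_eq0 => /orP[/eqP a0|/eqP//].
  by have := congr1 snd aE; rewrite /= a0 scale0r.
have funV u : U (u, 0) -> u = 0.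
  have sm : submodule (fun u : V => U (u, 0)).
    split=> [//|a x y Ux Uy|X x Ux].
      have -> : (a *: x + y, 0) = a *: (x, 0) + (y, 0) :> prodmod V W.
        by congr (_, _); rewrite /= scaler0 addr0.
      exact: UD.
    have := UX X _ Ux; congr U; congr (_, _) => /=; exact: (lin0 (mod_act_linear X)).
  case: (irrV) => _ /(_ _ sm)[z|z]; first exact: z.
  have [|a aE] := top _ (z v).
    by move=> H; congr (_, _) => /=; rewrite ?scaler0 ?(lin0 (mod_act_linear _)).
  case: v0; have /eqP := congr1 snd aE; rewrite eq_sym /= scaler_eq0 => /orP[/eqP a0|/eqP//].
  by have := congr1 fst aE; rewrite /= a0 scale0r.
have [F FP] := choice totV; have [G GP] := choice totW.
have uniF x y : U (x, y) -> F x = y.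
  move=> Uxy; apply/eqP; rewrite -subr_eq0; apply/eqP/funW.
  have -> : (0, F x - y) = (x, F x) - (x, y) :> prodmod V W.
    by congr (_, _); rewrite /= subrr.
  exact: (subspaceB sU).
exists F, G; split.
- split=> [a x y|X x]; apply: uniF; first exact: (UD a _ _ (FP x) (FP y)).
  exact: (UX X _ (FP x)).
- move=> x; apply/eqP; rewrite -subr_eq0; apply/eqP/funV.
  have -> : (G (F x) - x, 0) = (G (F x), F x) - (x, F x) :> prodmod V W.
    by congr (_, _); rewrite /= subrr.
  exact: (subspaceB sU).
- by move=> y; apply: uniF.
Qed.

End HighestWeight.

(** * Multiplicities *)

Lemma lspan_range (K : fieldType) (V : lmodType K) n (u : 'I_n -> V) x :
  lspan (fun y => exists l, y = u l) x -> exists b : 'I_n -> K, x = \sum_l b l *: u l.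
Proof.
elim=> [|a _ w [l ->] _ [b ->]].
  by exists (fun=> 0); rewrite big1 // => l _; rewrite scale0r.
exists (fun k => a *+ (k == l) + b k).
under [RHS]eq_bigr do rewrite scalerDl; rewrite big_split /=; congr (_ + _).
rewrite (bigD1 l) //= eqxx big1 ?addr0 // => k /negPf ->.
by rewrite mulr0n scale0r.
Qed.

(** A matrix with more rows than columns has a nonzero left kernel. *)
Lemma independent_leq (K : fieldType) (V : lmodType K) n n' (u : 'I_n -> V) (u' : 'I_n' -> V) :
  (forall r : 'I_n -> K, \sum_k r k *: u k = 0 -> forall k, r k = 0) ->
  (forall k, lspan (fun y => exists l, y = u' l) (u k)) -> (n <= n')%N.
Proof.
move=> indep uu'; have /choice[A AE] : forall k, exists b : 'I_n' -> K, u k = \sum_l b l *: u' l.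
  by move=> k; apply: lspan_range.
rewrite leqNgt; apply/negP => nn'; pose M : 'M[K]_(n, n') := \matrix_(k, l) A k l.
have /rowV0Pn[r /sub_kermxP rM r0] : kermx M != 0.
  by rewrite kermx_eq0 /row_free neq_ltn (leq_ltn_trans (rank_leq_col M)).
case/eqP: r0; apply/rowP => k; rewrite mxE; apply: (indep (fun k => r 0 k)).
under eq_bigr do rewrite AE scaler_sumr; rewrite exchange_big /=.
rewrite big1 // => l _; under eq_bigr do rewrite scalerA.
rewrite -scaler_suml; have := congr1 (fun N : 'rV[K]_n' => N 0 l) rM; rewrite !mxE => e.
by rewrite (eq_bigr (fun i => r 0 i * M i l)) ?e ?scale0r // => i _; rewrite mxE.
Qed.

Section Multiplicity.
Context (K : numFieldType) (g : finLieAlgType K) (I : finType).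
Context (D : cartanData g I).

Notation ghat := (affine (nform D)).
Notation root_vector := (@root_vector K g I D).
Notation hhat_in := (@hhat_in K g I D).
Notation weight := (weight D).
Implicit Types (X Y Z : ghat) (mu : weight) (H : hhat D) (m : weight -> nat).

Lemma tag_ord_eq m (j j' : {Phi : weight & 'I_(m Phi)}) :
  tag j = tag j' -> tagged j = tagged j' :> nat -> j = j'.
Proof. by case: j j' => [a i] [b k] /= e; case: _ / e k => k /val_inj ->. Qed.

(** Spanning allows repeated indices while independence wants distinct ones; a repetition is
    absorbed as a multiple of the component. *)
Lemma direct_sum_uniq (V : lieModType ghat) (J : eqType) (M : J -> lieModType ghat)
    (iota : forall j, M j -> V) (s : seq J) (x : forall j, M j) :
  (forall j, module_hom (iota j)) ->
  exists y : forall j, M j, \sum_(j <- s) iota j (x j) = \sum_(j <- undup s) iota j (y j).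
Proof.
move=> hi; exists (fun j => x j *+ count_mem j s).
rewrite -big_undup_iterop_count; apply: eq_bigr => j _.
rewrite -scaler_nat (linZ (hi j).1) scaler_nat.
by case: (count_mem j s).
Qed.

(** The highest weight vectors of the [m Phi] copies are independent. In the second decomposition
    their components are 0 or highest weight vectors of weight [Phi], hence multiples of the chosen
    ones in the [m' Phi] copies. *)
Lemma decomposes_leq (V : lieModType ghat) m m' Phi :
  decomposes V m -> decomposes V m' -> (m Phi <= m' Phi)%N.
Proof.
move=> [M [hM [iota [hi si ui]]]] [M' [hM' [iota' [hi' si' ui']]]].
have ex j : exists v : M j, highest_weight_vector (tag j) v by case: (hM j) => _ [].
have ex' j : exists v : M' j, highest_weight_vector (tag j) v by case: (hM' j) => _ [].
pose v j := sval (cid (ex j)); have hv j : highest_weight_vector (tag j) (v j) := svalP (cid (ex j)).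
pose v' j := sval (cid (ex' j)).
have hv' j : highest_weight_vector (tag j) (v' j) := svalP (cid (ex' j)).
pose T k := Tagged (fun Phi => 'I_(m Phi)) (k : 'I_(m Phi)).
pose T' k := Tagged (fun Phi => 'I_(m' Phi)) (k : 'I_(m' Phi)).
apply: (@independent_leq K V _ _ (fun k => iota (T k) (v (T k)))
  (fun k => iota' (T' k) (v' (T' k)))) => [r r0 k|k].
  (* Independence is stated for families over all indices, so [r] is extended by 0 beyond
     [m Phi]. *)
  pose r' n : K := if insub n is Some k then r k else 0.
  have r'E (l : 'I_(m Phi)) : r' l = r l by rewrite /r' valK.
  pose s := [seq T l | l <- enum 'I_(m Phi)].
  have us : uniq s.
    rewrite map_inj_uniq ?enum_uniq // => l l' e; apply: val_inj.
    exact: (congr1 (fun j : {Phi : weight & 'I_(m Phi)} => val (tagged j)) e).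
  have := ui s (fun j => r' (tagged j) *: v j) us.
  rewrite big_map big_enum /= (eq_bigr (fun k => r k *: iota (T k) (v (T k)))); last first.
    by move=> l _; rewrite (linZ (hi _).1) /= r'E.
  move=> /(_ r0 (T k)); rewrite map_f ?mem_enum // => /(_ isT) /eqP.
  rewrite /= r'E scaler_eq0 => /orP[/eqP //|/eqP vk].
  by case: (hv (T k)).
set u := iota _ _.
have uw : weight_vector Phi u.
  by move=> H; rewrite /u -(hi _).2; case: (hv (T k)) => _ -> _; rewrite (linZ (hi _).1).
have up c X : (exists i, c i <> 0%N) -> root_vector (Qcomb D c) X -> X ⋅ u = 0.
  move=> c0 rX; rewrite /u -(hi _).2; case: (hv (T k)) => _ _ /(_ c X c0 rX) ->.
  exact: (lin0 (hi _).1).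
have [s0 [x0 uE0]] := si' u; have [x uE] := direct_sum_uniq s0 x0 hi'.
rewrite -uE0 in uE; rewrite uE.
have us := undup_uniq s0; move: (undup s0) us uE => {uE0 x0}s us uE.
apply: (subspace_sum_seq (lspan_subspace _)) => j js _.
have xw : weight_vector Phi (x j).
  move=> H; apply/eqP; rewrite -subr_eq0; apply/eqP.
  apply: (ui' s (fun j => hhat_in H ⋅ x j - (Phi H : K) *: x j) us _ j js).
  rewrite (eq_bigr (fun j => hhat_in H ⋅ iota' j (x j) - (Phi H : K) *: iota' j (x j))).
    rewrite sumrB -scaler_sumr -(lin_sum (mod_act_linear (hhat_in H))) -uE uw.
    exact: subrr.
  by move=> l _; rewrite (linB (hi' l).1) (hi' l).2 (linZ (hi' l).1).
have xp c X : (exists i, c i <> 0%N) -> root_vector (Qcomb D c) X -> X ⋅ x j = 0.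
  move=> c0 rX; apply: (ui' s (fun j => X ⋅ x j) us _ j js).
  rewrite (eq_bigr (fun j => X ⋅ iota' j (x j))).
    by rewrite -(lin_sum (mod_act_linear X)) -uE; apply: up c0 rX.
  by move=> l _; rewrite (hi' l).2.
have [->|/eqP xn0] := eqVneq (x j) 0; first by rewrite (lin0 (hi' j).1); left.
have hx : highest_weight_vector Phi (x j) by [].
have irr : irreducible (M' j) by case: (hM' j) => _ [].
have [e [a ->]] := highest_weight_unique irr (hv' j) hx.
rewrite (linZ (hi' j).1); apply: (subspaceZ _ (lspan_subspace _)); apply: lspan_in.
by move: e; case: (j) => Psi l /= e; case: _ / e l => l; exists l.
Qed.

Lemma decomposes_unique (V : lieModType ghat) m m' :
  decomposes V m -> decomposes V m' -> m = m'.
Proof.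
move=> d d'; apply/funext => Phi; apply/eqP; rewrite eqn_leq.
by rewrite (decomposes_leq Phi d d') (decomposes_leq Phi d' d).
Qed.

Lemma multiplicity_eq (V : lieModType ghat) m Phi :
  decomposes V m -> multiplicity V Phi = m Phi.
Proof.
move=> d; rewrite /multiplicity; case: pselect => [e|[]]; last by exists m.
by rewrite (decomposes_unique (svalP (cid e)) d).
Qed.

Section Transport.
Context (t : lie_twist ghat) (up dn : weight -> weight).
Hypothesis dnK : cancel dn up.
Hypothesis upK : cancel up dn.
Hypothesis simple_up : forall (M : lieModType ghat) mu, dominant mu ->
  is_simple_integrable M mu ->
  dominant (up mu) /\ is_simple_integrable (twisted t M) (up mu).

(** The new summand of weight [mu] is the twist of the old one of weight [dn mu]; [F] identifies the
    twist of [T] with [T']. *)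
Lemma decomposes_transport (T T' : lieModType ghat) (F : T -> T') (G : T' -> T) m :
  @module_hom K _ (twisted t T) T' F -> cancel F G -> cancel G F ->
  decomposes T m -> decomposes T' (m \o dn).
Proof.
move=> [lF hF] FK GK [M [hM [iota [hi si ui]]]].
pose J := {Phi : weight & 'I_(m Phi)}; pose J' := {Phi : weight & 'I_((m \o dn) Phi)}.
pose p (j : J') : J := Tagged (fun Phi => 'I_(m Phi)) (tagged j).
have p_inj : injective p.
  move=> j j' e; apply: tag_ord_eq.
    by apply: (can_inj dnK); exact: (congr1 tag e).
  exact: (congr1 (fun i : J => val (tagged i)) e).
have /choice[q pK] : forall j : J, exists j' : J', p j' = j.
  move=> [Phi i]; exists (Tagged (fun Phi => 'I_((m \o dn) Phi))
    (cast_ord (congr1 m (esym (upK Phi))) i)).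
  by apply: tag_ord_eq => //=; apply: upK.
have qK : cancel p q by move=> j'; apply: p_inj; rewrite pK.
exists (fun j' => twisted t (M (p j'))); split.
  move=> j'; have [dj sj] := hM (p j').
  by have := simple_up dj sj; rewrite /= dnK.
exists (fun j' x => F (iota (p j') x)); split.
- move=> j'; have [li hij] := hi (p j'); split=> [a x y|X x].
    have e : iota (p j') (a *: x + y) = a *: iota (p j') x + iota (p j') y.
      exact: (li a x y).
    by rewrite e lF.
  have e : iota (p j') (X ⋅ x) = (X : ghat) ⋅ (iota (p j') x : twisted t T).
    by rewrite !twistedE (linD li) hij (linZ li).
  by rewrite e; apply: hF.
- move=> w; have [s [x xE]] := si (G w).
  exists (map q s), (fun j' => x (p j')); rewrite big_map -[w]GK xE (lin_sum lF).
  apply: eq_bigr => j _.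
  exact: (congr1 (fun i => F (iota i (x i))) (esym (pK j))).
- move=> s x us xs j' js.
  (* [p (q j) = j] holds only propositionally, whence the cast; at [p i] it is trivial, because
     equality proofs between indices are unique. *)
  pose y j : M j := eq_rect (p (q j)) (fun j => M j : Type) (x (q j)) j (pK j).
  have yE i : y (p i) = x i.
    rewrite /y; move: (pK (p i)); rewrite qK => e.
    by rewrite (eq_irrelevance e erefl).
  rewrite -yE; apply: (ui (map p s) y); last exact: map_f.
    by rewrite map_inj_uniq.
  rewrite big_map; under eq_bigr do rewrite yE.
  by apply: (can_inj FK); rewrite (lin_sum lF) (lin0 lF).
Qed.

End Transport.

End Multiplicity.

(** * Effect of a twist on weights, integrability and highest weight vectors *)

Section WeightTwist.
Context (K : numFieldType) (g : finLieAlgType K) (I : finType).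
Context (D : cartanData g I).

Notation ghat := (affine (nform D)).
Notation root_vector := (@root_vector K g I D).
Notation hhat_in := (@hhat_in K g I D).
Notation weight := (weight D).
Implicit Types (X Y Z : ghat) (mu : weight) (H : hhat D).

Context (t : lie_twist ghat) (s s' : hhat D -> hhat D) (sigma : {perm option I}).
Hypothesis mapE : forall H, tw_map t (hhat_in H) = hhat_in (s H).
Hypothesis s'K : cancel s' s.
Hypothesis s_coroot : forall i, s (coroot_hat D i) = coroot_hat D (sigma i).
Hypothesis s_ahat : forall i H, ahat D (sigma i) (s H) = ahat D i H :> K.
Hypothesis chi_coroot : forall i, tw_chi t (hhat_in (coroot_hat D i)) = 0.
Context (up : weight -> weight).
Hypothesis upE : forall mu H, up mu H = (mu (s H) : K) + tw_chi t (hhat_in H) :> K.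

Lemma tw_map_root mu (nu : weight) X : (forall H, nu (s H) = mu H :> K) ->
  root_vector mu X -> root_vector nu (tw_map t X).
Proof.
move=> e rX H; rewrite -[H]s'K -mapE -tw_map_lie rX (linZ (tw_map_linear t)).
by rewrite e.
Qed.

(** The character vanishes on [[H, X] = mu(H) X]. Root vectors thus act on a twist through the
    automorphism alone. *)
Lemma tw_chi_root mu X : root_vector mu X -> mu <> 0 -> tw_chi t X = 0.
Proof.
move=> rX m0; have [H mH] : exists H, mu H <> 0 :> K.
  by apply/existsNP => e; apply: m0; apply: weight_inj => H; rewrite e zero_lfunE.
have := tw_chi_lie t (hhat_in H) X; rewrite rX => e.
have /eqP : (mu H : K) * tw_chi t X = 0.
  by rewrite -e; apply/esym; exact: (linZ (tw_chi_linear t)).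
by rewrite mulf_eq0 => /orP[/eqP/mH|/eqP].
Qed.

Lemma ahat_neq0 i : ahat D i <> 0.
Proof.
by rewrite -Qcomb_delta => /Qcomb_eq0/(_ i); rewrite eqxx.
Qed.

Lemma twisted_root_act (M : lieModType ghat) mu X (v : M) :
  root_vector mu X -> mu <> 0 -> lie_act X (v : twisted t M) = tw_map t X ⋅ v.
Proof.
by move=> rX m0; rewrite twistedE (tw_chi_root rX m0) scale0r addr0.
Qed.

Lemma twisted_weight_vector (M : lieModType ghat) mu (v : M) :
  weight_vector mu v -> weight_vector (up mu) (v : twisted t M).
Proof. by move=> mv H; rewrite twistedE mapE mv -scalerDl upE. Qed.

Lemma twisted_integrable (M : lieModType ghat) : integrable M -> integrable (twisted t M).
Proof.
case=> wM nM; split=> [v|i X rX v].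
  have [r [rw ->]] := wM v; exists [seq (up p.1, p.2) | p <- r]; rewrite big_map.
  split=> // _ /mapP[p pr ->] /=; exact: twisted_weight_vector (rw p pr).
have rX' : root_vector (ahat D (sigma i)) (tw_map t X) \/
    root_vector (- ahat D (sigma i)) (tw_map t X).
  case: rX => rX; [left | right]; apply: tw_map_root rX => H; first exact: s_ahat.
  by rewrite !opp_lfunE s_ahat.
have [n nv] := nM _ _ rX' v; exists n.
rewrite -[RHS]nv; apply: eq_iter => u; case: rX => rX; apply: (twisted_root_act _ rX).
  exact: ahat_neq0.
by move=> /eqP; rewrite oppr_eq0 => /eqP; apply: ahat_neq0.
Qed.

Lemma twisted_highest_weight (M : lieModType ghat) mu (v : M) :
  highest_weight_vector mu v -> highest_weight_vector (up mu) (v : twisted t M).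
Proof.
case=> v0 vm vp; split=> //; first exact: twisted_weight_vector.
move=> c X c0 rX; have cn0 : Qcomb D c <> 0 := Qcomb_vector_eq0 c0.
(* The automorphism permutes the simple roots by [sigma], so coefficients [c] become [c] composed
   with the inverse of [sigma]. *)
rewrite (twisted_root_act _ rX cn0); apply: (vp (fun i => c ((sigma^-1)%g i))).
  by case: c0 => i ci; exists (sigma i); rewrite permK.
apply: (tw_map_root (mu := Qcomb D c)) => // H.
rewrite -/(Qcomb D (fun i => c ((sigma^-1)%g i))) !QcombE.
rewrite (reindex_inj (@perm_inj _ sigma)); apply: eq_bigr => i _.
by rewrite permK s_ahat.
Qed.

Lemma twisted_simple (M : lieModType ghat) mu :
  is_simple_integrable M mu -> is_simple_integrable (twisted t M) (up mu).
Proof.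
case=> iM irr [v hv]; split; first exact: twisted_integrable.
  exact: twisted_irreducible.
by exists v; apply: twisted_highest_weight.
Qed.

Lemma dominant_up mu : dominant mu -> dominant (up mu).
Proof.
move=> dm i; have [n nE] := dm (sigma i); exists n.
by rewrite upE s_coroot chi_coroot addr0.
Qed.

End WeightTwist.

Lemma weight_up_exists (K : numFieldType) (g : finLieAlgType K) (I : finType)
    (D : cartanData g I) (f : hhat D -> hhat D) (chi : hhat D -> K) :
  linear f -> linear (chi : hhat D -> K^o) ->
  exists up : weight D -> weight D, forall mu H, up mu H = (mu (f H) : K) + chi H :> K.
Proof.
move=> lf lchi; suff /choice[up upE] : forall mu : weight D, exists nu : weight D,
    forall H, nu H = (mu (f H) : K) + chi H :> K by exists up.
move=> mu.
apply: (@lfun_of_linear K _ _ (fun H => (mu (f H) : K) + chi H : K^o)) => a H H'.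
by rewrite lf lchi linearP scalerDr addrACA.
Qed.

(** * Comparison of the two tensor products *)

Section Main.
Context (K : numFieldType) (g : finLieAlgType K) (I : finType).
Context (D : cartanData g I) (sigma : {perm option I}).

Notation ghat := (affine (nform D)).

Theorem twisted_tensor_multiplicity (Lambda Phi : weight D) (c : option I -> nat)
    (Vj V V0 V' T T' : lieModType (affine (nform D)))
    (tau : Vj -> V -> T) (tau' : V0 -> V' -> T') :
  simple_lie g ->
  diagram_automorphism D sigma ->
  let j := sigma None in
  Lambda_hat D j + Lambda - Phi = \sum_i (c i)%:R *: ahat D i ->
  is_simple_integrable Vj (Lambda_hat D j) ->
  is_simple_integrable V Lambda ->
  is_simple_integrable V0 (Lambda_hat D None) ->
  is_simple_integrable V' (twist sigma Lambda) ->
  tensor_product tau -> tensor_product tau' ->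
  multiplicity T Phi =
  multiplicity T'
    (twist sigma Phi + ((c None)%:R - (c j)%:R) *: delta D).
Proof.
move=> sg diag j cE sVj sV sV0 sV' tt tt'.
have [d' d'E] := coweight_hat D (sigma None).
have [e [f [re rf ef gen]]] := affine_chevalley D sg.
have [phi [psi [lphi phi_lie phiK psiK phiH]]] := diagram_lift diag d'E re rf ef gen.
pose s := hhat_twist sigma d'; rewrite -/s in phiH.
have ls : linear s by exact: hhat_twist_linear.
have [s' sK s'K] : exists2 s', cancel s s' & cancel s' s.
  have [F FE] := lfun_of_linear ls.
  have kF : lker F == 0%VS.
    rewrite -subv0; apply/subvP => X; rewrite memv_ker memv0 FE => /eqP.
    by move=> /(hhat_twist_inj diag d'E) ->.
  exists (fun H => (F^-1)%VF H) => H; first by rewrite -FE lker0_lfunK.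
  by rewrite -FE lker0_lfunVK.
have ls' : linear s'.
  by move=> a H H'; apply: (can_inj sK); rewrite ls !s'K.
have lchi (a : K) : linear ((fun X : ghat => a * X.2) : ghat -> K^o).
  by move=> b [[? ?] x] [[? ?] y] /=; rewrite mulrDr mulrCA.
(* No bracket has a [d] component, so any multiple of the coefficient of [d] is a character. *)
have chi_lie (a : K) (X Y : ghat) : a * [lie X, Y].2 = 0.
  by case: X Y => [[? ?] x] [[? ?] y] /=; rewrite mulr0.
pose tw a := LieTwist lphi phi_lie phiK psiK (lchi a) (chi_lie a).
have chi0 a i : tw_chi (tw a) (hhat_in (coroot_hat D i)) = 0.
  by case: i => [i|]; rewrite /= mulr0.
have scor : forall i, s (coroot_hat D i) = coroot_hat D (sigma i).
  exact: hhat_twist_coroot.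
have sah i H : ahat D (sigma i) (s H) = ahat D i H :> K by exact: ahat_hhat_twist.
have upex a : exists up : weight D -> weight D, forall mu H,
    up mu H = (mu (s H) : K) + tw_chi (tw a) (hhat_in H) :> K.
  apply: weight_up_exists => // b H H'.
  by rewrite hhat_in_linear; exact: (lchi a).
have twE (mu : weight D) H : mu (s H) = (twist sigma mu H : K)
    + (mu d' - mu (0, 0, 1) : K) * (delta D H : K) :> K.
  by rewrite (twistE sigma d') subrK.
have upE a (up : weight D -> weight D) :
    (forall mu H, up mu H = (mu (s H) : K) + tw_chi (tw a) (hhat_in H) :> K) ->
    forall (mu : weight D) b, a + (mu d' - mu (0, 0, 1) : K) = b -> up mu = twist sigma mu + b *: delta D.
  move=> uE mu b <-; apply: weight_inj => H; rewrite uE twE add_lfunE scale_lfunE /=.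
  by rewrite deltaE -addrA; congr (_ + _); rewrite -mulrDl addrC.
(* These scalars cancel the multiples of [delta] by which the pull-backs of [Lambda_j] and [Lambda]
   differ from their images under [sigma]. *)
pose a1 : K := - (Lambda_hat D j d' - Lambda_hat D j (0, 0, 1)).
pose a2 : K := - (Lambda d' - Lambda (0, 0, 1)).
have [up1 up1E] := upex a1; have [up2 up2E] := upex a2.
have [up uE] := upex (a1 + a2).
have e1 : up1 (Lambda_hat D j) = Lambda_hat D None.
  rewrite (upE _ _ up1E _ 0) ?addNr // scale0r addr0 twist_Lambda_hat /j.
  by rewrite permK.
have e2 : up2 Lambda = twist sigma Lambda.
  by rewrite (upE _ _ up2E _ 0) ?addNr // scale0r addr0.
have e3 : up Phi = twist sigma Phi + ((c None)%:R - (c j)%:R) *: delta D.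
  apply: (upE _ _ uE); rewrite /a1 /a2.
  have ev H := congr1 (fun m : weight D => m H : K) cE.
  have := ev d'; have := ev (0, 0, 1).
  rewrite -/(Qcomb D c) !QcombE !add_lfunE !opp_lfunE.
  (* At [d] only the term of [alpha_0] survives, at [d'] only that of [alpha_j]. *)
  rewrite (bigD1 None) //= big1 => [|[i|] //= _]; last by rewrite extE linear0 mulr0.
  rewrite (bigD1 j) //= big1 => [|i ij]; last by rewrite d'E (negPf ij) mulr0.
  rewrite d'E eqxx add_lfunE opp_lfunE extE deltaE /= linear0 subr0 !mulr1 !addr0.
  move: (Lambda_hat D j d' : K) (Lambda_hat D j (0, 0, 1) : K) (Lambda d' : K)
    (Lambda (0, 0, 1) : K) (Phi d' : K) (Phi (0, 0, 1) : K) => x1 x2 y1 y2 z1 z2.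
  by move=> <- <-; ring.
have hw1 := twisted_simple (t := tw a1) phiH s'K sah up1E sVj.
have hw2 := twisted_simple (t := tw a2) phiH s'K sah up2E sV.
rewrite e1 in hw1; rewrite e2 in hw2.
have [F1 [G1 [hF1 F1K G1K]]] : exists (F : twisted (tw a1) Vj -> V0) (G : V0 -> twisted (tw a1) Vj),
    [/\ module_hom F, cancel F G & cancel G F].
  case: hw1 => _ irr1 [v1 h1]; case: sV0 => _ irr0 [v0 h0].
  exact: (highest_weight_iso irr1 irr0 h1 h0).
have [F2 [G2 [hF2 F2K G2K]]] : exists (F : twisted (tw a2) V -> V') (G : V' -> twisted (tw a2) V),
    [/\ module_hom F, cancel F G & cancel G F].
  case: hw2 => _ irr1 [v1 h1]; case: sV' => _ irr0 [v0 h0].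
  exact: (highest_weight_iso irr1 irr0 h1 h0).
have ttw := twisted_tensor (t := tw (a1 + a2)) (t1 := tw a1) (t2 := tw a2)
  (fun=> erefl) (fun=> erefl) (fun X => mulrDl a1 a2 X.2) tt.
have [F [G [hF FK GK]]] := tensor_iso ttw tt' hF1 F1K G1K hF2 F2K G2K.
pose t := tw (a1 + a2); pose ti := inv_twist t.
have tiH H : tw_map ti (hhat_in H) = hhat_in (s' H) by rewrite -{1}[H]s'K /= -phiH phiK.
have s'cor i : s' (coroot_hat D i) = coroot_hat D ((sigma^-1)%g i).
  by rewrite -{1}(permKV sigma i) -scor sK.
have s'ah i H : ahat D ((sigma^-1)%g i) (s' H) = ahat D i H :> K.
  by rewrite -sah permKV s'K.
have chi0i i : tw_chi ti (hhat_in (coroot_hat D i)) = 0.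
  have := tiH (coroot_hat D i); rewrite s'cor /= => ->.
  by have := chi0 (a1 + a2) ((sigma^-1)%g i); rewrite /= => ->; rewrite oppr0.
have [dn dnE] : exists dn : weight D -> weight D, forall mu H,
    dn mu H = (mu (s' H) : K) + tw_chi ti (hhat_in H) :> K.
  apply: weight_up_exists => // b H H'.
  by rewrite hhat_in_linear; exact: (tw_chi_linear ti).
have chiti H : tw_chi ti (hhat_in H) = - tw_chi t (hhat_in (s' H)).
  by rewrite -tiH.
have dnK : cancel dn up.
  by move=> mu; apply: weight_inj => H; rewrite uE dnE chiti sK subrK.
have upK : cancel up dn.
  by move=> mu; apply: weight_inj => H; rewrite dnE uE chiti s'K addrK.
have sup (M : lieModType ghat) mu : dominant mu -> is_simple_integrable M mu ->
    dominant (up mu) /\ is_simple_integrable (twisted t M) (up mu).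
  move=> dm sM; split.
    exact: (dominant_up scor (chi0 (a1 + a2)) uE dm).
  exact: (twisted_simple (t := t) phiH s'K sah uE sM).
have sdn (M : lieModType ghat) mu : dominant mu -> is_simple_integrable M mu ->
    dominant (dn mu) /\ is_simple_integrable (twisted ti M) (dn mu).
  move=> dm sM; split.
    exact: (dominant_up s'cor chi0i dnE dm).
  exact: (twisted_simple (t := ti) tiH sK s'ah dnE sM).
have [[m dT]|nT] := pselect (exists m, decomposes T m).
  have dT' := decomposes_transport dnK upK sup hF FK GK dT.
  by rewrite (multiplicity_eq Phi dT) -e3 (multiplicity_eq (up Phi) dT') /= upK.
(* The left side is 0 by convention. A decomposition of [T'] would come back to one of [T] through
   the inverse twist, so the right side is 0 as well. *)
rewrite /multiplicity; case: pselect => [//|_]; case: pselect => // -[m' dT'].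
case: nT; exists (m' \o up).
apply: (@decomposes_transport K g I D ti dn up upK dnK sdn T' T G F m' _ GK FK dT').
exact: (@inv_twist_hom K _ t T T' F G hF FK GK).
Qed.

End Main.

Local Open Scope complex_scope.

Theorem mainTheorem2 (R : realType) (g : finLieAlgType R[i]) (I : finType)
    (D : cartanData g I) (sigma : {perm option I}) (Lambda Phi : weight D)
    (c : option I -> nat)
    (Vj V V0 V' T T' : lieModType (affine (nform D)))
    (tau : Vj -> V -> T) (tau' : V0 -> V' -> T') :
  simple_lie g ->
  diagram_automorphism D sigma ->
  dominant Lambda -> dominant Phi ->
  let j := sigma None in
  Lambda_hat D j + Lambda - Phi = \sum_i (c i)%:R *: ahat D i ->
  is_simple_integrable Vj (Lambda_hat D j) ->
  is_simple_integrable V Lambda ->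
  is_simple_integrable V0 (Lambda_hat D None) ->
  is_simple_integrable V' (twist sigma Lambda) ->
  tensor_product tau -> tensor_product tau' ->
  multiplicity T Phi =
  multiplicity T'
    (twist sigma Phi + ((c None)%:R - (c j)%:R) *: delta D).
Proof.
move=> sg diag _ _ j cE sVj sV sV0 sV'.
exact: (twisted_tensor_multiplicity sg diag cE sVj sV sV0 sV').
Qed.
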